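(* Let $1\le p<q<\infty$ and $r_0>0$. Assume that $E\subset X$ is totally bounded and that for all balls centred in $E$ and of radius at most $r_0$ the following hold: (a) There are constants $C,\delta>0$ such that for all $x\in E$ and all $0<r'<r\le r_0$, $$0<\mu(B(x,2r))\le C\mu(B(x,r))<\infty,\qquad 0<\nu(B(x,2r))\le C\nu(B(x,r))<\infty,\qquad \frac{\nu(B(x,r'))}{\nu(B(x,r))}\le C\Bigl(\frac{r'}{r}\Bigr)^{\delta}.$$ (b) $\mu$ supports the $p$-Poincar\'e inequality: there are constants $C>0$ and $\lambda\ge1$ such that for all balls $B$ centred in $E$ of radius at most $r_0$ and all $u\in L^1_{\rm loc}(X,\mu)$ with a minimal $p$-weak upper gradient $g_u\in L^p(X,\mu)$, $$\frac1{\mu(B)}\int_B|u-u_{B,\mu}|\,d\mu\le C\operatorname{diam}(B)\biggl(\frac1{\mu(\lambda B)}\int_{\lambda B}g_u^p\,d\mu\biggr)^{1/p}.$$ Let $\mathcal{Y}=N^{1,p}(X,\mu)$ or $\mathcal{Y}=D^p(X,\mu)\cap L^1(E,\nu)$, equipped with the norms $\|u\|_{N^{1,p}(X,\mu)}$ and $\|g_u\|_{L^p(X,\mu)}+\|u\|_{L^1(E,\nu)}$, respectively. Then the embedding $\mathcal{Y}\hookrightarrow L^q(E,\nu)$ is bounded whenever $$\sup_{0<r<r_0}\ \sup_{x\in E}\frac{r\,\nu(B(x,r))^{1/q}}{\mu(B(x,r))^{1/p}}<\infty,\qquad(1)$$ and compact whenever $$\sup_{x\in E}\frac{r\,\nu(B(x,r))^{1/q}}{\mu(B(x,r))^{1/p}}\to0\quad\text{as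 }r\to0.\qquad(2)$$ If $\nu$ also satisfies the measure density condition $\nu(B(x,r)\cap E)\ge c\,\nu(B(x,r))$ with some $c>0$, for all $x\in E$ and $0<r\le r_0$ (in particular, if $\nu(X\setminus E)=0$), then (1) and (2) are also necessary for the boundedness and compactness, respectively, of $\mathcal{Y}\hookrightarrow L^q(E,\nu)$.
   Context: $(X,d)$ is a metric space with positive complete Borel measures $\mu,\nu$, and $E\subset X$ is $\nu$-measurable with $\nu(E)>0$. $B(x,r)$ is the open ball, balls come with a fixed centre and radius, $\lambda B(x,r)=B(x,\lambda r)$, $u_{B,\mu}=\mu(B)^{-1}\int_Bu\,d\mu$. $u\in L^1_{\rm loc}(X,\mu)$ means $u\in L^1(B,\mu)$ for all balls $B$. A Borel function $g:X\to[0,\infty]$ is an upper gradient of $u:X\to[-\infty,\infty]$ if for all rectifiable curves $\gamma:[0,l_\gamma]\to X$, $|u(\gamma(0))-u(\gamma(l_\gamma))|\le\int_\gamma g\,ds$ (left-hand side interpreted as $\infty$ if at least one of the terms is infinite). A $p$-weak upper gradient is required to satisfy this only for $p$-almost every curve, i.e. outside a curve family $\Gamma$ for which there is $0\le\rho\in L^p(X,\mu)$ with $\int_\gamma\rho\,ds=\infty$ for all $\gamma\in\Gamma$. If $u$ has an upper gradient in $L^p_{\rm loc}(X,\mu)$, it has a $\mu$-a.e. unique minimal $p$-weak upper gradient $g_u\in L^p_{\rm loc}(X,\mu)$ (i.e. $g_u\le g$ $\mu$-a.e. for every $p$-weak upper gradient $g\in L^p_{\rm loc}(X,\mu)$). $N^{1,p}(X,\mu)$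 is the set of $u$ with $\|u\|_{N^{1,p}(X,\mu)}=\bigl(\int_X|u|^p\,d\mu+\inf_g\int_Xg^p\,d\mu\bigr)^{1/p}<\infty$, the infimum over all ($p$-weak) upper gradients $g$ of $u$. $D^p(X,\mu)$ consists of all $u\in L^1_{\rm loc}(X,\mu)$ having an upper gradient in $L^p(X,\mu)$. Embeddings into $L^q(E,\nu)$ (and membership in $L^1(E,\nu)$) are understood through $\bar u$, where $\bar u(x)=\limsup_{r\to0}\mu(B(x,r))^{-1}\int_{B(x,r)}u\,d\mu$, $x\in E$: the embedding is the map $u\mapsto\bar u$. It is compact if every bounded sequence in $\mathcal{Y}$ has a subsequence whose images converge in $L^q(E,\nu)$, and bounded if $\|\bar u\|_{L^q(E,\nu)}\le C\|u\|_{\mathcal{Y}}$ for all $u\in\mathcal{Y}$. *)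

(* Defs.v *)
From HB Require Import structures.
From mathcomp Require Import all_boot all_order all_algebra.
From mathcomp Require Import all_classical all_reals all_analysis.
From mathcomp Require Import measurable_realfun.

Set Implicit Arguments.
Unset Strict Implicit.
Unset Printing Implicit Defensive.

Import Order.TTheory GRing.Theory Num.Theory.
Import numFieldNormedType.Exports.

Local Open Scope classical_set_scope.
Local Open Scope ring_scope.
Local Open Scope ereal_scope.

(* Measurable types of the library are pointed, hence so are the metric spaces
   considered here; a space carrying a set of positive measure is nonempty. *)
#[short(type="pmetricType")]
HB.structure Definition PointedMetric (K : numDomainType) :=
  { M of Pointed M & Metric K M }.

Section metric_spaces.
Context {R : realType} {X : pmetricType R}.
Implicit Types (A E : set X) (u g : X -> \bar R) (c : R -> X) (l : R).

Definition diam A : \bar R :=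
  ereal_sup [set (mdist y z)%:E | y in A & z in A].

Definition totally_bounded E : Prop :=
  forall e : R, (0 < e)%R ->
  exists2 F : set X, finite_set F & E `<=` \bigcup_(x in F) ball x e.

Definition borel_set : set (set X) := <<s (open : set (set X)) >>.

Definition borel_fun g : Prop :=
  measurable_fun setT (g : g_sigma_algebraType (open : set (set X)) -> \bar R).

(* Two measures on X may have different measurable sets, so the sigma-algebra
   S of a measure is an explicit argument, and the measure lives on the copy
   g_sigma_algebraType S of X.  A complete Borel measure is the completion of
   a measure defined on the Borel sets. *)
Record complete_borel_measure (S : set (set X))
    (mu : {measure set (g_sigma_algebraType S) -> \bar R}) : Prop := {
  cbm_sigma_algebra : sigma_algebra [set: X] S ;
  cbm_open : open `<=` S ;
  cbm_complete : measure_is_complete mu ;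
  cbm_completion : forall A, S A -> exists B Z : set X,
    [/\ borel_set B, borel_set Z, mu Z = 0 & B `<=` A /\ A `<=` B `|` Z] }.

Definition curve_length c (a b : R) : \bar R :=
  ereal_sup [set (let P := nth b (a :: s) in
     \sum_(0 <= n < size s) mdist (c (P n)) (c (P n.+1)))%R%:E
   | s in itv_partition a b].

(* Rectifiable curves are nonconstant and parametrized by arc length on
   [0, l]; the values of c outside [0, l] are irrelevant. *)
Definition rectifiable_curve c l : Prop :=
  (0 < l)%R /\ forall s t : R, (0 <= s)%R -> (s <= t)%R -> (t <= l)%R ->
    curve_length c s t = (t - s)%:E.

Definition line_integral c l g : \bar R :=
  \int[lebesgue_measure]_(t in `[0%R, l]) g (c t).

(* In \bar R, a difference with an infinite term is infinite (in particular
   +oo - +oo = -oo), so the left-hand side is +oo as soon as u is infinite at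
   one of the endpoints. *)
Definition upper_gradient_along u g c l : Prop :=
  `|u (c 0%R) - u (c l)| <= line_integral c l g.

Definition upper_gradient u g : Prop :=
  [/\ borel_fun g, (forall x, 0 <= g x) &
      forall c l, rectifiable_curve c l -> upper_gradient_along u g c l].

End metric_spaces.

Section function_spaces.
Context {R : realType} {X : pmetricType R} {S : set (set X)}.
Variable mu : {measure set (g_sigma_algebraType S) -> \bar R}.
Implicit Types (D E : set X) (p : R) (u f g : X -> \bar R).

Definition Lpnorm D p f : \bar R := 'N[mu]_(p%:E)[f \_ D].

Definition in_Lp D p f : Prop :=
  measurable_fun (D : set (g_sigma_algebraType S)) (f : _ -> \bar R) /\ Lpnorm D p f < +oo.

Definition in_Lploc p f : Prop :=
  forall (x : X) (r : R), (0 < r)%R -> in_Lp (ball x r) p f.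

Definition exceptional p (G : set ((R -> X) * R)) : Prop :=
  exists rho : X -> \bar R,
    [/\ borel_fun rho, (forall x, 0 <= rho x), in_Lp setT p rho &
        forall c l, G (c, l) -> rectifiable_curve c l ->
          line_integral c l rho = +oo].

Definition weak_upper_gradient p u g : Prop :=
  [/\ borel_fun g, (forall x, 0 <= g x) &
      exists2 G : set ((R -> X) * R), exceptional p G &
        forall c l, rectifiable_curve c l -> ~ G (c, l) ->
          upper_gradient_along u g c l].

Definition minimal_weak_upper_gradient p u g : Prop :=
  [/\ weak_upper_gradient p u g, in_Lploc p g &
      forall g', weak_upper_gradient p u g' -> in_Lploc p g' ->
        {ae mu, forall x, g x <= g' x}].

(* g_u; the default value +oo is only taken when u has no minimal p-weak
   upper gradient. *)
Definition min_upper_gradient p u : X -> \bar R :=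
  xget (cst +oo) [set g | minimal_weak_upper_gradient p u g].

Definition average u (x : X) (r : R) : \bar R :=
  (mu (ball x r))^-1 * \int[mu]_(y in ball x r) u y.

Definition limsup_average u (x : X) : \bar R :=
  limf_esup (average u x) 0^'+.

Definition poincare_inequality p E (r0 : R) : Prop :=
  exists C lam : R, [/\ (0 < C)%R, (1 <= lam)%R &
    forall (x : X) (r : R), E x -> (0 < r)%R -> (r <= r0)%R ->
    forall u g, in_Lploc 1 u -> minimal_weak_upper_gradient p u g ->
      in_Lp setT p g ->
      (mu (ball x r))^-1 *
        \int[mu]_(y in ball x r) `|u y - average u x r|
      <= C%:E * diam (ball x r) *
         ((mu (ball x (lam * r)))^-1 *
           \int[mu]_(y in ball x (lam * r)) (g y `^ p)) `^ p^-1].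

Record function_space := FunctionSpace {
  fs_mem : set (X -> \bar R) ;
  fs_norm : (X -> \bar R) -> \bar R }.

Definition newtonian_norm p u : \bar R :=
  (\int[mu]_y (`|u y| `^ p) +
   ereal_inf [set \int[mu]_y (g y `^ p) | g in upper_gradient u]) `^ p^-1.

Definition newtonian_space p : function_space := {|
  fs_mem := [set u |
    measurable_fun setT (u : g_sigma_algebraType S -> \bar R) /\
    newtonian_norm p u < +oo] ;
  fs_norm := newtonian_norm p |}.

Definition dirichlet_mem p u : Prop :=
  in_Lploc 1 u /\ exists2 g, upper_gradient u g & in_Lp setT p g.

End function_spaces.

Section embeddings.
Context {R : realType} {X : pmetricType R} {Smu Snu : set (set X)}.
Variable mu : {measure set (g_sigma_algebraType Smu) -> \bar R}.
Variable nu : {measure set (g_sigma_algebraType Snu) -> \bar R}.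
Implicit Types (E : set X) (p q : R) (Y : @function_space R X).

(* D^p(X, mu) \cap L^1(E, nu) *)
Definition dirichlet_space p E : function_space := {|
  fs_mem := [set u | dirichlet_mem mu p u /\
                     in_Lp nu E 1 (limsup_average mu u)] ;
  fs_norm := fun u => Lpnorm mu setT p (min_upper_gradient mu p u) +
                      Lpnorm nu E 1 (limsup_average mu u) |}.

Definition bounded_embedding Y E q : Prop :=
  exists2 C : R, (0 < C)%R & forall u, fs_mem Y u ->
    in_Lp nu E q (limsup_average mu u) /\
    Lpnorm nu E q (limsup_average mu u) <= C%:E * fs_norm Y u.

Definition compact_embedding Y E q : Prop :=
  forall (u : nat -> X -> \bar R) (M : R),
    (forall n, fs_mem Y (u n) /\ fs_norm Y (u n) <= M%:E) ->
  exists (phi : nat -> nat) (v : X -> \bar R),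
    [/\ {homo phi : m n / (m < n)%N},
        forall n, in_Lp nu E q (limsup_average mu (u (phi n))),
        in_Lp nu E q v &
        Lpnorm nu E q (fun x => limsup_average mu (u (phi n)) x - v x)
          @[n --> \oo] --> 0].

Definition doubling_conditions E (r0 : R) : Prop :=
  exists C delta : R, [/\ (0 < C)%R, (0 < delta)%R &
    forall (x : X) (r' r : R), E x -> (0 < r')%R -> (r' < r)%R ->
      (r <= r0)%R ->
    [/\ 0 < mu (ball x (2 * r)) /\
        mu (ball x (2 * r)) <= C%:E * mu (ball x r) < +oo,
        0 < nu (ball x (2 * r)) /\
        nu (ball x (2 * r)) <= C%:E * nu (ball x r) < +oo &
        nu (ball x r') / nu (ball x r) <= (C * (r' / r) `^ delta)%:E]].

Definition measure_density E (r0 : R) : Prop :=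
  exists2 c : R, (0 < c)%R &
    forall (x : X) (r : R), E x -> (0 < r)%R -> (r <= r0)%R ->
      c%:E * nu (ball x r) <= nu (ball x r `&` E).

Definition sup_ratio E p q (r : R) : \bar R :=
  ereal_sup [set r%:E * nu (ball x r) `^ q^-1 / mu (ball x r) `^ p^-1
            | x in E].

End embeddings.

(* Main.v *)
(* Write g for the minimal p-weak upper gradient of u and B_j for the balls
   B(x, R / 2^j).  Telescoping the averages of u over the B_j and applying the
   Poincare inequality on each of them bounds |ubar(x) - u_{B_0}| by a sum of
   terms r_j (mu(B_j)^-1 int_{lam B_j} g^p)^(1/p).  By (1) such a term is at most
   a constant times nu(lam B_j)^(-1/q) (int_{lam B_j} g^p)^(1/p), and splitting
   the sum as Hedberg does, using the geometric decay of nu(B_j), bounds it by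
   (int g^p)^(1/p - 1/q) M(x)^(1/q), where M(x) is the supremum over j of
   nu(lam B_j)^-1 int_{lam B_j} g^p.  The covering argument for M, with Vitali's
   lemma for finitely many balls since E is totally bounded, gives a weak type
   (p, q) estimate, and Maz'ya's truncation method upgrades it to the strong
   type; the truncations have localized gradients because u is absolutely
   continuous along almost every curve.

   The constant in these estimates is proportional to the one in (1) at small
   radii, so under (2) the oscillation of u at a small scale R is small in
   measure, while at scale R the function u is described up to this error by
   its averages over the finitely many balls of a net.  Along an ultrafilter all
   these averages converge; a bounded sequence is thus Cauchy in measure along
   it, and the strong type estimate makes it Cauchy in L^q.

   For the necessity, both conditions are tested on tents a min(1, 2 - 2d/r)+
   over balls B(x, r): their L^q norm is comparable to a nu(B)^(1/q), and their
   norm in Y is at most a constant times a (mu(B)^(1/p) / r + nu(B)), where the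
   second term is negligible for small r because q > 1. *)

Require Import Defs.
From mathcomp Require Import all_boot all_order all_algebra.
From mathcomp Require Import all_classical all_reals all_analysis.
From mathcomp Require Import measurable_realfun.
From mathcomp Require Import ring lra.

Set Implicit Arguments.
Unset Strict Implicit.
Unset Printing Implicit Defensive.

Import Order.TTheory GRing.Theory Num.Theory.
Import numFieldNormedType.Exports.

Local Open Scope classical_set_scope.
Local Open Scope ring_scope.
Local Open Scope ereal_scope.

(** * Functions on an interval with integrably controlled increments *)

(** The measures mu and nu are unrelated, and the hypotheses speak only of small balls centred in E.
    So ubar has to be controlled on E through averages over such balls, and even the convergence of
    these averages nu-almost everywhere on E has to come from the maximal estimate. Both spaces
    enter through pairs (f, G) of a real-valued representative and a p-integrable weak upper
    gradient, a class closed under differences and under slicing between two levels. Slicing is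
    delicate: a weak upper gradient must be Borel, while the level sets of f are only mu-measurable,
    so gradients are restricted to Borel supersets. The levels start at a multiple of a bound H for
    the averages of |f| at the top scale: a slice then has a small average there, and the bound for
    its deviation from the average becomes a bound for a level set. Such an H is immediate in
    N^{1,p}; in D^p it has to be recovered from the L^1(E, nu) bound. For compactness, only the
    largest values of u are left to the strong type estimate and its small constant; the
    intermediate values are bounded, and the set where they occur is estimated at a second scale,
    chosen afterwards. *)

Section real_line.
Context {R : realType}.
Implicit Types (k : R -> R) (l : R).

(** Induction along the interval: by superadditivity of [I], the supremum of the endpoints up to
    which the bound holds is attained, and a local step leads beyond it unless it equals [l]. *)
Lemma local_to_global k (I : R -> R -> \bar R) l : (0 <= l)%R ->
  (forall a b, 0 <= I a b) ->
  (forall a b c, (0 <= a <= b)%R -> (b <= c <= l)%R -> I a b + I b c <= I a c) ->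
  (forall u, (0 <= u <= l)%R -> exists2 d : R, (0 < d)%R &
    forall s t, (0 <= s <= t)%R -> (t <= l)%R -> (`|s - u| < d)%R ->
      (`|t - u| < d)%R -> `|k t - k s|%:E <= I s t) ->
  `|k l - k 0|%:E <= I 0%R l.
Proof.
move=> l0 I0 Iadd loc.
pose S := [set t | (0 <= t <= l)%R /\ `|k t - k 0|%:E <= I 0%R t].
have S0 : S 0%R by split; rewrite ?lexx//= subrr normr0.
have hS : has_sup S by split; [exists 0%R|exists l => t [/andP[]]].
have supS t : S t -> (t <= sup S)%R by move=> St; apply: ub_le_sup => //; exact: hS.2.
have s0 : (0 <= sup S)%R by exact: supS.
have sl : (sup S <= l)%R by apply: ge_sup; [exists 0%R|move=> t [/andP[]]].
have [d d0 locd] := loc (sup S) (introT andP (conj s0 sl)).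
have [t St tS] := sup_adherent d0 hS.
(* One local step joins a point [t] of [S] close to [sup S] to any later [t'] close to [sup S]. It
   serves both to attain the supremum and to pass it. *)
have ext t' : (t <= t' <= l)%R -> (`|t' - sup S| < d)%R -> S t'.
  move=> /andP[tt' t'l] t'S; case: St => /andP[t0 tl] tI; split.
    by rewrite t'l (le_trans t0).
  have tS' : (`|t - sup S| < d)%R.
    rewrite distrC ger0_norm ?subr_ge0; last by apply: supS; split; rewrite ?t0.
    by rewrite ltrBlDl -ltrBlDr.
  apply: le_trans (Iadd 0%R t t' _ _); rewrite ?lexx ?t0 ?tt'//.
  apply: le_trans (leeD tI (locd t t' _ t'l tS' t'S)); last by rewrite t0.
  by rewrite -EFinD lee_fin [leRHS]addrC; exact: ler_distD.
have tsup : (t <= sup S)%R by exact: supS.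
have SS : S (sup S) by apply: ext; rewrite ?tsup// subrr normr0.
have [lS|Sl] := leP l (sup S).
  by have -> : l = sup S by [apply/eqP; rewrite eq_le lS sl]; case: SS.
have : S (Num.min l (sup S + d / 2))%R.
  apply: ext.
    by rewrite ge_min lexx/= le_min (le_trans tsup)//= (le_trans tsup)// lerDl divr_ge0// ltW.
  rewrite ger0_norm; last by rewrite subr_ge0 le_min sl/= lerDl divr_ge0// ltW.
  rewrite ltrBlDl gt_min; apply/orP; right; rewrite ltrD2l ltr_pdivrMr//.
  by rewrite ltr_pMr// ltr1n.
move/supS; rewrite ge_min leNgt Sl/= gerDl leNgt divr_gt0//.
Qed.

End real_line.

Section absolute_continuity.
Context d (T : measurableType d) (R : realType).
Variable mu : {measure set T -> \bar R}.

(** Truncation: the integrals of f and min(f, n) over D differ by less than e/2 for some n, and the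
    integral of min(f, n) over A is at most n mu(A). *)
Lemma integral_abs_cont (D : set T) (f : T -> \bar R) : measurable D ->
  measurable_fun D f -> (forall x, D x -> 0 <= f x) ->
  \int[mu]_(x in D) f x < +oo ->
  forall e : R, (0 < e)%R -> exists2 a : R, (0 < a)%R &
    forall A, measurable A -> A `<=` D -> mu A < a%:E ->
      \int[mu]_(x in A) f x < e%:E.
Proof.
move=> mD mf f0 foo e e0.
pose h (n : nat) x := mine (f x) n%:R%:E.
have mh n : measurable_fun D (h n) by apply: measurable_mine => //.
have h0 n x : D x -> 0 <= h n x by move=> Dx; rewrite /h le_min f0//= lee_fin.
have hf x n : h n x <= f x by rewrite /h ge_min lexx.
have hnd x : D x -> nondecreasing_seq (h ^~ x).
  move=> Dx m n mn; rewrite /h le_min ge_min lexx/= ge_min.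
  by apply/orP; right; rewrite lee_fin ler_nat.
have hcvg x : D x -> h n x @[n --> \oo] --> f x.
  move=> Dx; rewrite /h; have := f0 _ Dx.
  case: (f x) => [r| |//]; rewrite ?lee_fin => r0.
    apply: cvg_near_cst; exists (Num.truncn r).+1 => // n/= rn.
    apply/min_idPl; rewrite lee_fin ltW// (lt_le_trans (truncnS_gt r))//.
    by rewrite ler_nat.
  rewrite (_ : (fun n => _) = fun n => n%:R%:E).
    by apply/cvgeryP; exact: cvgr_idn.
  by apply/funext => n; apply/min_idPr; rewrite leey.
have /= cvgI := @cvg_monotone_convergence _ _ _ mu _ mD _ mh h0 hnd.
have limh x : D x -> limn (h ^~ x) = f x by move=> Dx; apply/cvg_lim => //; exact: hcvg.
rewrite (eq_integral f) in cvgI; last by move=> x /[!inE] /limh.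
have fnum : \int[mu]_(x in D) f x \is a fin_num.
  by rewrite ge0_fin_numE// integral_ge0.
have [n nI] : exists n, \int[mu]_(x in D) f x - (e / 2)%:E < \int[mu]_(x in D) h n x.
  have : \forall n \near \oo, \int[mu]_(x in D) f x - (e / 2)%:E < \int[mu]_(x in D) h n x.
    apply: (cvgI [set y | \int[mu]_(x in D) f x - (e / 2)%:E < y]).
    apply: open_nbhs_nbhs; split.
      exact: open_ereal_gt_ereal.
    by rewrite /mkset lteBlDr// lteDl// lte_fin divr_gt0.
  by move=> [n _ /(_ n (leqnn _))]; exists n.
(* Makes n mu(A) at most e/2; [n.+1] avoids a division by zero at n = 0. *)
exists (e / (2 * n.+1%:R))%R; first by rewrite divr_gt0// mulr_gt0.
move=> A mA AD muA.
have mDA : measurable (D `\` A) by exact: measurableD.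
have splitI (g : T -> \bar R) : measurable_fun D g -> (forall x, D x -> 0 <= g x) ->
    \int[mu]_(x in D) g x = \int[mu]_(x in A) g x + \int[mu]_(x in D `\` A) g x.
  move=> mg g0; rewrite -ge0_integral_setU//.
  - by rewrite setDUK.
  - by rewrite setDUK.
  - by move=> x; rewrite setDUK//; exact: g0.
  - by apply/disj_setPS => x [/= Ax []].
have DAfin : \int[mu]_(x in D `\` A) f x \is a fin_num.
  rewrite ge0_fin_numE ?integral_ge0//; last by move=> x [Dx _]; exact: f0.
  by apply: le_lt_trans foo; apply: ge0_subset_integral.
move: nI; rewrite (splitI _ mf f0) (splitI _ (mh n) (h0 n)) lteBlDr//.
have hA : \int[mu]_(x in A) h n x <= n%:R%:E * mu A.
  rewrite -integral_cst//; apply: ge0_le_integral => //.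
  - by move=> x Ax; apply: h0; exact: AD.
  - exact: measurable_funS (mh n).
  - by move=> x _; rewrite /h ge_min lexx orbT.
have hDA : \int[mu]_(x in D `\` A) h n x <= \int[mu]_(x in D `\` A) f x.
  apply: ge0_le_integral => //.
  - by move=> x [Dx _]; exact: h0.
  - by apply: measurable_funS (mh n) => //; exact: subDsetl.
  - by apply: measurable_funS mf => //; exact: subDsetl.
move=> /lt_le_trans /(_ (leeD2r _ (leeD hA hDA))).
rewrite [X in _ < X]addeAC lteD2rE// => /lt_le_trans; apply.
apply: (@le_trans _ _ (n%:R%:E * (e / (2 * n.+1%:R))%:E + (e / 2)%:E)).
  by rewrite leeD2r// lee_wpmul2l ?lee_fin// ltW.
rewrite -EFinM -EFinD lee_fin [leRHS](splitr e) lerD2r.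
rewrite mulrA ler_pdivrMr ?mulr_gt0// mulrA mulfVK// mulrC ler_pM2l//.
by rewrite ler_nat.
Qed.

End absolute_continuity.

Section interval_integrals.
Context {R : realType}.
Notation lambda := (@lebesgue_measure R).
Implicit Types (k : R -> R) (l : R) (g : R -> \bar R).

(** Translation invariance follows from the uniqueness of Lebesgue measure, since translation
    preserves the length of half-open intervals. *)
Lemma ge0_integral_shift g (s t : R) : measurable_fun `[s, t] g ->
  (forall x, 0 <= g x) ->
  \int[lambda]_(x in `[s, t]) g x = \int[lambda]_(x in `[0%R, (t - s)%R]) g (s + x)%R.
Proof.
move=> mg g0.
pose phi : measurableTypeR R -> measurableTypeR R := fun x => (s + x)%R.
have mphi : measurable_fun setT phi by exact: measurable_funD.
have pre (a b : R) (b0 b1 : bool) :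
    phi @^-1` [set` Interval (BSide b0 a) (BSide b1 b)] =
    [set` Interval (BSide b0 (a - s)%R) (BSide b1 (b - s)%R)].
  apply/seteqP; split => x; rewrite /phi /= !in_itv/=; case: b0 => /=;
  case: b1 => /=; rewrite ?lerBlDl ?ltrBlDl ?lerBrDl ?ltrBrDl//.
have eqm (A : set R) : measurable A -> lambda A = pushforward lambda phi A.
  move=> mA; apply: lebesgue_measure_unique => //= _ [[a b]] _ <-.
  rewrite /pushforward/= pre !lebesgue_measure_itv/= !lte_fin ltrD2r.
  by case: ifP => // _; rewrite -!EFinD; congr EFin; ring.
rewrite (_ : `[0%R, (t - s)%R]%classic = phi @^-1` `[s, t]); last by rewrite pre subrr.
transitivity (\int[pushforward lambda phi]_(x in `[s, t]) g x).
  by apply: eq_measure_integral => //= A mA _; exact: eqm.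
by rewrite ge0_integral_pushforward.
Qed.

Lemma ge0_integral_itv_add g (a b c l : R) : measurable_fun `[0%R, l] g ->
  (forall x, 0 <= g x) -> (0 <= a <= b)%R -> (b <= c <= l)%R ->
  \int[lambda]_(x in `[a, b]) g x + \int[lambda]_(x in `[b, c]) g x =
  \int[lambda]_(x in `[a, c]) g x.
Proof.
move=> mg g0 /andP[a0 ab] /andP[bc cl].
have mgS (i : interval R) : [set` i] `<=` `[0%R, l]%classic ->
    measurable_fun [set` i] g.
  by move=> iS; apply: measurable_funS mg.
have sub : `]b, c]%classic `<=` `[0%R, l]%classic.
  move=> x/=; rewrite !in_itv/= => /andP[bx xc].
  by rewrite (le_trans a0 (le_trans ab (ltW bx))) (le_trans xc).
have subac : `[a, c]%classic `<=` `[0%R, l]%classic.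
  move=> x/=; rewrite !in_itv/= => /andP[ax xc].
  by rewrite (le_trans a0 ax) (le_trans xc).
rewrite -(integral_itv_obnd_cbnd (r := b)); last exact: mgS.
have -> : `[a, c]%classic = `[a, b] `|` `]b, c].
  by rewrite -itv_bndbnd_setU// bnd_simp.
rewrite ge0_integral_setU//.
- by rewrite -itv_bndbnd_setU ?bnd_simp//; exact: mgS.
- apply/disj_setPS => x [/=]; rewrite !in_itv/= => /andP[_ xb] /andP[bx _].
  by move: bx; rewrite ltNge xb.
Qed.

Lemma ge0_integral_itv_sub g (a b c d l : R) : measurable_fun `[0%R, l] g ->
  (forall x, 0 <= g x) -> (0 <= a)%R -> (a <= b)%R -> (c <= d)%R -> (d <= l)%R ->
  \int[lambda]_(x in `[b, c]) g x <= \int[lambda]_(x in `[a, d]) g x.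
Proof.
move=> mg g0 a0 ab cd dl; apply: ge0_subset_integral => //.
- apply: measurable_funS mg => // x/=; rewrite !in_itv/= => /andP[ax xd].
  by rewrite (le_trans a0 ax) (le_trans xd).
- by apply: subset_itv; rewrite bnd_simp.
Qed.

(** Outer regularity makes the measure of U minus A small, and the absolute continuity of the
    integral turns this into a small integral. *)
Lemma outer_open_integral g (A : set R) l : measurable A -> A `<=` `[0%R, l] ->
  measurable_fun `[0%R, l] g -> (forall x, 0 <= g x) ->
  \int[lambda]_(x in `[0%R, l]) g x < +oo ->
  forall e : R, (0 < e)%R -> exists U : set R, [/\ open U, A `<=` U &
    \int[lambda]_(x in `[0%R, l]) (g \_ (U `\` A)) x <= e%:E].
Proof.
move=> mA Al mg g0 goo e e0.
have [a a0 small] := integral_abs_cont (mu := lambda) (measurable_itv `[0%R, l]) mg (fun x _ => g0 x) goo e0.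
have lA : lambda A < +oo.
  apply: (le_lt_trans (le_measure lambda _ _ Al)); rewrite ?inE//.
  by rewrite /= lebesgue_measure_itv/=; case: ifPn => //; rewrite ltry.
have [U [oU AU UA]] := lebesgue_regularity_outer mA lA a0.
have mU : measurable U by exact: open_measurable.
exists U; split => //.
rewrite -integral_mkcondr; apply/ltW/small.
- by apply: measurableI => //; exact: measurableD.
- exact: subIsetl.
- apply: le_lt_trans UA; apply: le_measure; rewrite ?inE//.
  + by apply: measurableI => //; exact: measurableD.
  + exact: measurableD.
Qed.

Section increments.
Variables (k : R -> R) (l : R).

(** For integrable g this is absolute continuity of k with |k'| <= g almost everywhere, stated
    without derivatives. *)
Definition increments_le g := forall s t : R, (0 <= s <= t)%R -> (t <= l)%R ->
  `|k t - k s|%:E <= \int[lambda]_(x in `[s, t]) g x.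

Lemma increments_le_continuous g : measurable_fun `[0%R, l] g ->
  (forall x, 0 <= g x) -> \int[lambda]_(x in `[0%R, l]) g x < +oo ->
  increments_le g -> forall e : R, (0 < e)%R -> exists2 d : R, (0 < d)%R &
    forall s t, (0 <= s <= l)%R -> (0 <= t <= l)%R -> (`|t - s| < d)%R ->
    (`|k t - k s| < e)%R.
Proof.
move=> mg g0 goo kg e e0.
have [d d0 small] := integral_abs_cont (mu := lambda) (measurable_itv `[0%R, l]) mg (fun x _ => g0 x) goo e0.
exists d => // s t; wlog st : s t / (s <= t)%R.
  move=> H sl tl; have [/H|ts] := leP s t; first exact.
  by rewrite distrC (distrC (k _)); apply: H => //; exact: ltW.
move=> /andP[s0 sl] /andP[t0 tl]; rewrite ger0_norm ?subr_ge0// => tsd.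
rewrite -lte_fin; apply: le_lt_trans (kg s t _ tl) _; first by rewrite s0.
apply: small => //.
- by apply: subset_itv; rewrite bnd_simp.
- by rewrite /= lebesgue_measure_itv/=; case: ifPn => _; rewrite -?EFinB lte_fin.
Qed.

(* Open neighbourhoods of {g1 <= g2} and of its complement, chosen with small
   excess integral, reduce the claim to the two hypotheses locally; the local
   bounds are then glued by [local_to_global]. *)
Lemma increments_le_min g1 g2 : (0 <= l)%R ->
  measurable_fun `[0%R, l] g1 -> measurable_fun `[0%R, l] g2 ->
  (forall x, 0 <= g1 x) -> (forall x, 0 <= g2 x) ->
  \int[lambda]_(x in `[0%R, l]) g1 x < +oo ->
  \int[lambda]_(x in `[0%R, l]) g2 x < +oo ->
  increments_le g1 -> increments_le g2 ->
  `|k l - k 0|%:E <= \int[lambda]_(x in `[0%R, l]) mine (g1 x) (g2 x).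
Proof.
move=> l0 mg1 mg2 g10 g20 g1oo g2oo kg1 kg2; apply/lee_addgt0Pr => e e0.
pose A := `[0%R, l]%classic `&` [set x | g1 x <= g2 x].
pose B := `[0%R, l]%classic `\` A.
have mA : measurable A by exact: measurable_lee.
have mB : measurable B by exact: measurableD.
have e20 : (0 < e / 2)%R by rewrite divr_gt0.
have [U1 [oU1 AU1 U1e]] :=
  outer_open_integral mA (@subIsetl _ _ _) mg1 g10 g1oo e20.
have [U2 [oU2 BU2 U2e]] :=
  outer_open_integral mB (@subDsetl _ _ _) mg2 g20 g2oo e20.
have mU1 : measurable U1 by exact: open_measurable.
have mU2 : measurable U2 by exact: open_measurable.
have mres (g : R -> \bar R) C : measurable C -> measurable_fun `[0%R, l] g ->
    measurable_fun `[0%R, l] (g \_ C).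
  by move=> mC mg; apply/(measurable_restrict _ _ _) => //; exact: measurable_funS mg.
have res0 (g : R -> \bar R) C x : (forall x, 0 <= g x) -> 0 <= (g \_ C) x.
  by move=> g0; rewrite patchE; case: ifP.
pose m x := (g1 \_ U1) x + (g2 \_ U2) x.
have mm : measurable_fun `[0%R, l] m by apply: emeasurable_funD; exact: mres.
have m0 x : 0 <= m x by apply: adde_ge0; exact: res0.
have : `|k l - k 0|%:E <= \int[lambda]_(x in `[0%R, l]) m x.
  apply: (local_to_global (I := fun a b => \int[lambda]_(x in `[a, b]) m x)) => //.
  - by move=> a b; exact: integral_ge0.
  - by move=> a b c ab bc; rewrite (ge0_integral_itv_add mm).
  move=> u ul.
  have loc (g : R -> \bar R) (U : set R) : measurable_fun `[0%R, l] g ->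
      (forall x, 0 <= g x) -> increments_le g -> open U -> U u ->
      (forall x, (g \_ U) x <= m x) ->
      exists2 d : R, (0 < d)%R & forall s t : R, (0 <= s <= t)%R ->
      (t <= l)%R -> (`|s - u| < d)%R -> (`|t - u| < d)%R ->
      `|k t - k s|%:E <= \int[lambda]_(x in `[s, t]) m x.
    move=> mg g0 kg oU Uu gm.
    have : nbhs u U by exact: open_nbhs_nbhs.
    move=> /nbhs_ballP[d /= d0 dU]; exists d => // s t st tl su tu.
    apply: le_trans (kg _ _ st tl) _.
    have sub : `[s, t]%classic `<=` `[0%R, l]%classic.
      move/andP : st => [s0 st] x/=; rewrite !in_itv/= => /andP[sx xt].
      by rewrite (le_trans s0 sx) (le_trans xt).
    apply: ge0_le_integral => //.
    - exact: measurable_funS mg.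
    - exact: measurable_funS mm.
    move=> x /=; rewrite in_itv/= => /andP[sx xt].
    apply: le_trans (gm x); rewrite patchE ifT// inE; apply: dU.
    rewrite /ball/= distrC; move: su tu; rewrite !ltr_norml => /andP[su _] /andP[_ tu].
    by rewrite (lt_le_trans su) ?lerD2r//= (le_lt_trans _ tu)// lerD2r.
  have [Au|nAu] := pselect (A u).
    apply: (loc g1 U1) => //; first exact: AU1.
    by move=> x; rewrite /m leeDl// res0.
  apply: (loc g2 U2) => //; first by apply: BU2; split.
  by move=> x; rewrite /m leeDr// res0.
move/le_trans; apply.
apply: (@le_trans _ _ (\int[lambda]_(x in `[0%R, l])
   (mine (g1 x) (g2 x) + ((g1 \_ (U1 `\` A)) x + (g2 \_ (U2 `\` B)) x)))).
  apply: ge0_le_integral => //.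
  - apply: emeasurable_funD; first exact: measurable_mine.
    by apply: emeasurable_funD; apply: mres => //; exact: measurableD.
  move=> x xl; rewrite /m.
  have [Ax|nAx] := pselect (A x).
    have -> : mine (g1 x) (g2 x) = g1 x by apply/min_idPl; case: Ax.
    apply: leeD.
      by rewrite patchE; case: ifP.
    rewrite -[leLHS]add0e leeD//; first exact: res0.
    rewrite !patchE in_setD; have -> : x \in B = false.
      by apply/negbTE; rewrite notin_setE => -[_].
    by rewrite andbT.
  have Bx : B x by [].
  have -> : mine (g1 x) (g2 x) = g2 x.
    apply/min_idPr; rewrite leNgt; apply/negP => /ltW g12.
    by apply: nAx; split.
  rewrite addeCA; apply: leeD.
    rewrite !patchE in_setD; have -> : x \in A = false.
      by apply/negbTE; rewrite notin_setE.
    by rewrite andbT.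
  rewrite -[leLHS]adde0 leeD//; last exact: res0.
  by rewrite patchE; case: ifP.
have mmin : measurable_fun `[0%R, l] (fun x => mine (g1 x) (g2 x)).
  exact: measurable_mine.
have m1 : measurable_fun `[0%R, l] (g1 \_ (U1 `\` A)).
  by apply: mres => //; exact: measurableD.
have m2 : measurable_fun `[0%R, l] (g2 \_ (U2 `\` B)).
  by apply: mres => //; exact: measurableD.
rewrite ge0_integralD//; first last.
- exact: emeasurable_funD.
- by move=> x _; apply: adde_ge0; exact: res0.
- by move=> x _; rewrite le_min g10 g20.
rewrite ge0_integralD//; [|by move=> x _; exact: res0|by move=> x _; exact: res0].
by rewrite leeD2l// (splitr e) EFinD leeD.
Qed.

End increments.

Definition clamp (a b x : R) : R := Num.max a (Num.min x b).

Lemma clamp_id a b x : (a <= x <= b)%R -> clamp a b x = x.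
Proof. by move=> /andP[ax xb]; rewrite /clamp min_l// max_r. Qed.

Lemma clamp_le a b x : (a <= b)%R -> (x <= a)%R -> clamp a b x = a.
Proof. by move=> ab xa; rewrite /clamp min_l ?(le_trans xa)// max_l. Qed.

Lemma clamp_ge a b x : (a <= b)%R -> (b <= x)%R -> clamp a b x = b.
Proof. by move=> ab bx; rewrite /clamp min_r// max_r. Qed.

Lemma clamp_lip a b x y : (a <= b)%R -> (`|clamp a b x - clamp a b y| <= `|x - y|)%R.
Proof.
move=> ab; wlog xy : x y / (y <= x)%R.
  move=> H; have [/H//|/ltW/H] := leP y x.
  by rewrite distrC (distrC x).
rewrite (ger0_norm (_ : 0 <= x - y)%R) ?subr_ge0//.
have [xa|ax] := leP x a.
  by rewrite !clamp_le ?(le_trans xy)// subrr normr0 subr_ge0.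
have [ya|ay] := leP y a; have [bx|xb] := leP b x;
  rewrite ?(clamp_le ab ya) ?(clamp_ge ab bx) ?(clamp_id (x := x)) ?(ltW ax) ?(ltW xb)//.
- by rewrite ger0_norm ?subr_ge0//; lra.
- by rewrite ger0_norm ?subr_ge0 ?(ltW ax)//; lra.
- have [by'|yb] := leP b y; first by rewrite (clamp_ge ab by') subrr normr0 subr_ge0.
  by rewrite clamp_id ?(ltW ay) ?(ltW yb)// ger0_norm ?subr_ge0 ?(ltW yb)//; lra.
- by rewrite clamp_id ?(ltW ay) ?(ltW (le_lt_trans xy xb))// ger0_norm ?subr_ge0.
Qed.

(** With shrunken levels, a gap of width e separates the values at most a and at least b from those
    where the clamp varies, so that it is locally constant near the former; the price is an error
    e. *)
Lemma clamp_shrink a b e x : (0 <= e)%R -> (a + e <= b - e)%R ->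
  (`|clamp a b x - clamp (a + e) (b - e) x| <= e)%R.
Proof.
move=> e0 abe.
have ab : (a <= b)%R by lra.
have [xa|ax] := leP x a.
  by rewrite !clamp_le//; [rewrite opprD addNKr normrN ger0_norm|lra].
have [bx|xb] := leP b x.
  by rewrite !clamp_ge//; [rewrite opprB addrC subrK ger0_norm|lra].
rewrite (clamp_id (a := a)) ?(ltW ax) ?(ltW xb)//.
have [xa'|ax'] := leP x (a + e)%R.
  by rewrite clamp_le// ler_norml; apply/andP; split; lra.
have [bx'|xb'] := leP (b - e)%R x.
  by rewrite clamp_ge// ler_norml; apply/andP; split; lra.
by rewrite clamp_id ?(ltW ax') ?(ltW xb')// subrr normr0.
Qed.

(* The clamp of k between a + e and b - e is constant near the points where
   k <= a or b <= k, and {a < k < b} is a neighbourhood of all others; the claim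
   follows by gluing and letting e tend to 0. *)
Lemma increments_clamp_le k l g m (a b : R) : (0 <= l)%R -> (a < b)%R ->
  measurable_fun `[0%R, l] g -> (forall x, 0 <= g x) ->
  \int[lambda]_(x in `[0%R, l]) g x < +oo -> increments_le k l g ->
  measurable_fun `[0%R, l] m -> (forall x, 0 <= m x) ->
  (forall x, (0 <= x <= l)%R -> (a < k x < b)%R -> g x <= m x) ->
  `|clamp a b (k l) - clamp a b (k 0%R)|%:E <= \int[lambda]_(x in `[0%R, l]) m x.
Proof.
move=> l0 ab mg g0 goo kg mm m0 gm; apply/lee_addgt0Pr => e' e'0.
(* The error e occurs at both endpoints, hence e' / 2; the other bound keeps the shrunken levels in
   order. *)
pose e : R := Num.min (e' / 2)%R ((b - a) / 2)%R.
have e0 : (0 < e)%R by rewrite lt_min !divr_gt0// subr_gt0.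
have ee' : (e <= e' / 2)%R by rewrite ge_min lexx.
have abe : (a + e <= b - e)%R.
  have : (e <= (b - a) / 2)%R by rewrite ge_min lexx orbT.
  lra.
pose T := clamp (a + e) (b - e).
have key : `|T (k l) - T (k 0%R)|%:E <= \int[lambda]_(x in `[0%R, l]) m x.
  apply: (local_to_global (k := T \o k) (I := fun a b => \int[lambda]_(x in `[a, b]) m x)) => //.
  - by move=> *; exact: integral_ge0.
  - by move=> x y z xy yz; rewrite (ge0_integral_itv_add mm).
  move=> u ul.
  have cont := increments_le_continuous mg g0 goo kg.
  have itvl s t x : (0 <= s <= t)%R -> (t <= l)%R -> (s <= x <= t)%R -> (0 <= x <= l)%R.
    move=> /andP[s0 _] tl /andP[sx xt].
    by rewrite (le_trans s0 sx) (le_trans xt tl).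
  have [kua|aku] := leP (k u) a.
    have [d d0 du] := cont e e0; exists d => // s t st tl su tu /=.
    have le' x : (s <= x <= t)%R -> (`|x - u| < d)%R -> (k x <= a + e)%R.
      move=> sxt xu; have := du u x ul (itvl _ _ _ st tl sxt) xu.
      by rewrite ltr_norml => /andP[_]; lra.
    have := andP st => -[s0 st'].
    rewrite /T !clamp_le ?le' ?lexx ?st'//.
    by rewrite subrr normr0 integral_ge0.
  have [bku|kub] := leP b (k u).
    have [d d0 du] := cont e e0; exists d => // s t st tl su tu /=.
    have ge' x : (s <= x <= t)%R -> (`|x - u| < d)%R -> (b - e <= k x)%R.
      move=> sxt xu; have := du u x ul (itvl _ _ _ st tl sxt) xu.
      by rewrite ltr_norml => /andP[+ _]; lra.
    have := andP st => -[s0 st'].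
    rewrite /T !clamp_ge ?ge' ?lexx ?st'//.
    by rewrite subrr normr0 integral_ge0.
  have r0 : (0 < Num.min (k u - a) (b - k u))%R by rewrite lt_min !subr_gt0 aku.
  have [d d0 du] := cont _ r0; exists d => // s t st tl su tu /=.
  apply: (@le_trans _ _ `|k t - k s|%:E); first by rewrite lee_fin clamp_lip.
  apply: le_trans (kg _ _ st tl) _.
  have sub : `[s, t]%classic `<=` `[0%R, l]%classic.
    by move=> x/=; rewrite !in_itv/=; exact: itvl.
  apply: ge0_le_integral => //.
  - exact: measurable_funS mg.
  - exact: measurable_funS mm.
  move=> x /=; rewrite in_itv/= => sxt.
  have xl := itvl _ _ _ st tl sxt; apply: gm => //.
  have xu : (`|x - u| < d)%R.
    move: su tu; rewrite !ltr_norml => /andP[su _] /andP[_ tu].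
    by move/andP : sxt => [sx xt]; apply/andP; split; lra.
  by have := du u x ul xl xu; rewrite lt_min !ltr_norml => /andP[/andP[? ?] /andP[? ?]]; apply/andP; split; lra.
apply: (@le_trans _ _ (`|T (k l) - T (k 0%R)| + e')%:E); last by rewrite EFinD leeD2r.
rewrite lee_fin.
have h1 := clamp_shrink (k l) (ltW e0) abe.
have h2 := clamp_shrink (k 0%R) (ltW e0) abe.
rewrite -/T in h1 h2.
have -> : (clamp a b (k l) - clamp a b (k 0) = (T (k l) - T (k 0)) +
  (clamp a b (k l) - T (k l)) - (clamp a b (k 0) - T (k 0)))%R by ring.
rewrite (le_trans (ler_normB _ _))// (le_trans (lerD (ler_normD _ _) h2))//.
by rewrite -addrA lerD2l; lra.
Qed.

End interval_integrals.

(** * Curves and weak upper gradients *)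

Section curves.
Context {R : realType} {X : pmetricType R}.
Notation lambda := (@lebesgue_measure R).
Implicit Types (c : R -> X) (l : R) (g u : X -> \bar R).

Lemma rectifiable_lip c l s t : rectifiable_curve c l ->
  (0 <= s)%R -> (s <= t)%R -> (t <= l)%R -> (mdist (c s) (c t) <= t - s)%R.
Proof.
move=> [l0 clen] s0 st tl.
move: st; rewrite le_eqVlt => /predU1P[->|st]; first by rewrite mdistxx subrr.
rewrite -lee_fin -(clen s t s0 (ltW st) tl); apply: ereal_sup_ubound.
exists [:: t]; first by split => //=; rewrite st.
by rewrite /= big_nat1.
Qed.

Lemma curve_length_shift_le c (r a b : R) :
  curve_length (fun x => c (r + x)%R) a b <= curve_length c (r + a)%R (r + b)%R.
Proof.
apply: ge_ereal_sup => _ [s [ps ls] <-]; apply: ereal_sup_ubound.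
exists (map (+%R r) s).
  split; last by rewrite last_map (eqP ls).
  rewrite path_map; apply: sub_path ps => x y /=.
  by rewrite ltrD2l.
rewrite size_map; congr EFin; apply: eq_big_nat => i /andP[_ si].
rewrite -map_cons !(nth_map b)//= ltnS ltnW//.
Qed.

Lemma curve_length_shift c (r a b : R) :
  curve_length (fun x => c (r + x)%R) a b = curve_length c (r + a)%R (r + b)%R.
Proof.
apply/eqP; rewrite eq_le curve_length_shift_le/=.
have := curve_length_shift_le (fun x => c (r + x)%R) (- r)%R (r + a)%R (r + b)%R.
rewrite !addKr; apply: le_trans.
by under [in leRHS]eq_fun do rewrite addNKr.
Qed.

Lemma rectifiable_subcurve c l s t : rectifiable_curve c l ->
  (0 <= s)%R -> (s < t)%R -> (t <= l)%R ->
  rectifiable_curve (fun x => c (s + x)%R) (t - s).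
Proof.
move=> [l0 clen] s0 st tl; split; first by rewrite subr_gt0.
move=> a b a0 ab bts; rewrite curve_length_shift clen ?addr_ge0 ?lerD2l//; last by lra.
by congr EFin; ring.
Qed.

(** The curve is arbitrary outside [0, l]. Composed with the clamp to [0, l] it becomes 1-Lipschitz
    on the whole line, hence Borel, and is unchanged on [0, l]. *)
Lemma borel_fun_curve g c l : borel_fun g -> rectifiable_curve c l ->
  measurable_fun `[0%R, l] (g \o c).
Proof.
move=> bg rc; have l0 : (0 < l)%R by case: rc.
pose c' x := c (clamp 0 l x).
have inl x : (0 <= clamp 0 l x <= l)%R.
  rewrite /clamp le_max lexx/= ge_max (ltW l0)/= ge_min.
  by rewrite lexx orbT.
have c'lip x y : (mdist (c' x) (c' y) <= `|x - y|)%R.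
  apply: (@le_trans _ _ `|clamp 0 l x - clamp 0 l y|%R); last exact: clamp_lip (ltW l0).
  have /andP[x0 xl] := inl x; have /andP[y0 yl] := inl y.
  have [xy|/ltW yx] := leP (clamp 0 l x) (clamp 0 l y).
    by rewrite distrC ger0_norm ?subr_ge0//; exact: (rectifiable_lip rc).
  by rewrite ger0_norm ?subr_ge0// metric_sym; exact: (rectifiable_lip rc).
have mc' : measurable_fun setT (c' : R -> g_sigma_algebraType (open : set (set X))).
  apply: (@measurability _ _ _ (g_sigma_algebraType (open : set (set X))) _ c' _ erefl) => // _ [U oU <-].
  rewrite setTI; apply: open_measurable.
  rewrite openE => x /= Ux.
  have : nbhs (c' x) U by exact: open_nbhs_nbhs.
  move=> /nbhs_ballP[e /= e0 eU].
  apply/nbhs_ballP; exists e => //= y xy; apply: eU.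
  by rewrite ballEmdist/=; exact: le_lt_trans (c'lip x y) _.
have mgc' : measurable_fun `[0%R, l] (g \o c').
  apply: measurable_funTS; exact: (measurableT_comp bg mc').
apply: eq_measurable_fun mgc' => x; rewrite inE/= in_itv/= => xl.
by rewrite /c'/= clamp_id.
Qed.

(** The upper gradient inequality on all subcurves at once; it makes [u] absolutely continuous along
    [c] as soon as the integral of [g] is finite. *)
Definition increments_along u g c l := forall s t : R,
  (0 <= s)%R -> (s < t)%R -> (t <= l)%R ->
  `|u (c s) - u (c t)| <= \int[lambda]_(x in `[s, t]) g (c x).

(** A difference with an infinite term is infinite, so the finite bound excludes infinite values at
    both ends of every subcurve. *)
Lemma increments_along_real u g c l : (0 < l)%R -> (forall x, 0 <= g x) ->
  measurable_fun `[0%R, l] (g \o c) -> line_integral c l g < +oo ->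
  increments_along u g c l ->
  (forall s, (0 <= s <= l)%R -> u (c s) \is a fin_num) /\
  increments_le (fine \o u \o c) l (g \o c).
Proof.
move=> l0 g0 mg goo inc.
have fin s t : (0 <= s)%R -> (s < t)%R -> (t <= l)%R ->
    u (c s) \is a fin_num /\ u (c t) \is a fin_num.
  move=> s0 st tl; apply/andP.
  have : u (c s) - u (c t) \is a fin_num.
    rewrite -abse_fin_num ge0_fin_numE//; apply: le_lt_trans (inc s t s0 st tl) _.
    apply: le_lt_trans goo; rewrite /line_integral.
    exact: (@ge0_integral_itv_sub _ (g \o c) 0%R s t l l mg (fun x => g0 (c x)) (lexx _) s0 tl (lexx _)).
  by rewrite fin_numB.
have finc s : (0 <= s <= l)%R -> u (c s) \is a fin_num.
  move=> /andP[s0]; rewrite le_eqVlt => /predU1P[->|sl].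
    by have [] := fin 0%R l (lexx _) l0 (lexx _).
  by have [] := fin s l s0 sl (lexx _).
split => // s t /andP[s0]; rewrite le_eqVlt => /predU1P[<- _|st tl].
  by rewrite subrr normr0 integral_ge0// => x _ /=.
have := inc s t s0 st tl; apply: le_trans.
have [us ut] := fin s t s0 st tl.
by rewrite /= -(fineK us) -(fineK ut) /= distrC.
Qed.

End curves.

(** * Borel sets and completed measures *)

Section borel_sets.
Context {R : realType} {X : pmetricType R} {S : set (set X)}.
Variable mu : {measure set (g_sigma_algebraType S) -> \bar R}.
Hypothesis hmu : complete_borel_measure mu.
Implicit Types (A B : set X) (g : X -> \bar R).

Local Notation XS := (g_sigma_algebraType S).

Lemma S_measurable A : S A -> measurable (A : set XS).
Proof. exact: sub_sigma_algebra. Qed.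

Lemma measurable_S A : measurable (A : set XS) -> S A.
Proof. by apply: smallest_sub => //; case: hmu. Qed.

Lemma borel_measurable B : borel_set B -> measurable (B : set XS).
Proof. by apply: sub_sigma_algebra2; case: hmu. Qed.

Lemma open_measurableX A : open A -> measurable (A : set XS).
Proof. by move=> oA; apply: borel_measurable; exact: sub_sigma_algebra. Qed.

Lemma open_ballX (x : X) (r : R) : open (ball x r).
Proof.
rewrite openE => y; rewrite ballEmdist/= => xy.
apply/nbhs_ballP; exists (r - mdist x y)%R => /=; first by rewrite subr_gt0.
move=> z; rewrite !ballEmdist/= ltrBrDl; apply: le_lt_trans.
exact: metric_triangle.
Qed.

Lemma measurable_ballX (x : X) (r : R) : measurable (ball x r : set XS).
Proof. by apply: open_measurableX; exact: open_ballX. Qed.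

Lemma borel_fun_measurable g : borel_fun g -> measurable_fun setT (g : XS -> \bar R).
Proof.
move=> bg _ Y mY; apply: borel_measurable.
exact: (bg measurableT Y mY).
Qed.

(** Weak upper gradients have to be Borel, but the level sets to which they are localized are only
    measurable for the completed measure. The null set [Z] of the completion is added instead of
    removed. *)
Lemma borel_superset A : measurable (A : set XS) -> exists B, [/\ borel_set B,
  A `<=` B & mu (B `\` A) = 0].
Proof.
move=> mA; have [B [Z [bB bZ Z0 [BA ABZ]]]] := cbm_completion hmu (measurable_S mA).
exists (B `|` Z); split => //.
  exact: (@measurableU _ (g_sigma_algebraType (open : set (set X)))).
have mB := borel_measurable bB; have mZ := borel_measurable bZ.
apply/eqP; rewrite eq_le measure_ge0 andbT -Z0.
apply: le_measure; rewrite ?inE//; first by apply: measurableD => //; exact: measurableU.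
by move=> x [[/BA//|//]].
Qed.

End borel_sets.

Lemma lee_poweR {R : realType} (r : R) (x y : \bar R) : (0 <= r)%R -> 0 <= x ->
  x <= y -> x `^ r <= y `^ r.
Proof.
move=> r0 x0 xy; apply: gt0_ler_poweR => //.
  by rewrite in_itv/= x0 leey.
by rewrite in_itv/= leey andbT (le_trans x0).
Qed.

Section Lp_spaces.
Context {R : realType} {X : pmetricType R} {S : set (set X)}.
Variable mu : {measure set (g_sigma_algebraType S) -> \bar R}.
Implicit Types (D : set X) (p : R) (f : X -> \bar R).

Lemma LpnormE D p f : (0 < p)%R -> measurable (D : set (g_sigma_algebraType S)) ->
  Lpnorm mu D p f = (\int[mu]_(x in D) (`|f x| `^ p)) `^ p^-1.
Proof.
move=> p0 mD; rewrite /Lpnorm unlock; congr poweR.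
rewrite [RHS]integral_mkcond; apply: eq_integral => x _.
by rewrite !patchE; case: ifP => // _; rewrite abse0 poweR0r// gt_eqF.
Qed.

Lemma in_LpP D p f : (0 < p)%R -> measurable (D : set (g_sigma_algebraType S)) ->
  in_Lp mu D p f <->
  measurable_fun (D : set (g_sigma_algebraType S)) (f : _ -> \bar R) /\
  \int[mu]_(x in D) (`|f x| `^ p) < +oo.
Proof.
move=> p0 mD; rewrite /in_Lp LpnormE//; split => -[mf foo]; split => //.
  by apply: lty_poweRy foo; rewrite gt_eqF ?invr_gt0.
exact: poweR_lty.
Qed.

End Lp_spaces.

(** * Properties of p-almost every curve *)

Section pae_curves.
Context {R : realType} {X : pmetricType R} {S : set (set X)}.
Variable mu : {measure set (g_sigma_algebraType S) -> \bar R}.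
Hypothesis hmu : complete_borel_measure mu.
Variables (p : R) (p_gt0 : (0 < p)%R).
Implicit Types (u g rho : X -> \bar R).

Local Notation XS := (g_sigma_algebraType S).
Local Notation lambda := (@lebesgue_measure R).

(** One class for two roles: p-integrable gradients, and weights whose infinite line integrals mark
    an exceptional family. *)
Definition borel_Lp rho := [/\ borel_fun rho, (forall x, 0 <= rho x) &
  \int[mu]_x (rho x `^ p) < +oo].

Lemma borel_poweR g r : borel_fun g -> borel_fun (fun x => g x `^ r).
Proof. by move=> bg; apply: (measurableT_comp (measurable_poweR r)). Qed.

(** r^p is a weighted sum of the rho_n^p. Summing p-th powers allows integration term by term, and
    each summand bounds r from below. *)
Lemma borel_Lp_dominating (rho : nat -> X -> \bar R) :
  (forall n, borel_Lp (rho n)) ->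
  exists2 r, borel_Lp r & forall n, exists2 b : R, (0 < b)%R &
    forall x, b%:E * rho n x <= r x.
Proof.
move=> Hrho.
have brho n : borel_fun (rho n) by have [] := Hrho n.
have rho0 n x : 0 <= rho n x by have [_ + _] := Hrho n; exact.
pose a n := fine (\int[mu]_x (rho n x `^ p)).
have aE n : \int[mu]_x (rho n x `^ p) = (a n)%:E.
  have [_ _ roo] := Hrho n; rewrite fineK// ge0_fin_numE//.
  by apply: integral_ge0 => x _; exact: poweR_ge0.
have a0 n : (0 <= a n)%R.
  by rewrite -lee_fin -aE; apply: integral_ge0 => x _; exact: poweR_ge0.
have a1 n : (0 < 1 + a n)%R by rewrite ltr_pwDl.
(* The weighted energies are at most 2^-(n+1), so their sum is at most 1; adding 1 covers the case
   a_n = 0. *)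
pose b n : R := (1 / (2 ^ n.+1)%:R / (1 + a n))%R.
have b0 n : (0 < b n)%R by rewrite !divr_gt0// ltr0n expn_gt0.
pose F (x : X) : \bar R := \sum_(n <oo) ((b n)%:E * (rho n x `^ p)).
have term0 n x : 0 <= (b n)%:E * (rho n x `^ p).
  by rewrite mule_ge0 ?poweR_ge0// lee_fin ltW.
have F0 x : 0 <= F x by apply: nneseries_ge0 => n _ _; exact: term0.
have bterm n : borel_fun (fun x => (b n)%:E * (rho n x `^ p)).
  by apply: (@emeasurable_funM _ (g_sigma_algebraType (open : set (set X)))) => //; exact: borel_poweR.
have bF : borel_fun F.
  apply: (@ge0_emeasurable_sum _ (g_sigma_algebraType (open : set (set X))) _ _
    (fun n x => (b n)%:E * (rho n x `^ p)) xpredT) => // k _.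
  exact: bterm.
exists (fun x => F x `^ p^-1).
  split.
  - exact: borel_poweR.
  - by move=> x; exact: poweR_ge0.
  rewrite (eq_integral (F : XS -> \bar R)); last first.
    by move=> x _; rewrite -poweRrM mulVf ?gt_eqF// poweRe1.
  rewrite integral_nneseries//; last first.
    by move=> n; apply: (borel_fun_measurable hmu); exact: bterm.
  apply: (@le_lt_trans _ _ (\sum_(n <oo) (1 / (2 ^ n.+1)%:R)%:E)).
    apply: lee_nneseries => [n _ _|n _].
      by apply: integral_ge0.
    rewrite ge0_integralZl_EFin//.
    - rewrite aE -EFinM lee_fin /b -[leLHS]mulrA ler_piMr//.
      by rewrite mulrC ler_pdivrMr// mul1r lerDr.
    - by move=> x _; exact: poweR_ge0.
    - by apply: (borel_fun_measurable hmu); exact: borel_poweR.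
    - exact: ltW.
  by apply: le_lt_trans (ltry 1%R); exact: epsilon_trick0.
move=> n; exists (b n `^ p^-1)%R; first exact: powR_gt0.
move=> x; rewrite -poweR_EFin.
have {1}-> : rho n x = (rho n x `^ p) `^ p^-1.
  by rewrite -poweRrM mulfV ?gt_eqF// poweRe1.
rewrite -poweRM ?poweR_ge0 ?lee_fin ?(ltW (b0 n))//.
apply: gt0_ler_poweR; rewrite ?invr_ge0 ?(ltW p_gt0)// ?in_itv/= ?leey ?andbT//.
have := @nneseries_lim_ge _ (fun n => (b n)%:E * (rho n x `^ p)) xpredT 0 n.+1 (fun k _ _ => term0 k x).
apply: le_trans; rewrite big_nat_recr//= leeDr//.
by apply: sume_ge0 => k _; exact: term0.
Qed.

(** The exceptional family is represented by its weight [rho]. Finiteness of an integral of [rho]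
    passes to subcurves, so properties of subcurves come for free. *)
Definition pae_curve (P : (R -> X) -> R -> Prop) := exists2 rho, borel_Lp rho &
  forall c l, rectifiable_curve c l -> line_integral c l rho < +oo -> P c l.

Lemma pae_curve_mono (P Q : (R -> X) -> R -> Prop) :
  (forall c l, rectifiable_curve c l -> P c l -> Q c l) ->
  pae_curve P -> pae_curve Q.
Proof.
move=> PQ [rho Hrho rhoP]; exists rho => // c l rc /(rhoP c l rc).
exact: PQ.
Qed.

Lemma line_integralZ c l g (b : R) : (0 <= b)%R -> borel_fun g ->
  (forall x, 0 <= g x) -> rectifiable_curve c l ->
  line_integral c l (fun x => b%:E * g x) = b%:E * line_integral c l g.
Proof.
move=> b0 bg g0 rc; rewrite /line_integral ge0_integralZl_EFin//.
exact: borel_fun_curve bg rc.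
Qed.

Lemma le_line_integral c l g g' : borel_fun g -> borel_fun g' ->
  (forall x, 0 <= g x) -> (forall x, g x <= g' x) -> rectifiable_curve c l ->
  line_integral c l g <= line_integral c l g'.
Proof.
move=> bg bg' g0 gg' rc; apply: ge0_le_integral => //.
- exact: borel_fun_curve bg rc.
- exact: borel_fun_curve bg' rc.
Qed.

Lemma line_integral_lty_scale c l g g' (b : R) : (0 < b)%R -> borel_fun g ->
  borel_fun g' -> (forall x, 0 <= g x) -> (forall x, b%:E * g x <= g' x) ->
  rectifiable_curve c l -> line_integral c l g' < +oo ->
  line_integral c l g < +oo.
Proof.
move=> b0 bg bg' g0 gg' rc g'oo.
have bbg : borel_fun (fun x => b%:E * g x).
  by apply: (@emeasurable_funM _ (g_sigma_algebraType (open : set (set X)))).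
have : b%:E * line_integral c l g < +oo.
  rewrite -line_integralZ//; last exact: ltW.
  apply: le_lt_trans g'oo; apply: le_line_integral => // x.
  by rewrite mule_ge0 ?lee_fin ?(ltW b0).
rewrite !ltey; apply: contra => /eqP ->.
by rewrite gt0_muley ?lte_fin.
Qed.

(** Countable unions of exceptional families are exceptional: one weight dominates a positive
    multiple of each given one, and its finite integral makes all of theirs finite. *)
Lemma pae_curve_countable (P : nat -> (R -> X) -> R -> Prop) :
  (forall n, pae_curve (P n)) -> pae_curve (fun c l => forall n, P n c l).
Proof.
move=> HP.
have /choice[rho Hrho] n : exists rho, borel_Lp rho /\ forall c l,
    rectifiable_curve c l -> line_integral c l rho < +oo -> P n c l.
  by have [rho ? ?] := HP n; exists rho.
have [r Hr rdom] := borel_Lp_dominating (fun n => (Hrho n).1).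
exists r => // c l rc roo n; apply: (Hrho n).2 => //.
have [b b0 brho] := rdom n.
have [[brhon rho0 _] _] := Hrho n; have [br _ _] := Hr.
exact: (line_integral_lty_scale b0 brhon br rho0 brho rc roo).
Qed.

Lemma pae_curve_and (P Q : (R -> X) -> R -> Prop) : pae_curve P -> pae_curve Q ->
  pae_curve (fun c l => P c l /\ Q c l).
Proof.
move=> HP HQ.
have : pae_curve (fun c l => forall n, (if n is 0 then P else Q) c l).
  by apply: (@pae_curve_countable (fun n => if n is 0 then P else Q)) => -[|n].
apply: pae_curve_mono => c l _ H; split; first exact: (H 0%N).
exact: (H 1%N).
Qed.

Lemma pae_curve_lty g : borel_Lp g -> pae_curve (fun c l => line_integral c l g < +oo).
Proof. by move=> Hg; exists g. Qed.

(** A curve of length l stays in the ball around [point] of radius d(point, c 0) + l, up to the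
    boundary, so countably many balls, each with a p-integrable restriction of [g], take care of all
    curves. *)
Lemma pae_curve_lty_loc g : borel_fun g -> (forall x, 0 <= g x) ->
  in_Lploc mu p g -> pae_curve (fun c l => line_integral c l g < +oo).
Proof.
move=> bg g0 gloc.
pose B (n : nat) := ball (point : X) n.+1%:R.
have bB n : borel_set (B n) by apply: sub_sigma_algebra; exact: open_ballX.
have HgB n : borel_Lp (g \_ (B n)).
  split.
  - apply: (@measurable_restrictT _ _ (g_sigma_algebraType (open : set (set X))) _ (B n) g (bB n)).1.
    exact: (@measurable_funTS _ _ (g_sigma_algebraType (open : set (set X)))).
  - by move=> x; rewrite patchE; case: ifP.
  have mB := measurable_ballX hmu (point : X) n.+1%:R.
  have [_] := (in_LpP mu g p_gt0 mB).1 (gloc point n.+1%:R (ltr0Sn _ _)).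
  rewrite integral_mkcond; congr (_ < _); apply: eq_integral => x _.
  rewrite !patchE; case: ifP => _; first by rewrite gee0_abs.
  by rewrite poweR0r// gt_eqF.
have : pae_curve (fun c l => forall n, line_integral c l (g \_ (B n)) < +oo).
  by apply: pae_curve_countable => n; exact: pae_curve_lty.
apply: pae_curve_mono => c l rc H.
have l0 : (0 < l)%R by case: rc.
pose n := Num.truncn (mdist point (c 0%R) + l)%R.
suff -> : line_integral c l g = line_integral c l (g \_ (B n)) by exact: H.
apply: eq_integral => t; rewrite inE/= in_itv/= => /andP[t0 tl].
rewrite patchE ifT// inE /B ballEmdist/=.
apply: le_lt_trans (truncnS_gt _).
apply: (le_trans (metric_triangle _ (c 0%R) _)); rewrite lerD2l.
by apply: (le_trans (rectifiable_lip rc (lexx _) t0 tl)); rewrite subr0.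
Qed.

(** If a subcurve belonged to the exceptional family, the weight would have infinite integral along
    it, and hence along the whole curve. *)
Lemma pae_curve_weak_upper_gradient u g : weak_upper_gradient mu p u g ->
  pae_curve (increments_along u g).
Proof.
move=> [bg g0 [G [rho [brho rho0 rhoLp GP]] ug]].
exists rho.
  split => //; have [_] := (in_LpP mu rho p_gt0 measurableT).1 rhoLp.
  by congr (_ < _); apply: eq_integral => x _; rewrite gee0_abs.
move=> c l rc roo s t s0 st tl.
have rsub := rectifiable_subcurve rc s0 st tl.
have shift (h : X -> \bar R) : borel_fun h -> (forall x, 0 <= h x) ->
    line_integral (fun x => c (s + x)%R) (t - s) h = \int[lambda]_(x in `[s, t]) h (c x).
  move=> bh h0; rewrite /line_integral.
  rewrite (@ge0_integral_shift _ (h \o c)) => //.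
  - apply: measurable_funS (borel_fun_curve bh rc) => //.
    by apply: subset_itv; rewrite bnd_simp.
  - by move=> x /=.
rewrite -shift//.
have := ug (fun x => c (s + x)%R) (t - s)%R rsub.
rewrite /upper_gradient_along addr0 subrKC; apply.
move=> /GP /(_ rsub); rewrite shift// => absurd.
move: roo; rewrite ltNge => /negP; apply; rewrite -absurd.
have := @ge0_integral_itv_sub _ (rho \o c) 0%R s t l l (borel_fun_curve brho rc)
  (fun x => rho0 (c x)) (lexx _) s0 tl (lexx _).
by [].
Qed.

Lemma weak_upper_gradient_pae u g : borel_fun g -> (forall x, 0 <= g x) ->
  pae_curve (upper_gradient_along u g) -> weak_upper_gradient mu p u g.
Proof.
move=> bg g0 [rho [brho rho0 rhooo] H]; split => //.
exists [set cl | line_integral cl.1 cl.2 rho = +oo].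
  exists rho; split => //; apply/(in_LpP mu rho p_gt0 measurableT); split.
    exact: (borel_fun_measurable hmu).
  move: rhooo; congr (_ < _).
  by apply: eq_integral => x _; rewrite gee0_abs.
move=> c l rc /= nG; apply: H => //; rewrite ltey; exact/eqP.
Qed.

End pae_curves.

(** * Calculus of weak upper gradients *)

Section weak_upper_gradients.
Context {R : realType} {X : pmetricType R} {S : set (set X)}.
Variable mu : {measure set (g_sigma_algebraType S) -> \bar R}.
Hypothesis hmu : complete_borel_measure mu.
Variables (p : R) (p_gt0 : (0 < p)%R).
Implicit Types (u g rho : X -> \bar R).

Local Notation XS := (g_sigma_algebraType S).
Local Notation XB := (g_sigma_algebraType (open : set (set X))).
Local Notation lambda := (@lebesgue_measure R).
Local Notation pae := (pae_curve mu p).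
Local Notation wug := (weak_upper_gradient mu p).
Local Notation bLp := (borel_Lp mu p).

Lemma upper_gradient_along_real u g c l :
  u (c 0%R) \is a fin_num -> u (c l) \is a fin_num ->
  `|fine (u (c l)) - fine (u (c 0%R))|%:E <= line_integral c l g ->
  upper_gradient_along u g c l.
Proof.
move=> u0 ul; apply: le_trans.
by rewrite -{1}(fineK u0) -{1}(fineK ul) /= distrC.
Qed.

(** It suffices to compare [v] with [u] at finite values of [u], because [u] is finite along almost
    every curve. This allows infinite values to be replaced by real ones. *)
Lemma weak_upper_gradient_lip u v g :
  (forall x y, u x \is a fin_num -> u y \is a fin_num ->
    `|v x - v y| <= `|u x - u y|) ->
  wug u g -> pae (fun c l => line_integral c l g < +oo) -> wug v g.
Proof.
move=> vu ug goo; have [bg g0 _] := ug.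
apply: (weak_upper_gradient_pae hmu p_gt0) => //.
apply: pae_curve_mono (pae_curve_and hmu p_gt0 goo (pae_curve_weak_upper_gradient p_gt0 ug)).
move=> c l rc [goo' inc].
have l0 : (0 < l)%R by case: rc.
have [fin _] := increments_along_real l0 g0 (borel_fun_curve bg rc) goo' inc.
apply: le_trans (inc 0%R l (lexx _) l0 (lexx _)).
by apply: vu; apply: fin; rewrite ?lexx ltW.
Qed.

(** The minimum may switch between g and g' arbitrarily often along a curve, so the inequalities on
    all subcurves have to be combined. *)
Lemma weak_upper_gradient_min u g g' : wug u g -> wug u g' ->
  pae (fun c l => line_integral c l g < +oo) ->
  pae (fun c l => line_integral c l g' < +oo) ->
  wug u (fun x => mine (g x) (g' x)).
Proof.
move=> ug ug' goo g'oo; have [bg g0 _] := ug; have [bg' g'0 _] := ug'.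
apply: (weak_upper_gradient_pae hmu p_gt0).
- exact: (@measurable_mine _ XB).
- by move=> x; rewrite le_min g0 g'0.
have := pae_curve_and hmu p_gt0 (pae_curve_and hmu p_gt0 goo g'oo)
  (pae_curve_and hmu p_gt0 (pae_curve_weak_upper_gradient p_gt0 ug) (pae_curve_weak_upper_gradient p_gt0 ug')).
apply: pae_curve_mono => c l rc [[gc g'c] [inc inc']].
have l0 : (0 < l)%R by case: rc.
have mg := borel_fun_curve bg rc; have mg' := borel_fun_curve bg' rc.
have [fin incr] := increments_along_real l0 g0 mg gc inc.
have [_ incr'] := increments_along_real l0 g'0 mg' g'c inc'.
apply: upper_gradient_along_real; [by rewrite fin// lexx ltW|by rewrite fin// lexx ltW|].
exact: (increments_le_min (ltW l0) mg mg' (fun x => g0 (c x)) (fun x => g'0 (c x)) gc g'c incr incr').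
Qed.

Lemma upper_gradient_weak u g : upper_gradient u g -> wug u g.
Proof.
move=> [bg g0 ug]; apply: (weak_upper_gradient_pae hmu p_gt0) => //.
exists (cst 0); last by move=> c l rc _; exact: ug.
split => //; first exact: (@measurable_cst _ _ XB).
rewrite (eq_integral (cst 0 : XS -> \bar R)) ?integral0// => x _.
by rewrite poweR0r// gt_eqF.
Qed.

Lemma borel_Lp_le g g' : borel_fun g' -> (forall x, 0 <= g' x) ->
  (forall x, g' x <= g x) -> bLp g -> bLp g'.
Proof.
move=> bg' g'0 gg' [bg g0 goo]; split => //.
apply: le_lt_trans goo; apply: ge0_le_integral => //.
- by move=> x _; exact: poweR_ge0.
- by apply: (borel_fun_measurable hmu); exact: borel_poweR.
- by apply: (borel_fun_measurable hmu); exact: borel_poweR.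
- by move=> x _; apply: lee_poweR => //; exact: ltW.
Qed.

Lemma borel_Lp_loc g : bLp g -> in_Lploc mu p g.
Proof.
move=> [bg g0 goo] x r r0; apply/(in_LpP mu g p_gt0 (measurable_ballX hmu x r)).
have mg := borel_fun_measurable hmu bg; split; first exact: measurable_funTS.
apply: le_lt_trans goo.
have -> : \int[mu]_y (g y `^ p) = \int[mu]_y (`|g y| `^ p).
  by apply: eq_integral => y _; rewrite gee0_abs.
apply: ge0_subset_integral => //; first exact: (measurable_ballX hmu).
- apply: (measurableT_comp (measurable_poweR p)).
  exact: (measurableT_comp (@abse_measurable R setT)).
- by move=> y _; exact: poweR_ge0.
Qed.

(* The p-energies of the p-integrable weak upper gradients have an infimum; a
   minimizing sequence is made decreasing by taking minima. *)
Lemma exists_minimal_weak_upper_gradient u g0 : wug u g0 -> bLp g0 ->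
  exists2 g, minimal_weak_upper_gradient mu p u g & bLp g.
Proof.
move=> ug0 g0Lp.
have [bg0 g00 g0oo] := g0Lp.
pose Phi := [set \int[mu]_x (g x `^ p) | g in [set g | wug u g /\ bLp g]].
pose m := ereal_inf Phi.
have Phi0 : Phi (\int[mu]_x (g0 x `^ p)) by exists g0.
have m0 : 0 <= m.
  by apply: le_ereal_inf_tmp => _ [g _ <-]; apply: integral_ge0 => x _; exact: poweR_ge0.
have moo : m < +oo by apply: le_lt_trans g0oo; exact: ereal_inf_lbound.
have mfin : m \is a fin_num by rewrite ge0_fin_numE.
have /choice[h Hh] (n : nat) : exists g, [/\ wug u g, bLp g &
    \int[mu]_x (g x `^ p) < m + (n.+1%:R^-1)%:E].
  have n0 : (0 < n.+1%:R^-1 :> R)%R by rewrite invr_gt0.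
  by have [_ [g [ug gLp] <-] gm] := lb_ereal_inf_adherent n0 mfin; exists g.
pose G := fix G n := if n is k.+1 then (fun x => mine (G k x) (h k.+1 x)) else h 0%N.
have GP n : wug u (G n) /\ bLp (G n).
  elim: n => [|n [IH1 IH2]]; first by have [] := Hh 0%N.
  have [uh hLp _] := Hh n.+1.
  have ugmin : wug u (G n.+1).
    by apply: weak_upper_gradient_min => //; exact: pae_curve_lty.
  split => //; have [bG G0 _] := ugmin.
  by apply: borel_Lp_le IH2 => // x; rewrite /= ge_min lexx.
have Gh n x : G n x <= h n x by case: n => //= n; rewrite ge_min lexx orbT.
have bG n : borel_fun (G n) by have [_ []] := GP n.
have G0 n x : 0 <= G n x by have [_ [_ + _]] := GP n; exact.
have Gdec x : {homo (fun n => G n x) : a b / (a <= b)%N >-> b <= a}.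
  apply/nonincreasing_seqP => n /=; by rewrite ge_min lexx.
clearbody G.
pose Ginf (x : X) : \bar R := ereal_inf (range (fun n => G n x)).
have Gcvg x : G n x @[n --> \oo] --> Ginf x by exact: ereal_nonincreasing_cvgn.
have GinfG n x : Ginf x <= G n x by apply: ereal_inf_lbound; exists n.
have Ginf0 x : 0 <= Ginf x by apply: le_ereal_inf_tmp => _ [n _ <-].
have bGinf : borel_fun Ginf.
  by apply: (@emeasurable_fun_cvg _ XB _ _ G).
have GinfLp : bLp Ginf by apply: borel_Lp_le (GP 0%N).2.
have ugGinf : wug u Ginf.
  apply: (weak_upper_gradient_pae hmu p_gt0) => //.
  have incs : pae (fun c l => forall n, increments_along u (G n) c l).
    apply: pae_curve_countable => // n.
    by apply: pae_curve_weak_upper_gradient => //; exact: (GP n).1.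
  apply: pae_curve_mono (pae_curve_and hmu p_gt0 incs (pae_curve_lty (GP 0%N).2)).
  move=> c l rc [inc G0c].
  have l0 : (0 < l)%R by case: rc.
  have mGc n := borel_fun_curve (bG n) rc.
  (* The decreasing sequence is dominated by [G 0], which is integrable along almost every curve, so
     the inequality passes to the limit by dominated convergence on each such curve. *)
  have iG0 : lambda.-integrable `[0%R, l] (G 0%N \o c).
    apply/integrableP; split; first exact: mGc.
    apply: le_lt_trans G0c.
    rewrite le_eqVlt; apply/orP; left; apply/eqP; apply: eq_integral => x _.
    by rewrite /= gee0_abs.
  have domG : {ae lambda, forall x n, `[0%R, l]%classic x -> `|(G n \o c) x| <= (G 0%N \o c) x}.
    by apply: nearW => x n _ /=; rewrite gee0_abs// Gdec.
  have cvgG : {ae lambda, forall x, `[0%R, l]%classic x ->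
      (G n \o c) x @[n --> \oo] --> (Ginf \o c) x}.
    by apply: nearW => x _; exact: Gcvg.
  have [_ _] := @dominated_convergence _ _ _ lambda _ (measurable_itv `[0%R, l])
    (fun n => G n \o c) (Ginf \o c) (G 0%N \o c) mGc (borel_fun_curve bGinf rc) cvgG iG0 domG.
  apply: cvge_ge.
  by near=> n; exact: (inc n 0%R l (lexx _) l0 (lexx _)).
exists Ginf => //; split => //; first exact: borel_Lp_loc.
move=> g' ug' g'loc; have [bg' g'0 _] := ug'.
(* The competitor g' is only locally p-integrable, but its minimum with [Ginf] is p-integrable and
   therefore has energy at least m. Equality of the energies then forces [Ginf] = g'' <= g' almost
   everywhere. *)
pose g'' x := mine (Ginf x) (g' x).
have ug'' : wug u g''.
  by apply: weak_upper_gradient_min => //; [exact: pae_curve_lty|exact: pae_curve_lty_loc].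
have [bg'' g''0 _] := ug''.
have g''Lp : bLp g'' by apply: borel_Lp_le GinfLp => // x; rewrite ge_min lexx.
have Im (g : X -> \bar R) : wug u g -> bLp g -> m <= \int[mu]_x (g x `^ p).
  by move=> ug gLp; apply: ereal_inf_lbound; exists g.
have mp (g : X -> \bar R) : borel_fun g -> measurable_fun setT (fun x : XS => g x `^ p).
  by move=> bg; apply: (borel_fun_measurable hmu); exact: borel_poweR.
have lep (g k : X -> \bar R) x : 0 <= g x -> g x <= k x -> g x `^ p <= k x `^ p.
  by move=> gx gk; apply: lee_poweR => //; exact: ltW.
have Ginfm : \int[mu]_x (Ginf x `^ p) <= m.
  apply/lee_addgt0Pr => e e0.
  have [n ne] : exists n : nat, (n.+1%:R^-1 < e)%R.
    exists (Num.truncn e^-1).+1; rewrite invf_plt ?posrE//.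
    by rewrite (lt_trans (truncnS_gt _))// ltr_nat.
  have [_ _ hm] := Hh n.
  apply: (@le_trans _ _ (\int[mu]_x (h n x `^ p))).
    apply: ge0_le_integral => //.
    - by move=> x _; exact: poweR_ge0.
    - exact: mp.
    - by apply: mp; have [_ []] := Hh n.
    - by move=> x _; apply: lep => //; exact: le_trans (GinfG n x) (Gh n x).
  by apply: (le_trans (ltW hm)); rewrite leeD2l// lee_fin ltW.
have eqI : \int[mu]_x (g'' x `^ p) = \int[mu]_x (Ginf x `^ p).
  apply/eqP; rewrite eq_le (le_trans Ginfm)// ?andbT; last exact: Im.
  apply: ge0_le_integral => //.
  - by move=> x _; exact: poweR_ge0.
  - exact: mp.
  - exact: mp.
  - by move=> x _; apply: lep => //; rewrite ge_min lexx.
have Ipoo : \int[mu]_x (Ginf x `^ p) < +oo by case: GinfLp.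
have ae : ae_eq mu setT (fun x => Ginf x `^ p) (fun x => g'' x `^ p).
  apply: integral_ae_eq => //.
  - apply/integrableP; split; first exact: mp.
    rewrite (eq_integral (fun x : XS => Ginf x `^ p))// => x _.
    by rewrite gee0_abs// poweR_ge0.
  - exact: mp.
  move=> A _ mA.
  have split (g : X -> \bar R) : borel_fun g -> \int[mu]_x (g x `^ p) =
      \int[mu]_(x in A) (g x `^ p) + \int[mu]_(x in ~` A) (g x `^ p).
    move=> bg; rewrite -ge0_integral_setU ?setUv//; first exact: measurableC.
    - exact: mp.
    - by move=> x _; exact: poweR_ge0.
    - by apply/disj_setPS => x [].
  have leI (B : set X) : measurable (B : set XS) ->
      \int[mu]_(x in B) (g'' x `^ p) <= \int[mu]_(x in B) (Ginf x `^ p).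
    move=> mB; apply: ge0_le_integral => //.
    - by move=> x _; exact: poweR_ge0.
    - by apply: measurable_funTS; exact: mp.
    - by apply: measurable_funTS; exact: mp.
    - by move=> x _; apply: lep => //; rewrite ge_min lexx.
  have mAc : measurable (~` A : set XS) by exact: measurableC.
  (* The total energies agree and are finite, so the inequality on the complement of A, subtracted
     from the total, gives the missing inequality on A. *)
  apply/eqP; rewrite eq_le leI// andbT.
  have fin : \int[mu]_(x in ~` A) (g'' x `^ p) \is a fin_num.
    rewrite ge0_fin_numE; last by apply: integral_ge0 => x _; exact: poweR_ge0.
    apply: le_lt_trans (leI _ mAc) _; apply: le_lt_trans Ipoo.
    apply: ge0_subset_integral => //; first exact: mp.
    by move=> x _; exact: poweR_ge0.
  rewrite -(leeD2rE _ _ fin) -split// eqI split// leeD2l//.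
  exact: leI.
apply: filterS ae => x /(_ I) Hx.
have : Ginf x = g'' x.
  rewrite -[LHS]poweRe1// -[RHS]poweRe1// -(mulfV (lt0r_neq0 p_gt0)) !poweRrM.
  by rewrite Hx.
by move=> ->; rewrite /g'' ge_min lexx orbT.
Unshelve. all: by end_near. Qed.

(** Along almost every curve the clamp of [f] varies only where a < f < b. A Borel superset [B] of
    this band is used because [f] need not be Borel. *)
Lemma weak_upper_gradient_clamp (f : X -> R) g B (a b : R) : (a < b)%R ->
  wug (EFin \o f) g -> bLp g -> borel_set B ->
  [set x | (a < f x < b)%R] `<=` B ->
  wug (EFin \o (clamp a b \o f)) (g \_ B).
Proof.
move=> ab ug gLp bB fB; have [bg g0 _] := ug.
have bgB : borel_fun (g \_ B).
  apply: (@measurable_restrictT _ _ XB _ B g bB).1.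
  exact: (@measurable_funTS _ _ XB).
have gB0 x : 0 <= (g \_ B) x by rewrite patchE; case: ifP.
apply: (weak_upper_gradient_pae hmu p_gt0) => //.
apply: pae_curve_mono (pae_curve_and hmu p_gt0 (pae_curve_lty gLp) (pae_curve_weak_upper_gradient p_gt0 ug)).
move=> c l rc [gc inc].
have l0 : (0 < l)%R by case: rc.
have [_ incr] := increments_along_real l0 g0 (borel_fun_curve bg rc) gc inc.
apply: upper_gradient_along_real => //=.
apply: (increments_clamp_le (ltW l0) ab (borel_fun_curve bg rc) (fun x => g0 (c x)) gc incr
  (borel_fun_curve bgB rc) (fun x => gB0 (c x))).
move=> x _ /= abx; rewrite patchE ifT// inE; exact: fB.
Qed.

Lemma weak_upper_gradient_sub (f1 f2 : X -> R) g1 g2 :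
  wug (EFin \o f1) g1 -> wug (EFin \o f2) g2 ->
  wug (fun x => (f1 x - f2 x)%:E) (fun x => g1 x + g2 x).
Proof.
move=> ug1 ug2; have [bg1 g10 _] := ug1; have [bg2 g20 _] := ug2.
apply: (weak_upper_gradient_pae hmu p_gt0).
- exact: (@emeasurable_funD _ XB).
- by move=> x; exact: adde_ge0.
apply: pae_curve_mono (pae_curve_and hmu p_gt0 (pae_curve_weak_upper_gradient p_gt0 ug1) (pae_curve_weak_upper_gradient p_gt0 ug2)).
move=> c l rc [inc1 inc2].
have l0 : (0 < l)%R by case: rc.
rewrite /upper_gradient_along /line_integral ge0_integralD//; first last.
- exact: borel_fun_curve bg2 rc.
- exact: borel_fun_curve bg1 rc.
apply: le_trans (leeD (inc1 0%R l (lexx _) l0 (lexx _)) (inc2 0%R l (lexx _) l0 (lexx _))).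
rewrite /= -!EFinD lee_fin opprD addrACA opprK.
have -> : (- f2 (c 0) + f2 (c l) = - (f2 (c 0) - f2 (c l)))%R by ring.
exact: ler_normB.
Qed.

End weak_upper_gradients.

(** * Averages and the Poincare inequality *)

Section averages.
Context d (T : measurableType d) (R : realType).
Variable mu : {measure set T -> \bar R}.
Implicit Types (D : set T) (f g : T -> R).

Definition pos_finite D := [/\ measurable D, 0 < mu D & mu D < +oo].

(** Real-valued: [fine] sends infinite measures and integrals to a default value, so the facts below
    assume [pos_finite] and [integrable_on] where the true value matters. *)
Definition avg D f : R := ((fine (mu D))^-1 * Rintegral mu D f)%R.

Definition osc D f : R := avg D (fun x => `|f x - avg D f|)%R.

Definition integrable_on D f := mu.-integrable D (EFin \o f).

Lemma pos_finite_fine D : pos_finite D -> (0 < fine (mu D))%R.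
Proof. by move=> [_ m0 moo]; rewrite fine_gt0// m0. Qed.

Lemma integrable_on_cst D (c : R) : pos_finite D -> integrable_on D (fun=> c).
Proof.
move=> [mD m0 moo]; apply/integrableP; split; first exact: measurable_cst.
by rewrite /= integral_cst// lte_mul_pinfty.
Qed.

Lemma integrable_onB D f g : pos_finite D -> integrable_on D f ->
  integrable_on D g -> integrable_on D (fun x => f x - g x)%R.
Proof.
move=> [mD _ _] If Ig; have := integrableB mD If Ig.
by apply: eq_integrable.
Qed.

Lemma integrable_onD D f g : pos_finite D -> integrable_on D f ->
  integrable_on D g -> integrable_on D (fun x => f x + g x)%R.
Proof.
move=> [mD _ _] If Ig; have := integrableD mD If Ig.
by apply: eq_integrable.
Qed.

Lemma integrable_onBcst D f (c : R) : pos_finite D -> integrable_on D f ->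
  integrable_on D (fun x => f x - c)%R.
Proof. by move=> pD If; apply: integrable_onB => //; exact: integrable_on_cst. Qed.

Lemma integrable_on_norm D f : pos_finite D -> integrable_on D f ->
  integrable_on D (fun x => `|f x|)%R.
Proof.
move=> [mD _ _] If; have := integrable_abse If.
by apply: eq_integrable.
Qed.

Lemma integrable_on_le D f g : pos_finite D -> measurable_fun D f ->
  (forall x, D x -> `|f x| <= `|g x|)%R -> integrable_on D g -> integrable_on D f.
Proof.
move=> [mD _ _] mf fg; apply: le_integrable => //.
  exact/measurable_EFinP.
Qed.

Lemma avg_cst D (c : R) : pos_finite D -> avg D (fun=> c) = c.
Proof.
move=> pD; have := pos_finite_fine pD; case: pD => mD _ _ m0.
by rewrite /avg Rintegral_cst// mulrCA mulVf ?mulr1// gt_eqF.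
Qed.

Lemma avgB D f g : pos_finite D -> integrable_on D f -> integrable_on D g ->
  avg D (fun x => f x - g x)%R = (avg D f - avg D g)%R.
Proof. by move=> [mD _ _] If Ig; rewrite /avg RintegralB// mulrBr. Qed.

Lemma avgD D f g : pos_finite D -> integrable_on D f -> integrable_on D g ->
  avg D (fun x => f x + g x)%R = (avg D f + avg D g)%R.
Proof. by move=> [mD _ _] If Ig; rewrite /avg RintegralD// mulrDr. Qed.

Lemma avg_ge0 D f : (forall x, D x -> 0 <= f x)%R -> (0 <= avg D f)%R.
Proof.
by move=> f0; apply: mulr_ge0; [rewrite invr_ge0 fine_ge0|exact: Rintegral_ge0].
Qed.

Lemma le_avg D f g : pos_finite D -> integrable_on D f -> integrable_on D g ->
  (forall x, D x -> f x <= g x)%R -> (avg D f <= avg D g)%R.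
Proof.
move=> pD If Ig fg; rewrite ler_pM2l ?invr_gt0 ?pos_finite_fine//.
by apply: le_Rintegral => //; case: pD.
Qed.

Lemma avg_norm D f : pos_finite D -> integrable_on D f ->
  (`|avg D f| <= avg D (fun x => `|f x|))%R.
Proof.
move=> pD If; have m0 := pos_finite_fine pD.
rewrite normrM gtr0_norm ?invr_gt0// ler_pM2l ?invr_gt0//.
by apply: le_normr_Rintegral => //; case: pD.
Qed.

Lemma avg_sub_cst D f (c : R) : pos_finite D -> integrable_on D f ->
  (`|avg D f - c| <= avg D (fun x => `|f x - c|))%R.
Proof.
move=> pD If; rewrite -{1}(avg_cst c pD) -avgB//; last exact: integrable_on_cst.
by apply: avg_norm => //; exact: integrable_onBcst.
Qed.

Lemma integrable_onS D D' f : pos_finite D -> pos_finite D' -> D' `<=` D ->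
  integrable_on D f -> integrable_on D' f.
Proof. by move=> [mD _ _] [mD' _ _] DD'; exact: integrableS. Qed.

Lemma avg_subset D D' f : pos_finite D -> pos_finite D' -> D' `<=` D ->
  integrable_on D f -> (forall x, 0 <= f x)%R ->
  (avg D' f <= fine (mu D) / fine (mu D') * avg D f)%R.
Proof.
move=> pD pD' DD' If f0.
have m0 := pos_finite_fine pD; have m0' := pos_finite_fine pD'.
rewrite /avg mulrACA mulfV ?gt_eqF// mul1r ler_pM2l ?invr_gt0//.
have If' := integrable_onS pD pD' DD' If.
have [mD _ _] := pD; have [mD' _ _] := pD'.
apply: fine_le; [exact: integrable_fin_num|exact: integrable_fin_num|].
apply: ge0_subset_integral => //; first exact: measurable_int If.
by move=> x _; rewrite lee_fin.
Qed.

Lemma integrable_osc D f (c : R) : pos_finite D -> integrable_on D f ->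
  integrable_on D (fun x => `|f x - c|)%R.
Proof. by move=> pD If; apply: integrable_on_norm => //; exact: integrable_onBcst. Qed.

Lemma osc_ge0 D f : (0 <= osc D f)%R.
Proof. by apply: avg_ge0. Qed.

Lemma avg_sub_osc D D' f : pos_finite D -> pos_finite D' -> D' `<=` D ->
  integrable_on D f ->
  (`|avg D' f - avg D f| <= fine (mu D) / fine (mu D') * osc D f)%R.
Proof.
move=> pD pD' DD' If.
apply: le_trans (avg_sub_cst _ pD' (integrable_onS pD pD' DD' If)) _.
by apply: avg_subset => //; exact: integrable_osc.
Qed.

Lemma avg_close D f g (e : R) : pos_finite D -> integrable_on D f -> integrable_on D g ->
  (forall x, D x -> `|f x - g x| <= e)%R -> (`|avg D f - avg D g| <= e)%R.
Proof.
move=> pD If Ig fg; rewrite -avgB//.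
apply: le_trans (avg_norm pD (integrable_onB pD If Ig)) _.
rewrite -[leRHS](avg_cst e pD); apply: le_avg => //.
- by apply: integrable_on_norm => //; exact: integrable_onB.
- exact: integrable_on_cst.
Qed.

Lemma osc_close D f g (e : R) : pos_finite D -> integrable_on D f -> integrable_on D g ->
  (forall x, D x -> `|f x - g x| <= e)%R -> (osc D f <= osc D g + e *+ 2)%R.
Proof.
move=> pD If Ig fg.
have fgavg := avg_close pD If Ig fg.
rewrite /osc -(avg_cst (e *+ 2) pD) -avgD//; first last.
- exact: integrable_on_cst.
- exact: integrable_osc.
apply: le_avg => //.
- exact: integrable_osc.
- by apply: integrable_onD => //; [exact: integrable_osc|exact: integrable_on_cst].
move=> x Dx.
have -> : (f x - avg D f = (f x - g x) + (g x - avg D g) + (avg D g - avg D f))%R by ring.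
apply: le_trans (ler_normD _ _) _; rewrite mulr2n [leRHS]addrA.
rewrite lerD//; last by rewrite distrC.
by rewrite [leRHS]addrC (le_trans (ler_normD _ _))// lerD2r fg.
Qed.

Lemma avg_norm_le D f : pos_finite D -> integrable_on D f ->
  (avg D (fun x => `|f x|) <= `|avg D f| + osc D f)%R.
Proof.
move=> pD If; rewrite -(avg_cst `|avg D f|%R pD) -avgD//; first last.
- exact: integrable_osc.
- exact: integrable_on_cst.
apply: le_avg => //.
- exact: integrable_on_norm.
- by apply: integrable_onD => //; [exact: integrable_on_cst|exact: integrable_osc].
by move=> x Dx; rewrite -{1}(subrK (avg D f) (f x)) addrC ler_normD.
Qed.

End averages.

Lemma nbhs_right0_itv {R : realType} (d : R) : (0 < d)%R ->
  \forall r \near (0%R : R)^'+, (0 < r < d)%R.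
Proof.
move=> d0; near=> r; apply/andP; split; near: r; first exact: nbhs_right_gt.
exact: nbhs_right_lt.
Unshelve. all: by end_near. Qed.

(** * Lebesgue points *)

Section lebesgue_values.
Context {R : realType} {X : pmetricType R} {S : set (set X)}.
Variable mu : {measure set (g_sigma_algebraType S) -> \bar R}.
Hypothesis hmu : complete_borel_measure mu.
Local Notation XS := (g_sigma_algebraType S).
Local Notation B x r := (ball x r : set XS).
Implicit Types (f : X -> R) (u v : X -> \bar R) (x : X).

Lemma average_avg f x r : pos_finite mu (B x r) -> integrable_on mu (B x r) f ->
  average mu (EFin \o f) x r = (avg mu (B x r) f)%:E.
Proof.
move=> pB If; have m0 := pos_finite_fine pB; case: pB => mB mB0 mBoo.
rewrite /average /avg EFinM /Rintegral fineK; last exact: integrable_fin_num.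
congr *%E; rewrite -{1}(@fineK _ (mu (B x r))) ?ge0_fin_numE//.
by rewrite inver gt_eqF.
Qed.

Lemma limsup_average_congr u v x (r0 : R) : (0 < r0)%R ->
  (forall r, (0 < r < r0)%R -> average mu u x r = average mu v x r) ->
  limsup_average mu u x = limsup_average mu v x.
Proof.
move=> r00; rewrite /limsup_average.
wlog suff : u v / (forall r, (0 < r < r0)%R -> average mu u x r = average mu v x r) ->
    limf_esup (average mu u x) 0^'+ <= limf_esup (average mu v x) 0^'+.
  move=> H uv; apply/eqP; rewrite eq_le; apply/andP.
  by split; apply: H => // r rr0; rewrite uv.
move=> uv; apply: le_ereal_inf_tmp => _ [V FV <-].
apply: (@le_trans _ _ (ereal_sup (average mu u x @` (V `&` [set r | (0 < r < r0)%R])))).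
  apply: ereal_inf_lbound; exists (V `&` [set r | (0 < r < r0)%R]) => //.
  apply: filterI => //; exact: nbhs_right0_itv.
apply: ge_ereal_sup => _ [r [Vr rr0] <-]; rewrite uv//.
by apply: ereal_sup_ubound; exists r.
Qed.

(** Stronger than convergence of the averages: unlike an upper limit of averages, this notion is
    compatible with Lipschitz functions of f and with differences. *)
Definition lebesgue_value f x (b : R) := forall e : R, (0 < e)%R ->
  exists2 d : R, (0 < d)%R & forall r, (0 < r < d)%R ->
    (avg mu (B x r) (fun y => `|f y - b|) <= e)%R.

Definition good_point f x := exists2 d : R, (0 < d)%R & forall r, (0 < r < d)%R ->
  pos_finite mu (B x r) /\ integrable_on mu (B x r) f.

Lemma limsup_average_lebesgue f x b : good_point f x -> lebesgue_value f x b ->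
  limsup_average mu (EFin \o f) x = b%:E.
Proof.
move=> [d1 d10 good] Lb.
have near (e : R) : (0 < e)%R -> exists2 d : R, (0 < d)%R & forall r, (0 < r < d)%R ->
    (b - e)%:E <= average mu (EFin \o f) x r <= (b + e)%:E.
  move=> e0; have [d d0 H] := Lb e e0.
  exists (Num.min d d1); first by rewrite lt_min d0.
  move=> r; rewrite lt_min => /andP[r0 /andP[rd rd1]].
  have [pB If] := good r (introT andP (conj r0 rd1)).
  rewrite average_avg// !lee_fin.
  have := le_trans (avg_sub_cst b pB If) (H r (introT andP (conj r0 rd))).
  by rewrite ler_norml => /andP[? ?]; apply/andP; split; lra.
apply/eqP; rewrite eq_le; apply/andP; split.
  apply/lee_addgt0Pr => e e0; have [d d0 H] := near e e0.
  apply: (@le_trans _ _ (ereal_sup (average mu (EFin \o f) x @` [set r | (0 < r < d)%R]))).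
    apply: ereal_inf_lbound; exists [set r | (0 < r < d)%R] => //.
    exact: nbhs_right0_itv.
  by apply: ge_ereal_sup => _ [r rd <-]; have /andP[] := H r rd.
apply: le_ereal_inf_tmp => _ [V FV <-]; apply/lee_addgt0Pr => e e0.
have [d d0 H] := near e e0.
have : (0^'+ : set_system R) (V `&` [set r | (0 < r < d)%R]).
  by apply: filterI => //; exact: nbhs_right0_itv.
move=> /filter_ex[r [Vr rd]].
have /andP[+ _] := H r rd; rewrite EFinB leeBlDr// => /le_trans; apply.
by rewrite leeD2r//; apply: ereal_sup_ubound; exists r.
Qed.

Lemma lebesgue_value_lip f x b (phi : R -> R) : measurable_fun setT phi ->
  (forall s t, `|phi s - phi t| <= `|s - t|)%R -> good_point f x ->
  measurable_fun setT (f : XS -> R) ->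
  lebesgue_value f x b -> lebesgue_value (phi \o f) x (phi b).
Proof.
move=> mphi lip [d1 d10 good] mf Lb e e0; have [d d0 H] := Lb e e0.
exists (Num.min d d1); first by rewrite lt_min d0.
move=> r; rewrite lt_min => /andP[r0 /andP[rd rd1]].
have [pB If] := good r (introT andP (conj r0 rd1)).
apply: le_trans (H r (introT andP (conj r0 rd))).
have Ifb := integrable_osc b pB If.
apply: le_avg => //; last by move=> y _ /=; exact: lip.
apply: integrable_on_le Ifb => //.
  apply: measurable_funTS; apply: (measurableT_comp (@normr_measurable R setT)).
  by apply: measurable_funB => //; exact: (measurableT_comp mphi).
by move=> y _ /=; rewrite !normr_id lip.
Qed.

Lemma lebesgue_valueB f g x b c : good_point f x -> good_point g x ->
  lebesgue_value f x b -> lebesgue_value g x c ->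
  lebesgue_value (fun y => f y - g y)%R x (b - c).
Proof.
move=> [d1 d10 goodf] [d2 d20 goodg] Lf Lg e e0.
have e20 : (0 < e / 2)%R by rewrite divr_gt0.
have [d3 d30 Hf] := Lf _ e20; have [d4 d40 Hg] := Lg _ e20.
exists (Num.min (Num.min d1 d2) (Num.min d3 d4)); first by rewrite !lt_min d10 d20 d30.
move=> r; rewrite !lt_min => /andP[r0 /andP[/andP[r1 r2] /andP[r3 r4]]].
have [pB If] := goodf r (introT andP (conj r0 r1)).
have [_ Ig] := goodg r (introT andP (conj r0 r2)).
rewrite (splitr e); apply: le_trans (lerD (Hf r _) (Hg r _)); rewrite ?r0//.
have Iof := integrable_osc b pB If; have Iog := integrable_osc c pB Ig.
rewrite -avgD//; apply: le_avg => //.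
- by apply: integrable_osc => //; exact: integrable_onB.
- exact: integrable_onD.
move=> y _.
have -> : (f y - g y - (b - c) = (f y - b) - (g y - c))%R by ring.
exact: ler_normB.
Qed.

End lebesgue_values.

(** * Doubling and decay of balls centred in E *)

Section doubling_geometry.
Context {R : realType} {X : pmetricType R} {Smu Snu : set (set X)}.
Variable mu : {measure set (g_sigma_algebraType Smu) -> \bar R}.
Variable nu : {measure set (g_sigma_algebraType Snu) -> \bar R}.
Variable E : set X.

Definition muB x r : R := fine (mu (ball x r)).
Definition nuB x r : R := fine (nu (ball x r)).

(** Hypothesis (a) in terms of real numbers and a single constant. Balls have positive finite
    measure up to radius 2 r0, since doubling at r0 speaks of the doubled ball, and K >= 1 lets the
    decay estimate include r' = r. *)
Record geometry (r0 K delta : R) : Prop := {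
  geo_r0 : (0 < r0)%R ;
  geo_K : (1 <= K)%R ;
  geo_delta : (0 < delta)%R ;
  geo_mu : forall x r, E x -> (0 < r)%R -> (r <= 2 * r0)%R ->
    pos_finite mu (ball x r : set (g_sigma_algebraType Smu)) ;
  geo_nu : forall x r, E x -> (0 < r)%R -> (r <= 2 * r0)%R ->
    pos_finite nu (ball x r : set (g_sigma_algebraType Snu)) ;
  geo_dbl_mu : forall x r, E x -> (0 < r)%R -> (r <= r0)%R ->
    (muB x (2 * r) <= K * muB x r)%R ;
  geo_dbl_nu : forall x r, E x -> (0 < r)%R -> (r <= r0)%R ->
    (nuB x (2 * r) <= K * nuB x r)%R ;
  geo_dec : forall x r' r, E x -> (0 < r')%R -> (r' <= r)%R -> (r <= r0)%R ->
    (nuB x r' <= K * (r' / r) `^ delta * nuB x r)%R }.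

Lemma doubling_geometry r0 : complete_borel_measure mu -> complete_borel_measure nu ->
  (0 < r0)%R -> E !=set0 -> doubling_conditions mu nu E r0 ->
  exists K delta, geometry r0 K delta.
Proof.
move=> hmu hnu r00 [x0 Ex0] [C [delta [C0 delta0 H]]].
have dbl x r : E x -> (0 < r)%R -> (r <= r0)%R ->
   [/\ 0 < mu (ball x (2 * r)) /\ mu (ball x (2 * r)) <= C%:E * mu (ball x r) < +oo &
    0 < nu (ball x (2 * r)) /\ nu (ball x (2 * r)) <= C%:E * nu (ball x r) < +oo].
  move=> Ex rp rr0; have r2 : (0 < r / 2)%R by rewrite divr_gt0.
  by have [] := H x (r / 2)%R r Ex r2 (ltac:(rewrite ltr_pdivrMr// ltr_pMr// ltr1n)) rr0.
have posmu x r : E x -> (0 < r)%R -> (r <= 2 * r0)%R ->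
    pos_finite mu (ball x r : set (g_sigma_algebraType Smu)).
  move=> Ex rp rr0; have r2 : (0 < r / 2)%R by rewrite divr_gt0.
  have r2r : (r / 2 <= r0)%R by rewrite ler_pdivrMr// mulrC.
  have [[m0 /andP[m1 m2]] _] := dbl x _ Ex r2 r2r.
  rewrite mulrCA mulfV// mulr1 in m0 m1.
  split => //; last exact: le_lt_trans m2.
  exact: (measurable_ballX hmu).
have posnu x r : E x -> (0 < r)%R -> (r <= 2 * r0)%R ->
    pos_finite nu (ball x r : set (g_sigma_algebraType Snu)).
  move=> Ex rp rr0; have r2 : (0 < r / 2)%R by rewrite divr_gt0.
  have r2r : (r / 2 <= r0)%R by rewrite ler_pdivrMr// mulrC.
  have [_ [m0 /andP[m1 m2]]] := dbl x _ Ex r2 r2r.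
  rewrite mulrCA mulfV// mulr1 in m0 m1.
  split => //; last exact: le_lt_trans m2.
  exact: (measurable_ballX hnu).
have le2 r : (r <= r0)%R -> (r <= 2 * r0)%R.
  by move=> rr0; rewrite (le_trans rr0)// ler_peMl ?ler1n ?(ltW r00).
have le22 r : (r <= r0)%R -> (2 * r <= 2 * r0)%R by move=> rr0; rewrite ler_pM2l.
exists (Num.max 1 C)%R, delta.
have CK : (C <= Num.max 1 C)%R by rewrite le_max lexx orbT.
split => //; first by rewrite le_max lexx.
- move=> x r Ex rp rr0.
  have [_ _ f1] := posmu x r Ex rp (le2 _ rr0).
  have [_ _ f2] := posmu x (2 * r)%R Ex (mulr_gt0 (ltr0Sn _ 1) rp) (le22 _ rr0).
  have [[_ /andP[m1 _]] _] := dbl x r Ex rp rr0.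
  have e1 : mu (ball x r) = (muB x r)%:E by rewrite fineK// ge0_fin_numE.
  have e2 : mu (ball x (2 * r)) = (muB x (2 * r))%:E by rewrite fineK// ge0_fin_numE.
  move: m1; rewrite e1 e2 -EFinM lee_fin => /le_trans; apply.
  by rewrite ler_wpM2r// /muB fine_ge0.
- move=> x r Ex rp rr0.
  have [_ _ f1] := posnu x r Ex rp (le2 _ rr0).
  have [_ _ f2] := posnu x (2 * r)%R Ex (mulr_gt0 (ltr0Sn _ 1) rp) (le22 _ rr0).
  have [_ [_ /andP[m1 _]]] := dbl x r Ex rp rr0.
  have e1 : nu (ball x r) = (nuB x r)%:E by rewrite fineK// ge0_fin_numE.
  have e2 : nu (ball x (2 * r)) = (nuB x (2 * r))%:E by rewrite fineK// ge0_fin_numE.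
  move: m1; rewrite e1 e2 -EFinM lee_fin => /le_trans; apply.
  by rewrite ler_wpM2r// /nuB fine_ge0.
- move=> x r' r Ex r'0; rewrite le_eqVlt => /predU1P[<- rr0|r'r rr0].
    rewrite mulfV ?gt_eqF// powR1 mulr1 ler_peMl ?fine_ge0//.
    by rewrite le_max lexx.
  have rp : (0 < r)%R by exact: lt_trans r'r.
  have rr02 := le2 _ rr0.
  have pr := posnu x r Ex rp rr02.
  have n0 : (0 < nuB x r)%R := pos_finite_fine pr.
  have [_ _ f1] := pr.
  have [_ _ f2] := posnu x r' Ex r'0 (le_trans (ltW r'r) rr02).
  have e1 : nu (ball x r) = (nuB x r)%:E by rewrite fineK// ge0_fin_numE.
  have e2 : nu (ball x r') = (nuB x r')%:E by rewrite fineK// ge0_fin_numE.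
  have [_ _] := H x r' r Ex r'0 r'r rr0.
  rewrite e1 e2 inver gt_eqF// -EFinM lee_fin ler_pdivrMr// => /le_trans; apply.
  by rewrite ler_wpM2r ?(ltW n0)// ler_wpM2r// powR_ge0.
Qed.

End doubling_geometry.

(** * Soft thresholding *)

Section soft_threshold.
Context {R : realType}.
Implicit Types (a b e s t : R).

(** For e >= 0 this is sgn(t) max(|t| - e, 0). *)
Definition soft (e t : R) : R := (t - clamp (- e) e t)%R.

Lemma clamp_mono a b s t : (s <= t)%R -> (clamp a b s <= clamp a b t)%R.
Proof.
move=> st; rewrite /clamp ge_max !le_max lexx/=; apply/orP; right.
by rewrite le_min !ge_min lexx st orbT.
Qed.

Lemma soft_lip e s t : (0 <= e)%R -> (`|soft e s - soft e t| <= `|s - t|)%R.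
Proof.
move=> e0; wlog st : s t / (t <= s)%R.
  move=> H; have [/H//|/ltW/H] := leP t s.
  by rewrite distrC (distrC s).
have ee : (- e <= e)%R by rewrite ge0_cp.
have h1 := clamp_mono (- e) e st.
have := clamp_lip s t ee.
rewrite (ger0_norm (_ : 0 <= clamp (- e) e s - _)%R) ?subr_ge0//.
rewrite (ger0_norm (_ : 0 <= s - t)%R) ?subr_ge0// => h2.
by rewrite /soft ger0_norm; lra.
Qed.

Lemma soft_close e t : (0 <= e)%R -> (`|t - soft e t| <= e)%R.
Proof.
move=> e0; rewrite /soft opprB addrC subrK ler_norml /clamp.
by rewrite le_max lexx/= ge_max ge0_cp//= ge_min lexx orbT.
Qed.

Lemma measurable_clamp a b : measurable_fun setT (clamp a b).
Proof.
apply: (@measurable_maxr _ _ R); first exact: measurable_cst.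
by apply: (@measurable_minr _ _ R) => //; exact: measurable_cst.
Qed.

Lemma measurable_soft e : measurable_fun setT (soft e).
Proof. by apply: measurable_funB => //; exact: measurable_clamp. Qed.

(** The threshold vanishes for |t| <= e, and beyond that |t| / e is at most its p-th power. *)
Lemma soft_le p e t : (1 <= p)%R -> (0 < e)%R -> (`|soft e t| <= e * (`|t| / e) `^ p)%R.
Proof.
move=> p1 e0; have [te|et] := leP `|t|%R e.
  rewrite /soft clamp_id ?subrr ?normr0 -?ler_norml//.
  by rewrite mulr_ge0 ?powR_ge0// ltW.
have te1 : (1 <= `|t| / e)%R by rewrite ler_pdivlMr// mul1r ltW.
apply: (@le_trans _ _ `|t|%R).
  have := soft_lip t 0 (ltW e0); rewrite {2}/soft clamp_id ?subr0//.
  by rewrite oppr_le0 ltW.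
rewrite -[leLHS](mulfVK (lt0r_neq0 e0)) mulrC ler_pM2l//.
rewrite -[leLHS]powRr1 ?ler_powR//.
by rewrite divr_ge0 ?(ltW e0).
Qed.

End soft_threshold.

(** * Admissible pairs and the Poincare inequality for them *)

Section admissible.
Context {R : realType} {X : pmetricType R} {S : set (set X)}.
Variable mu : {measure set (g_sigma_algebraType S) -> \bar R}.
Hypothesis hmu : complete_borel_measure mu.
Variables (p : R) (p_ge1 : (1 <= p)%R).
Local Notation XS := (g_sigma_algebraType S).
Local Notation B x r := (ball x r : set XS).
Implicit Types (f : X -> R) (G : X -> \bar R) (loc : bool).

Let p_gt0 : (0 < p)%R. Proof. exact: lt_le_trans p_ge1. Qed.

(* The flag distinguishes D^p, whose elements are locally integrable, from
   N^{1,p}, whose elements are only p-integrable (balls may have infinite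
   measure). *)
Definition base_integrable loc f : Prop :=
  if loc then in_Lploc mu 1 (EFin \o f)
  else \int[mu]_x ((`|f x| `^ p)%:E) < +oo.

(** The common frame for both spaces: [f] is real everywhere, and [G] is any p-integrable weak upper
    gradient rather than the minimal one, so that it can be restricted to slices of [f] and added to
    another. *)
Record admissible loc f G : Prop := {
  adm_meas : measurable_fun setT (f : XS -> R) ;
  adm_base : base_integrable loc f ;
  adm_wug : weak_upper_gradient mu p (EFin \o f) G ;
  adm_Lp : borel_Lp mu p G }.

Definition energy G x r : R := fine (\int[mu]_(y in B x r) (G y `^ p)).

Lemma energyE G x r : borel_Lp mu p G ->
  \int[mu]_(y in B x r) (G y `^ p) = (energy G x r)%:E.
Proof.
move=> [bG G0 Goo]; rewrite fineK// ge0_fin_numE; last first.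
  by apply: integral_ge0 => y _; exact: poweR_ge0.
apply: le_lt_trans Goo; apply: ge0_subset_integral => //.
- exact: (measurable_ballX hmu).
- by apply: (borel_fun_measurable hmu); exact: borel_poweR.
- by move=> y _; exact: poweR_ge0.
Qed.

Lemma energy_ge0 G x r : (0 <= energy G x r)%R.
Proof. by apply: fine_ge0; apply: integral_ge0 => y _; exact: poweR_ge0. Qed.

Lemma in_Lploc1P (u : X -> \bar R) : in_Lploc mu 1 u <->
  forall x r, (0 < r)%R -> mu.-integrable (B x r) u.
Proof.
split=> H x r r0.
  have [mu' uoo] := (in_LpP mu u ltr01 (measurable_ballX hmu x r)).1 (H x r r0).
  apply/integrableP; split => //; move: uoo; congr (_ < _).
  by apply: eq_integral => y _; rewrite poweRe1.
have /integrableP[mu' uoo] := H x r r0.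
apply/(in_LpP mu u ltr01 (measurable_ballX hmu x r)); split => //.
move: uoo; congr (_ < _).
by apply: eq_integral => y _; rewrite poweRe1.
Qed.

Lemma le_1_powR (t : R) : (0 <= t)%R -> (t <= 1 + t `^ p)%R.
Proof.
move=> t0; have [t1|t1] := leP t 1%R.
  by rewrite (le_trans t1)// lerDl powR_ge0.
rewrite -[leLHS](powRr1 t0) -[leLHS]add0r lerD// ler_powR// ltW//.
Qed.

(** In the p-integrable case, |f| <= 1 + |f|^p, and the constant 1 is integrable on a ball of finite
    measure. *)
Lemma admissible_integrable loc f G x r : admissible loc f G -> (0 < r)%R ->
  pos_finite mu (B x r) -> integrable_on mu (B x r) f.
Proof.
move=> [mf bf _ _] r0 pB; case: loc bf => /= [/in_Lploc1P H|foo]; first exact: H.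
have mfB : measurable_fun (B x r) (EFin \o f : XS -> \bar R).
  by apply: measurable_funTS; exact/measurable_EFinP.
have mfp : measurable_fun setT (fun y : XS => (`|f y| `^ p)%:E).
  apply/measurable_EFinP; apply: (measurableT_comp (measurable_powR p)).
  exact: (measurableT_comp (@normr_measurable R setT)).
have [mB _ mBoo] := pB.
apply/integrableP; split => //.
apply: (@le_lt_trans _ _ (\int[mu]_(y in B x r) (1 + (`|f y| `^ p)%:E))).
  apply: ge0_le_integral => //.
  - exact: measurableT_comp mfB.
  - by apply: emeasurable_funD => //; exact: measurable_funTS.
  - by move=> y _ /=; rewrite -EFinD lee_fin le_1_powR.
rewrite ge0_integralD//.
- rewrite integral_cst// mul1e; apply: lte_add_pinfty => //.
  apply: le_lt_trans foo; apply: ge0_subset_integral => //.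
  exact: measurable_funTS.
Qed.

Lemma diam_ball (x : X) (r : R) : (0 < r)%R -> diam (ball x r) <= (2 * r)%:E.
Proof.
move=> r0; apply: ge_ereal_sup => _ [y xy [z xz <-]].
rewrite lee_fin (le_trans (metric_triangle _ x _))// mulr_natl mulr2n.
move: xy xz; rewrite !ballEmdist/= => xy xz.
by rewrite lerD// ?(ltW xz)// metric_sym ltW.
Qed.

Section poincare.
Variables (E : set X) (r0 : R).
Hypothesis hb : poincare_inequality mu p E r0.
Hypothesis hpos : forall x r, E x -> (0 < r)%R -> (r <= 2 * r0)%R ->
  pos_finite mu (B x r).

(** The hypothesis with any weak upper gradient [G] in place of the minimal one, which is at most
    [G] almost everywhere. The diameter is at most 2 r, whence the constant 2 C. *)
Let poincare_loc : exists C lam : R, [/\ (0 < C)%R, (1 <= lam)%R &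
  forall f G x r, admissible true f G -> E x -> (0 < r)%R -> (lam * r <= r0)%R ->
  (osc mu (B x r) f <= C * r * (energy G x (lam * r) / muB mu x (lam * r)) `^ p^-1)%R].
Proof.
have [C [lam [C0 lam1 H]]] := hb; exists (C * 2)%R, lam; split => //.
  by rewrite mulr_gt0.
move=> f G x r [mf bf ug GLp] Ex rp lr.
have lam0 : (0 < lam)%R by exact: lt_le_trans lam1.
have rr0 : (r <= r0)%R by rewrite (le_trans _ lr)// ler_peMl ?(ltW rp).
have r00 : (0 < r0)%R by exact: lt_le_trans rr0.
have r02 : (r0 <= 2 * r0)%R by rewrite ler_peMl ?ler1n ?(ltW r00).
have lrp : (0 < lam * r)%R by rewrite mulr_gt0.
have pB := hpos Ex rp (le_trans rr0 r02).
have plB := hpos Ex lrp (le_trans lr r02).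
have [g gmin gLp] := exists_minimal_weak_upper_gradient hmu p_gt0 ug GLp.
have [bG G0 Goo] := GLp.
have [ug' gloc gle] := gmin.
have [bg g0 goo] := gLp.
have gLpT : in_Lp mu setT p g.
  apply/(in_LpP mu g p_gt0 measurableT); split; first exact: (borel_fun_measurable hmu).
  by move: goo; congr (_ < _); apply: eq_integral => y _; rewrite gee0_abs.
have If : integrable_on mu (B x r) f by apply: (in_Lploc1P _).1 bf x r rp.
have := H x r Ex rp rr0 (EFin \o f) g bf gmin gLpT.
rewrite (_ : (mu (ball x r))^-1 * _ = (osc mu (B x r) f)%:E); last first.
  rewrite /osc -average_avg//; last exact: integrable_osc.
  by rewrite [in RHS]/average; congr *%E; apply: eq_integral => y _; rewrite average_avg.
have gG : \int[mu]_(y in B x (lam * r)) (g y `^ p) <= (energy G x (lam * r))%:E.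
  rewrite -energyE//; apply: ae_ge0_le_integral => //.
  - exact: (measurable_ballX hmu).
  - by move=> y _; exact: poweR_ge0.
  - by apply: measurable_funTS; apply: (borel_fun_measurable hmu); exact: borel_poweR.
  - by move=> y _; exact: poweR_ge0.
  - by apply: measurable_funTS; apply: (borel_fun_measurable hmu); exact: borel_poweR.
  have gleG : {ae mu, forall y : XS, g y <= G y} := gle _ ug (borel_Lp_loc hmu p_gt0 GLp).
  apply: filterS gleG => y gy _.
  by apply: lee_poweR => //; exact: ltW.
have ml0 : (0 < muB mu x (lam * r))%R := pos_finite_fine plB.
have [_ _ mloo] := plB.
have -> : (mu (ball x (lam * r)))^-1 = ((muB mu x (lam * r))^-1)%:E.
  rewrite -(_ : (muB mu x (lam * r))%:E = mu (ball x (lam * r))).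
    by rewrite inver gt_eqF.
  by rewrite fineK// ge0_fin_numE.
move=> Hle; rewrite -lee_fin; apply: (le_trans Hle).
rewrite EFinM -poweR_EFin; apply: lee_pmul.
- rewrite mule_ge0 ?lee_fin ?(ltW C0)//; apply: ereal_sup_ubound.
  by exists x; [exact: ballxx|exists x; [exact: ballxx|rewrite mdistxx]].
- exact: poweR_ge0.
- rewrite -mulrA EFinM lee_pmul2l ?lte_fin//.
  exact: diam_ball.
apply: lee_poweR; first by rewrite invr_ge0 ltW.
  rewrite mule_ge0 ?lee_fin ?invr_ge0 ?(ltW ml0)//.
  by apply: integral_ge0 => y _; exact: poweR_ge0.
by rewrite (mulrC (energy _ _ _)) EFinM lee_pmul2l ?lte_fin ?invr_gt0.
Qed.

Lemma admissible_lip loc loc' f f' G : admissible loc f G ->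
  measurable_fun setT (f' : XS -> R) -> base_integrable loc' f' ->
  (forall x y, `|f' x - f' y| <= `|f x - f y|)%R -> admissible loc' f' G.
Proof.
move=> [mf bf ug GLp] mf' bf' lip; split => //.
apply: (weak_upper_gradient_lip hmu p_gt0) ug _; last exact: pae_curve_lty.
by move=> x y _ _ /=; rewrite lee_fin lip.
Qed.

Lemma in_Lploc1_le f (h : X -> R) : measurable_fun setT (f : XS -> R) ->
  (forall x, `|f x| <= h x)%R ->
  (forall x r, (0 < r)%R -> mu.-integrable (B x r) (EFin \o h)) ->
  in_Lploc mu 1 (EFin \o f).
Proof.
move=> mf fh Ih; apply/in_Lploc1P => x r rp.
apply: le_integrable (Ih x r rp).
- exact: (measurable_ballX hmu).
- by apply: measurable_funTS; exact/measurable_EFinP.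
by move=> y _ /=; rewrite lee_fin (le_trans (fh y))// ler_norm.
Qed.

(* A p-integrable f need not be integrable on balls of infinite measure, but its
   soft threshold is at most e (|f| / e)^p, so that the Poincare inequality
   applies to it; letting e tend to 0 gives the inequality for f. *)
Lemma admissible_soft f G e : (0 < e)%R -> admissible false f G ->
  admissible true (soft e \o f) G.
Proof.
move=> e0 af; have [mf foo _ _] := af.
have msf : measurable_fun setT (soft e \o f : XS -> R).
  exact: (measurableT_comp (measurable_soft e)).
apply: (admissible_lip af msf); last first.
  by move=> x y /=; apply: soft_lip; exact: ltW.
have mfp : measurable_fun setT (fun y : XS => (`|f y| `^ p)%:E).
  apply/measurable_EFinP; apply: (measurableT_comp (measurable_powR p)).
  exact: (measurableT_comp (@normr_measurable R setT)).
apply: (@in_Lploc1_le _ (fun y => (e * (e^-1 `^ p)) * `|f y| `^ p)%R) => [|y|]; first exact: msf.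
  apply: le_trans (soft_le (f y) p_ge1 e0) _.
  by rewrite powRM ?invr_ge0 ?(ltW e0)// -mulrA ler_pM2l// mulrC.
move=> x r rp; apply: (integrableS (E := setT)) => //.
  exact: (measurable_ballX hmu).
have Ifp : mu.-integrable setT (fun y : XS => (`|f y| `^ p)%:E).
  apply/integrableP; split => //; move: foo; congr (_ < _).
  by apply: eq_integral => y _; rewrite gee0_abs// lee_fin powR_ge0.
by have := integrableZl measurableT (e * (e^-1 `^ p))%R Ifp; apply: eq_integrable.
Qed.

Lemma admissible_poincare : exists C lam : R, [/\ (0 < C)%R, (1 <= lam)%R &
  forall loc f G x r, admissible loc f G -> E x -> (0 < r)%R -> (lam * r <= r0)%R ->
  (osc mu (B x r) f <= C * r * (energy G x (lam * r) / muB mu x (lam * r)) `^ p^-1)%R].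
Proof.
have [C [lam [C0 lam1 H]]] := poincare_loc; exists C, lam; split => //.
move=> [] f G x r af Ex rp lr; first exact: H.
apply/ler_addgt0Pr => e e0.
(* Half of e, because [osc_close] counts the pointwise error twice: once for the values and once for
   their average. *)
have e20 : (0 < e / 2)%R by rewrite divr_gt0.
have rr0 : (r <= r0)%R by rewrite (le_trans _ lr)// ler_peMl ?(ltW rp).
have r02 : (r <= 2 * r0)%R.
  by rewrite (le_trans rr0)// ler_peMl ?ler1n// (le_trans (ltW rp)).
have pB := hpos Ex rp r02.
have asf := admissible_soft e20 af.
have := @osc_close _ _ _ mu _ f (soft (e / 2) \o f) (e / 2) pB
  (admissible_integrable af rp pB) (admissible_integrable asf rp pB)
  (fun y _ => soft_close (f y) (ltW e20)).
rewrite (_ : e / 2 *+ 2 = e)%R; last by lra.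
move=> /le_trans; apply.
by rewrite lerD2r; exact: H.
Qed.

End poincare.

End admissible.

(** * The weak type estimate *)

Section hedberg.
Context {R : realType}.
Local Open Scope ring_scope.
Implicit Types (n N Gam : nat -> R).

Lemma ler_powR2 (r x y : R) : 0 <= r -> 0 <= x -> x <= y -> x `^ r <= y `^ r.
Proof.
move=> r0 x0 xy; apply: ge0_ler_powR => //; rewrite nnegrE//.
exact: le_trans xy.
Qed.

Lemma eq_ler (x y : R) : x = y -> x <= y. Proof. by move->. Qed.

Lemma one_powR (r : R) : 1 `^ r = 1. Proof. by rewrite powR1. Qed.

Lemma exprn_powR (x r : R) k : 0 <= x -> (x ^+ k) `^ r = (x `^ r) ^+ k.
Proof. by move=> x0; rewrite -powR_mulrn// powRAC powR_mulrn// powR_ge0. Qed.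

Lemma sum_geometric_le (th : R) J : 0 <= th < 1 ->
  \sum_(j < J) th ^+ j <= (1 - th)^-1.
Proof.
move=> /andP[th0 th1].
have h : 0 < 1 - th by rewrite subr_gt0.
rewrite -[leRHS]mul1r ler_pdivlMr// mulrC.
have -> : (1 - th) * \sum_(j < J) th ^+ j = 1 - th ^+ J.
  by rewrite -opprB mulNr -subrX1 opprB.
by rewrite gerBl exprn_ge0.
Qed.

Section decay.
Variables (K th b : R).
Hypotheses (K1 : 1 <= K) (th01 : 0 < th < 1) (b0 : 0 < b).

Let th0 : 0 < th. Proof. by case/andP: th01. Qed.

Let eta01 : 0 <= th `^ b < 1.
Proof.
case/andP: th01 => t0 t1; rewrite powR_ge0/= -[ltRHS](one_powR b).
by apply: gt0_ltr_powR; rewrite ?nnegrE ?ler01// ltW.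
Qed.

Let dec_powR (x y : R) k : 0 < x -> x <= K * th ^+ k * y -> 0 < y ->
  x `^ b <= K `^ b * (th `^ b) ^+ k * y `^ b.
Proof.
move=> x0 xy y0.
have K0 : 0 <= K by exact: le_trans K1.
have tk := exprn_ge0 k (ltW th0).
apply: le_trans (ler_powR2 (ltW b0) (ltW x0) xy) _.
by rewrite (powRM b (mulr_ge0 K0 tk) (ltW y0)) (powRM b K0 tk) exprn_powR// ltW.
Qed.

(** Dropping leading terms above 1, one may assume that the first term is at most 1; the decay from
    there on dominates the sum by a geometric series. *)
Lemma sum_decay_small n J : (forall j, 0 < n j) ->
  (forall i j, (i <= j)%N -> n j <= K * th ^+ (j - i) * n i) ->
  \sum_(j < J | n j <= 1) n j `^ b <= K `^ b / (1 - th `^ b).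
Proof.
have C0 : 0 <= K `^ b / (1 - th `^ b).
  by case/andP: eta01 => ? ?; rewrite mulr_ge0 ?powR_ge0// invr_ge0 subr_ge0 ltW.
elim: J n => [|J IH] n n0 dec; first by rewrite big_ord0.
rewrite big_mkcond big_ord_recl /=; case: ifPn => [n01|n01]; last first.
  rewrite add0r; have := IH (fun j => n j.+1) (fun j => n0 _).
  rewrite big_mkcond; apply => i j ij.
  by rewrite -subSS; exact: dec.
apply: (@le_trans _ _ (\sum_(j < J.+1) K `^ b * (th `^ b) ^+ j)).
  have term j : n j `^ b <= K `^ b * (th `^ b) ^+ j.
    have := dec 0%N j (leq0n _); rewrite subn0 => /dec_powR -/(_ (n0 _) (n0 _)) /le_trans; apply.
    rewrite ler_piMr// ?mulr_ge0 ?powR_ge0 ?exprn_ge0 ?powR_ge0//.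
    by rewrite -[leRHS](one_powR b); apply: ler_powR2 n01; exact: ltW.
  rewrite [leRHS]big_ord_recl; apply: lerD; first exact: (term 0%N).
  apply: ler_sum => j _; case: ifP => _; first exact: (term (bump 0 j)).
  by rewrite mulr_ge0 ?powR_ge0 ?exprn_ge0 ?powR_ge0.
by rewrite -mulr_sumr ler_wpM2l ?powR_ge0// sum_geometric_le.
Qed.

(** The mirror image: the last index with a term above 1 is the reference, and going backwards from
    it the terms n_j^(-b) decay geometrically. *)
Lemma sum_decay_large n J : (forall j, 0 < n j) ->
  (forall i j, (i <= j)%N -> n j <= K * th ^+ (j - i) * n i) ->
  \sum_(j < J | 1 < n j) n j `^ (- b) <= K `^ b / (1 - th `^ b).
Proof.
have C0 : 0 <= K `^ b / (1 - th `^ b).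
  by case/andP: eta01 => ? ?; rewrite mulr_ge0 ?powR_ge0// invr_ge0 subr_ge0 ltW.
move=> n0 dec; elim: J => [|J IH]; first by rewrite big_ord0.
rewrite big_mkcond big_ord_recr /=; case: ifPn => [nJ1|nJ1]; last first.
  by rewrite addr0 -big_mkcond.
apply: (@le_trans _ _ (\sum_(j < J.+1) K `^ b * (th `^ b) ^+ (J - j))).
  have term j : (j <= J)%N -> n j `^ (- b) <= K `^ b * (th `^ b) ^+ (J - j).
    move=> jJ; have := dec_powR (n0 _) (dec j J jJ) (n0 _).
    rewrite powRN => h.
    have nj0 : 0 < n j `^ b by rewrite powR_gt0.
    rewrite -[leLHS]mul1r ler_pdivrMr//; apply: le_trans h.
    by rewrite -[leLHS](one_powR b); apply: ler_powR2 (ltW nJ1); [exact: ltW|exact: ler01].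
  rewrite [leRHS]big_ord_recr; apply: lerD; last exact: (term J).
  apply: ler_sum => j _; case: ifP => _; first by apply: (term j); exact: ltnW.
  by rewrite mulr_ge0 ?powR_ge0 ?exprn_ge0 ?powR_ge0.
rewrite -mulr_sumr ler_wpM2l ?powR_ge0//.
rewrite (reindex_inj rev_ord_inj)/=.
rewrite (eq_bigr (fun j : 'I_J.+1 => (th `^ b) ^+ j)).
  by apply: sum_geometric_le.
by move=> j _; rewrite subSS subKn// -ltnS.
Qed.

End decay.

(** [ip] and [iq] stand for 1/p and 1/q. The exponents in the two halves of the sum are 1/p - 1/q
    and -1/q; the smaller absolute value serves for both, and each half contributes one of the two
    copies. *)
Definition hedberg_const (K th ip iq : R) : R :=
  let b := Num.min iq (ip - iq) in (K `^ b / (1 - th `^ b)) *+ 2.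

Lemma hedberg_const_ge0 K th ip iq : 0 < th < 1 -> 0 < iq -> iq < ip ->
  0 <= hedberg_const K th ip iq.
Proof.
move=> /andP[th0 th1] iq0 iqip; rewrite /hedberg_const mulrn_wge0//.
rewrite mulr_ge0 ?powR_ge0// invr_ge0 subr_ge0 -[leRHS](one_powR (Num.min iq (ip - iq))).
by rewrite ler_powR2 ?(ltW th0) ?(ltW th1)// le_min (ltW iq0) subr_ge0 ltW.
Qed.

(** Each Gam_j is bounded by both T and M N_j. The second bound is used where M N_j <= T and leaves
    a positive power of N_j, the first one elsewhere and leaves a negative power; geometric decay
    sums both. *)
Lemma hedberg N Gam (K th T M ip iq : R) J : 1 <= K -> 0 < th < 1 ->
  0 < iq -> iq < ip -> 0 <= T -> 0 <= M -> (forall j, 0 < N j) ->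
  (forall i j, (i <= j)%N -> N j <= K * th ^+ (j - i) * N i) ->
  (forall j, 0 <= Gam j <= T) -> (forall j, Gam j <= M * N j) ->
  \sum_(j < J) N j `^ (- iq) * Gam j `^ ip <=
    hedberg_const K th ip iq * (T `^ (ip - iq) * M `^ iq).
Proof.
move=> K1 th01 iq0 iqip T0 M0 N0 dec GT GM.
have ip0 : 0 < ip by exact: lt_trans iqip.
have al0 : 0 < ip - iq by rewrite subr_gt0.
have rhs0 : 0 <= hedberg_const K th ip iq * (T `^ (ip - iq) * M `^ iq).
  by rewrite mulr_ge0 ?hedberg_const_ge0// mulr_ge0 ?powR_ge0.
have [zero|] := pselect (forall j, Gam j = 0).
  rewrite big1// => j _; rewrite zero powR0 ?mulr0// gt_eqF//.
move=> /existsNP[j0 /eqP Gj0].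
have Gj0p : 0 < Gam j0 by rewrite lt_neqAle eq_sym Gj0; case/andP: (GT j0).
have Tp : 0 < T by apply: (lt_le_trans Gj0p); case/andP: (GT j0).
have Mp : 0 < M.
  have := lt_le_trans Gj0p (GM j0).
  by rewrite pmulr_lgt0.
(* Normalization to the crossover value 1: the j-th term is at most L n_j^(1/p - 1/q), and also at
   most L n_j^(-1/q). *)
pose n j := N j * (M / T).
have MT0 : 0 < M / T by rewrite divr_gt0.
have n0 j : 0 < n j by rewrite mulr_gt0.
have ndec i j : (i <= j)%N -> n j <= K * th ^+ (j - i) * n i.
  by move=> ij; rewrite /n [leRHS]mulrA ler_wpM2r ?(ltW MT0)// dec.
pose b := Num.min iq (ip - iq).
have b0 : 0 < b by rewrite lt_min iq0.
pose L := T `^ (ip - iq) * M `^ iq.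
have L0 : 0 <= L by rewrite mulr_ge0 ?powR_ge0.
have nzT : T != 0 by rewrite gt_eqF. have nzM : M != 0 by rewrite gt_eqF.
have term j : N j `^ (- iq) * Gam j `^ ip <=
    L * (if n j <= 1 then n j `^ b else n j `^ (- b)).
  have nzN : N j != 0 by rewrite gt_eqF.
  have /andP[G0 GT'] := GT j.
  have nE r : n j `^ r = N j `^ r * (M `^ r * T `^ (- r)).
    rewrite /n powRM ?(ltW (N0 j)) ?(ltW MT0)// powRM ?(ltW Mp) ?invr_ge0 ?(ltW Tp)//.
    by rewrite -powR_inv1 ?(ltW Tp)// -powRrM mulN1r.
  case: ifPn => [n1|]; last rewrite -ltNge => n1.
    apply: (@le_trans _ _ (L * n j `^ (ip - iq))).
      apply: (@le_trans _ _ (N j `^ (- iq) * (M * N j) `^ ip)).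
        by rewrite ler_wpM2l ?powR_ge0// ler_powR2// ltW.
      rewrite powRM ?(ltW Mp) ?(ltW (N0 j))// nE /L.
      rewrite powRN.
      rewrite (_ : M `^ ip = M `^ iq * M `^ (ip - iq)); last first.
        by rewrite -powRD ?subrKC// nzM implybT.
      rewrite (_ : N j `^ ip = N j `^ iq * N j `^ (ip - iq)); last first.
        by rewrite -powRD ?subrKC// nzN implybT.
      rewrite powRN.
      have hN : N j `^ iq != 0 by rewrite gt_eqF// powR_gt0.
      have hT : T `^ (ip - iq) != 0 by rewrite gt_eqF// powR_gt0.
      by apply: eq_ler; field; rewrite hN hT.
    by rewrite ler_wpM2l// ger_powR ?n1 ?n0// ge_min lexx orbT.
  apply: (@le_trans _ _ (L * n j `^ (- iq))).
    apply: (@le_trans _ _ (N j `^ (- iq) * T `^ ip)).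
      by rewrite ler_wpM2l ?powR_ge0// ler_powR2// ltW.
    rewrite nE /L opprK (powRN M).
    rewrite (_ : T `^ ip = T `^ iq * T `^ (ip - iq)); last first.
      by rewrite -powRD ?subrKC// nzT implybT.
    have hM : M `^ iq != 0 by rewrite gt_eqF// powR_gt0.
    by apply: eq_ler; field; rewrite hM.
  by rewrite ler_wpM2l// ler_powR ?(ltW n1)// lerN2 ge_min lexx.
apply: le_trans; first by apply: ler_sum => j _; exact: term.
rewrite -mulr_sumr mulrC /L ler_wpM2r//.
have -> : \sum_(i < J) (if n i <= 1 then n i `^ b else n i `^ (- b)) =
    \sum_(i < J | n i <= 1) n i `^ b + \sum_(i < J | 1 < n i) n i `^ (- b).
  rewrite (big_mkcond (fun i : 'I_J => n i <= 1)) (big_mkcond (fun i : 'I_J => 1 < n i)).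
  rewrite -big_split; apply: eq_bigr => i _ /=.
  by rewrite ltNge; case: ifP => _; rewrite ?addr0 ?add0r.
rewrite /hedberg_const -/b mulr2n lerD//.
  exact: sum_decay_small.
exact: sum_decay_large.
Qed.

End hedberg.

(** * Coverings *)

Section vitali.
Context {R : realType} {X : pmetricType R}.
Local Open Scope ring_scope.

Lemma ball_sub_ball3 (x y : X) (r s : R) : s <= r -> ball x r `&` ball y s !=set0 ->
  ball y s `<=` ball x (3 * r).
Proof.
move=> sr [z []]; rewrite !ballEmdist/= => xz yz w /= yw.
apply: le_lt_trans (metric_triangle x z w) _.
apply: (@lt_le_trans _ _ (r + (s + s))); last by lra.
apply: ltrD => //; apply: le_lt_trans (metric_triangle z y w) _.
by apply: ltrD => //; rewrite metric_sym.
Qed.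

(** Greedy choice: keep a ball of largest radius, discard the balls meeting it, which lie in its
    threefold enlargement, and recurse on the rest. *)
Lemma vitali_finite (s : seq (X * R)) : (forall i, i \in s -> 0 < i.2) ->
  exists D : seq (X * R), [/\ uniq D, {subset D <= s},
    trivIset [set` D] (fun i => ball i.1 i.2) &
    forall i, i \in s -> exists2 j, j \in D & ball i.1 i.2 `<=` ball j.1 (3 * j.2)].
Proof.
have [k] := ubnP (size s); elim: k s => // k IH s; rewrite ltnS => sk s0.
have [->|s_n0] := eqVneq s [::].
  by exists [::]; split => //; exact: trivIset_set0.
have [m ms mmax] : exists2 m, m \in s & forall i, i \in s -> i.2 <= m.2.
  elim: s s_n0 {sk s0} => // a [|b s] IHs _.
    by exists a; rewrite ?mem_head// => i; rewrite inE => /eqP ->.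
  have [m ms mmax] := IHs isT.
  have [am|ma] := leP a.2 m.2.
    exists m; first by rewrite inE ms orbT.
    by move=> i; rewrite inE => /predU1P[->|/mmax].
  exists a; first by rewrite mem_head.
  move=> i; rewrite inE => /predU1P[->//|/mmax im].
  exact: le_trans im (ltW ma).
pose meets i := `[< ball m.1 m.2 `&` ball i.1 i.2 !=set0 >].
pose s' := [seq i <- s | ~~ meets i].
have m0 := s0 _ ms.
have mm : meets m by apply/asboolP; exists m.1; split; exact: ballxx.
have s's : (size s' < size s)%N.
  rewrite size_filter -(count_predC meets s) addnC -ltn_subLR ?subnn//.
  by rewrite -has_count; apply/hasP; exists m.
have [D [uD Ds tD cD]] := IH s' (leq_trans s's sk)
  (fun i => fun h => s0 i (mem_subseq (filter_subseq _ _) h)).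
have mD i : i \in D -> ~~ meets i by move=> /Ds; rewrite mem_filter => /andP[].
exists (m :: D); split.
- by rewrite /= uD andbT; apply/negP => /mD; rewrite mm.
- move=> i; rewrite inE => /predU1P[->//|/Ds].
  by rewrite mem_filter => /andP[].
- move=> i j /=; rewrite !inE => /predU1P[->|iD] /predU1P[->|jD] //.
  + by move=> h; have := mD j jD; rewrite /meets; move/asboolP => /(_ h).
  + by rewrite setIC => h; have := mD i iD; rewrite /meets; move/asboolP => /(_ h).
  + exact: tD.
move=> i is_.
have [mi|nmi] := boolP (meets i).
  exists m; first by rewrite mem_head.
  by apply: ball_sub_ball3; [exact: mmax|exact/asboolP].
have [|j jD ij] := cD i; first by rewrite mem_filter nmi.
by exists j => //; rewrite inE jD orbT.
Qed.

(** The centres in the definition of total boundedness need not lie in E, but only balls centred in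
    E are controlled. So each useful centre of a net of radius e/2 is moved to a nearby point of
    E. *)
Lemma totally_bounded_net (E : set X) (e : R) : totally_bounded E -> 0 < e ->
  exists F : seq X, (forall z, z \in F -> E z) /\
    (forall x, E x -> exists2 z, z \in F & ball z e x).
Proof.
move=> tb e0; have e20 : 0 < e / 2 by rewrite divr_gt0.
have [F0 /finite_seqP[s ->] EF] := tb _ e20.
have [f Hf] : exists f : X -> X, forall x, (exists y, E y /\ ball x (e / 2) y) ->
    E (f x) /\ ball x (e / 2) (f x).
  suff /choice[f Hf] : forall x, exists y, (exists y, E y /\ ball x (e / 2) y) ->
    E y /\ ball x (e / 2) y by exists f.
  move=> x; have [[y Hy]|no] := pselect (exists y, E y /\ ball x (e / 2) y).
    by exists y.
  by exists x.
exists [seq f x | x <- s & `[< exists y, E y /\ ball x (e / 2) y >]]; split.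
  move=> _ /mapP[x + ->]; rewrite mem_filter => /andP[/asboolP/Hf[]] //.
move=> y Ey; have [x /= xs xy] := EF y Ey.
have ex : exists y, E y /\ ball x (e / 2) y by exists y.
exists (f x).
  by apply/mapP; exists x => //; rewrite mem_filter xs andbT; apply/asboolP.
have [_ xf] := Hf x ex.
by rewrite (splitr e); apply: ball_triangle xy; apply: ball_sym.
Qed.

End vitali.

(** * The maximal function *)

Section weak_type.
Context {R : realType} {X : pmetricType R} {Smu Snu : set (set X)}.
Variable mu : {measure set (g_sigma_algebraType Smu) -> \bar R}.
Variable nu : {measure set (g_sigma_algebraType Snu) -> \bar R}.
Hypotheses (hmu : complete_borel_measure mu) (hnu : complete_borel_measure nu).
Variables (E : set X) (r0 K delta : R).
Hypothesis geo : geometry mu nu E r0 K delta.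
Hypothesis tbE : totally_bounded E.
Variables (p q : R) (p_ge1 : (1 <= p)%R) (lt_pq : (p < q)%R).

Local Notation XS := (g_sigma_algebraType Smu).
Local Notation XN := (g_sigma_algebraType Snu).
Local Notation B x r := (ball x r : set XS).
Local Notation energy := (energy mu p).
Local Notation muB := (muB mu).
Local Notation nuB := (nuB nu).

Let p_gt0 : (0 < p)%R. Proof. exact: lt_le_trans p_ge1. Qed.
Let q_gt0 : (0 < q)%R. Proof. exact: lt_trans lt_pq. Qed.
Let r0_gt0 : (0 < r0)%R. Proof. exact: geo_r0 geo. Qed.
Let K_ge1 : (1 <= K)%R. Proof. exact: geo_K geo. Qed.
Let K_gt0 : (0 < K)%R. Proof. exact: lt_le_trans K_ge1. Qed.

Let le2r0 r : (r <= r0)%R -> (r <= 2 * r0)%R.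
Proof. by move=> rr0; have := r0_gt0; lra. Qed.

Lemma muB_gt0 x r : E x -> (0 < r)%R -> (r <= 2 * r0)%R -> (0 < muB x r)%R.
Proof. by move=> Ex rp rr; exact: pos_finite_fine (geo_mu geo Ex rp rr). Qed.

Lemma nuB_gt0 x r : E x -> (0 < r)%R -> (r <= 2 * r0)%R -> (0 < nuB x r)%R.
Proof. by move=> Ex rp rr; exact: pos_finite_fine (geo_nu geo Ex rp rr). Qed.

Lemma nuBE x r : E x -> (0 < r)%R -> (r <= 2 * r0)%R -> nu (ball x r) = (nuB x r)%:E.
Proof.
by move=> Ex rp rr; have [_ _ oo] := geo_nu geo Ex rp rr; rewrite fineK// ge0_fin_numE.
Qed.

Lemma muBE x r : E x -> (0 < r)%R -> (r <= 2 * r0)%R -> mu (ball x r) = (muB x r)%:E.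
Proof.
by move=> Ex rp rr; have [_ _ oo] := geo_mu geo Ex rp rr; rewrite fineK// ge0_fin_numE.
Qed.

Lemma ball_subset (x y : X) (r s : R) : (mdist x y + r <= s)%R -> ball x r `<=` ball y s.
Proof.
move=> rs z; rewrite !ballEmdist/= => xz; apply: lt_le_trans rs.
by apply: le_lt_trans (metric_triangle y x z) _; rewrite metric_sym ltrD2l.
Qed.

Lemma le_nuB x y r s : E x -> E y -> (0 < r)%R -> (r <= 2 * r0)%R -> (0 < s)%R ->
  (s <= 2 * r0)%R -> ball x r `<=` ball y s -> (nuB x r <= nuB y s)%R.
Proof.
move=> Ex Ey rp rr sp sr sub; rewrite -lee_fin -!nuBE//.
by apply: le_measure => //; rewrite inE; exact: (measurable_ballX hnu).
Qed.

Lemma le_muB x y r s : E x -> E y -> (0 < r)%R -> (r <= 2 * r0)%R -> (0 < s)%R ->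
  (s <= 2 * r0)%R -> ball x r `<=` ball y s -> (muB x r <= muB y s)%R.
Proof.
move=> Ex Ey rp rr sp sr sub; rewrite -lee_fin -!muBE//.
by apply: le_measure => //; rewrite inE; exact: (measurable_ballX hmu).
Qed.

Lemma le_energy G x y r s : borel_Lp mu p G -> ball x r `<=` ball y s ->
  (energy G x r <= energy G y s)%R.
Proof.
move=> GLp sub; rewrite -lee_fin -!(energyE hmu)//.
have [bG G0 _] := GLp.
apply: ge0_subset_integral => //.
- exact: (measurable_ballX hmu).
- exact: (measurable_ballX hmu).
- apply: measurable_funTS.
  by apply: (borel_fun_measurable hmu); exact: borel_poweR.
- by move=> z _; exact: poweR_ge0.
Qed.

Definition total_energy G : R := fine (\int[mu]_y (G y `^ p)).

Lemma total_energyE G : borel_Lp mu p G -> \int[mu]_y (G y `^ p) = (total_energy G)%:E.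
Proof.
move=> [bG G0 Goo]; rewrite fineK// ge0_fin_numE//.
by apply: integral_ge0 => y _; exact: poweR_ge0.
Qed.

Lemma total_energy_ge0 G : (0 <= total_energy G)%R.
Proof. by apply: fine_ge0; apply: integral_ge0 => y _; exact: poweR_ge0. Qed.

Lemma energy_le_total G x r : borel_Lp mu p G -> (energy G x r <= total_energy G)%R.
Proof.
move=> GLp; rewrite -lee_fin -(energyE hmu)// -total_energyE//.
have [bG G0 _] := GLp.
apply: ge0_subset_integral => //.
- exact: (measurable_ballX hmu).
- by apply: (borel_fun_measurable hmu); exact: borel_poweR.
- by move=> z _; exact: poweR_ge0.
Qed.

(* Bad balls of finitely many generations are thinned out to a disjoint family
   whose threefold enlargements still cover. *)
Lemma bad_balls_bound G (s : seq (X * R)) (tau : R) : borel_Lp mu p G -> (0 < tau)%R ->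
  (forall i, i \in s -> [/\ E i.1, (0 < i.2)%R, (2 * i.2 <= r0)%R &
     (tau * nuB i.1 i.2 < energy G i.1 i.2)%R]) ->
  nu (\bigcup_(i in [set` s]) ball i.1 i.2) <= (K ^+ 2 * total_energy G / tau)%:E.
Proof.
move=> GLp tau0 Hs; have [bG G0 _] := GLp.
have [D [uD Ds tD cD]] := vitali_finite (fun i is_ => let: And4 _ h _ _ := Hs i is_ in h).
have mB (i : X * R) : measurable (ball i.1 i.2 : set XS) by exact: (measurable_ballX hmu).
have mN (x : X) (r : R) : measurable (ball x r : set XN) by exact: (measurable_ballX hnu).
apply: (@le_trans _ _ (\sum_(i <- D) nu (ball i.1 (3 * i.2)))).
  apply: (@le_trans _ _ (nu (\big[setU/set0]_(i <- D) ball i.1 (3 * i.2)))).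
    apply: le_measure; rewrite ?inE.
    - apply: fin_bigcup_measurable; first exact: finite_seq.
      by move=> i _; exact: mN.
    - by apply: bigsetU_measurable => i _; exact: mN.
    move=> x [i /= is_ ix]; have [j jD ij] := cD i is_.
    by rewrite -bigcup_seq; exists j => //; exact: ij.
  elim: D {uD Ds tD cD} => [|a D IH]; first by rewrite !big_nil measure0.
  rewrite !big_cons; apply: le_trans (leeD2l _ IH).
  apply: measureU2; first exact: mN.
  by apply: bigsetU_measurable => i _; exact: mN.
apply: (@le_trans _ _ (\sum_(i <- D) (K ^+ 2 / tau * energy G i.1 i.2)%:E)).
  rewrite big_seq [leRHS]big_seq; apply: lee_sum => i /Ds/Hs[Ei i0 ir0 ibad].
  (* The threefold ball is enlarged to the fourfold one, which two doublings reach; this gives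
     K^2. *)
  apply: (@le_trans _ _ (nu (ball i.1 (4 * i.2)))).
    by apply: le_measure; rewrite ?inE//; apply: le_ball; lra.
  rewrite nuBE//; [|lra|lra].
  rewrite lee_fin (_ : 4 * i.2 = 2 * (2 * i.2))%R; last by ring.
  apply: (le_trans (geo_dbl_nu geo Ei _ _)); [lra|lra|].
  rewrite expr2 -!mulrA ler_pM2l//.
  apply: (le_trans (geo_dbl_nu geo Ei _ _)); [lra|lra|].
  by rewrite ler_pM2l// mulrC ler_pdivlMr// mulrC ltW.
rewrite sumEFin lee_fin -mulr_sumr.
rewrite [leRHS]mulrAC ler_wpM2l//.
  by rewrite divr_ge0 ?exprn_ge0 ?(ltW tau0) ?(ltW K_gt0).
rewrite -lee_fin -sumEFin.
under eq_bigr => i _ do rewrite -(energyE hmu) //.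
rewrite -ge0_integral_bigsetU//; first last.
- by move=> x _; exact: poweR_ge0.
- apply: measurable_funTS.
  by apply: (borel_fun_measurable hmu); exact: borel_poweR.
rewrite -total_energyE//; apply: ge0_subset_integral => //.
- by apply: bigsetU_measurable => i _; exact: mB.
- by apply: (borel_fun_measurable hmu); exact: borel_poweR.
- by move=> x _; exact: poweR_ge0.
Qed.

(** [V] collects bad balls centred at finite nets of every generation, so it is measurable and its
    measure is the limit of those of finite unions. A point x outside [V] is close to a net point z
    whose ball of twice the radius is not bad and contains the ball around x. *)
Lemma maximal_bound G (s tau : R) : borel_Lp mu p G -> (0 < s)%R -> (4 * s <= r0)%R ->
  (0 < tau)%R -> exists V : set X, [/\ measurable (V : set XN),
    nu V <= (K ^+ 4 * total_energy G / tau)%:E &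
    forall x, E x -> ~ V x -> forall j : nat,
      (energy G x (s / 2 ^+ j) <= tau * nuB x (s / 2 ^+ j))%R].
Proof.
move=> GLp s0 sr0 tau0.
have sj0 j : (0 < s / 2 ^+ j)%R by rewrite divr_gt0// exprn_gt0.
have sjs j : (s / 2 ^+ j <= s)%R.
  by rewrite ler_pdivrMr ?exprn_gt0// ler_peMr ?(ltW s0)// exprn_ege1// ler1n.
have /choice[F HF] j : exists F : seq X, (forall z, z \in F -> E z) /\
    (forall x, E x -> exists2 z, z \in F & ball z (s / 2 ^+ j) x).
  exact: totally_bounded_net.
(* Returning from z to x costs two doublings of nu; together with the covering this makes K^4. *)
pose tau' := (tau / K ^+ 2)%R.
have tau'0 : (0 < tau')%R by rewrite divr_gt0// exprn_gt0.
pose bad j z := (tau' * nuB z (2 * (s / 2 ^+ j)) < energy G z (2 * (s / 2 ^+ j)))%R.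
pose L j := [seq (z, 2 * (s / 2 ^+ j))%R | z <- F j & bad j z].
pose LL n := flatten [seq L j | j <- iota 0 n].
pose V n := \bigcup_(i in [set` LL n]) (ball i.1 i.2).
have mV n : measurable (V n : set XN).
  apply: fin_bigcup_measurable; first exact: finite_seq.
  by move=> i _; exact: (measurable_ballX hnu).
have memLL n i : i \in LL n -> exists j z, [/\ (j < n)%N, z \in F j, bad j z &
    i = (z, 2 * (s / 2 ^+ j))%R].
  move=> /flattenP[_ /mapP[j + ->]]; rewrite mem_iota add0n => /andP[_ jn].
  by move=> /mapP[z +] ->; rewrite mem_filter => /andP[bz zF]; exists j, z.
have Vbound n : nu (V n) <= (K ^+ 4 * total_energy G / tau)%:E.
  have -> : (K ^+ 4 * total_energy G / tau = K ^+ 2 * total_energy G / tau')%R.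
    rewrite /tau'; have h1 := lt0r_neq0 K_gt0; have h2 := lt0r_neq0 tau0.
    by field; rewrite h1 h2.
  apply: bad_balls_bound => // i /memLL[j [z [jn zF bz ->]]] /=.
  have := sjs j; have := sj0 j; split=> //; [exact: (HF j).1|lra|lra].
have ndV : {homo V : n m / (n <= m)%N >-> (n <= m)%O}.
  move=> n m nm; apply/subsetPset => x [i /= iL ix]; exists i => //=.
  have [j [z [jn zF bz ei]]] := memLL n i iL.
  apply/flattenP; exists (L j).
    by apply/mapP; exists j => //; rewrite mem_iota/= add0n (leq_trans jn).
  by apply/mapP; exists z => //; rewrite mem_filter bz.
have mVU : measurable (\bigcup_n V n : set XN) by exact: bigcupT_measurable.
exists (\bigcup_n V n); split => //.
  have := @nondecreasing_cvg_mu _ _ _ nu _ mV mVU ndV.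
  by apply: cvge_le; near=> n; exact: Vbound.
move=> x Ex nVx j.
have [z zF zx] := (HF j).2 x Ex.
have Ez := (HF j).1 z zF.
have nbad : ~~ bad j z.
  apply/negP => bz; apply: nVx; exists j.+1 => //; exists (z, 2 * (s / 2 ^+ j))%R => /=.
    apply/flattenP; exists (L j).
      by apply/mapP; exists j => //; rewrite mem_iota/= add0n.
    by apply/mapP; exists z => //; rewrite mem_filter bz.
  by apply: le_ball zx; have := sj0 j; lra.
have xz : (mdist x z < s / 2 ^+ j)%R by move: zx; rewrite ballEmdist/= metric_sym.
have h1 := sj0 j; have h2 := sjs j.
apply: (@le_trans _ _ (energy G z (2 * (s / 2 ^+ j)))).
  by apply: le_energy => //; apply: ball_subset; lra.
move: nbad; rewrite /bad -leNgt => /le_trans; apply.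
rewrite /tau' mulrAC ler_pdivrMr ?exprn_gt0// -mulrA ler_pM2l//.
apply: (le_trans (geo_dbl_nu geo Ez _ _)); [lra|lra|].
rewrite [leRHS]mulrC expr2 -mulrA ler_pM2l//.
apply: (@le_trans _ _ (nuB x (2 * (s / 2 ^+ j)))).
  by apply: le_nuB => //; [lra|lra|lra|apply: ball_subset; rewrite metric_sym; lra].
by apply: (geo_dbl_nu geo Ex _ _); lra.
Unshelve. all: by end_near. Qed.

End weak_type.

(** * Dyadic chains, Lebesgue points and the weak type estimate *)

Section lebesgue_points.
Context {R : realType} {X : pmetricType R} {Smu Snu : set (set X)}.
Variable mu : {measure set (g_sigma_algebraType Smu) -> \bar R}.
Variable nu : {measure set (g_sigma_algebraType Snu) -> \bar R}.
Hypotheses (hmu : complete_borel_measure mu) (hnu : complete_borel_measure nu).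
Variables (E : set X) (r0 K delta : R).
Hypothesis geo : geometry mu nu E r0 K delta.
Hypothesis tbE : totally_bounded E.
Variables (p q : R) (p_ge1 : (1 <= p)%R) (lt_pq : (p < q)%R).

Local Notation XS := (g_sigma_algebraType Smu).
Local Notation XN := (g_sigma_algebraType Snu).
Local Notation B x r := (ball x r : set XS).
Local Notation energy := (energy mu p).
Local Notation total_energy := (total_energy mu p).
Local Notation muB := (muB mu).
Local Notation nuB := (nuB nu).

Definition poincare_const (C lam : R) := [/\ (0 < C)%R, (1 <= lam)%R &
  forall loc f G x r, admissible mu p loc f G -> E x -> (0 < r)%R -> (lam * r <= r0)%R ->
  (osc mu (B x r) f <= C * r * (energy G x (lam * r) / muB x (lam * r)) `^ p^-1)%R].

(** Condition (1) without denominators, restricted to radii at most s, so that its constant can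
    depend on the scale. *)
Definition ratio_bound (A s : R) := forall x r, E x -> (0 < r)%R -> (r <= s)%R ->
  (r * nuB x r `^ q^-1 <= A * muB x r `^ p^-1)%R.

(** [R0] is the top radius of the dyadic chains; the factor 4 in [R0_le] leaves room for the
    enlarged balls of the covering argument. *)
Variables (C lam R0 A : R).
Hypothesis poin : poincare_const C lam.
Hypotheses (R0_gt0 : (0 < R0)%R) (R0_le : (4 * (lam * R0) <= r0)%R) (A_gt0 : (0 < A)%R).
Hypothesis ratio : ratio_bound A (lam * R0).

Let p_gt0 : (0 < p)%R. Proof. exact: lt_le_trans p_ge1. Qed.
Let q_gt0 : (0 < q)%R. Proof. exact: lt_trans lt_pq. Qed.
Let r0_gt0 : (0 < r0)%R. Proof. exact: geo_r0 geo. Qed.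
Let K_ge1 : (1 <= K)%R. Proof. exact: geo_K geo. Qed.
Let K_gt0 : (0 < K)%R. Proof. exact: lt_le_trans K_ge1. Qed.
Let lam_ge1 : (1 <= lam)%R. Proof. by case: poin. Qed.
Let lam_gt0 : (0 < lam)%R. Proof. exact: lt_le_trans lam_ge1. Qed.
Let C_gt0 : (0 < C)%R. Proof. by case: poin. Qed.
Let R0_le_lam : (R0 <= lam * R0)%R. Proof. by rewrite ler_peMl// ltW. Qed.
Let lamR0_gt0 : (0 < lam * R0)%R. Proof. by rewrite mulr_gt0. Qed.
Let iq0 : (0 < q^-1)%R. Proof. by rewrite invr_gt0. Qed.
Let iqip : (q^-1 < p^-1)%R. Proof. by rewrite ltf_pV2. Qed.
Let ip0 : (0 < p^-1)%R. Proof. by rewrite invr_gt0. Qed.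
Let al0 : (0 < p^-1 - q^-1)%R. Proof. by rewrite subr_gt0. Qed.

(** The factor by which nu decays, up to K, when a radius is halved. *)
Definition th : R := (2 `^ (- delta))%R.

Lemma th01 : (0 < th < 1)%R.
Proof.
rewrite /th powR_gt0//= powRN invf_lt1 ?powR_gt0//.
rewrite -[ltLHS](one_powR delta); apply: gt0_ltr_powR; rewrite ?nnegrE//; first exact: geo_delta geo.
by rewrite ltr1n.
Qed.

Let lamr_le r : (r <= R0)%R -> (lam * r <= lam * R0)%R.
Proof. by move=> rR; rewrite ler_pM2l. Qed.

Let dyad0 j : (0 < R0 / 2 ^+ j)%R. Proof. by rewrite divr_gt0// exprn_gt0. Qed.

Let dyad_le j : (R0 / 2 ^+ j <= R0)%R.
Proof. by rewrite ler_pdivrMr ?exprn_gt0// ler_peMr ?(ltW R0_gt0)// exprn_ege1// ler1n. Qed.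

Let pos_ball x r : E x -> (0 < r)%R -> (r <= R0)%R -> pos_finite mu (B x r).
Proof.
by move=> Ex rp rr; apply: (geo_mu geo) => //; have := R0_le_lam; have := R0_le; have := r0_gt0; lra.
Qed.

Let nu_pos x r : E x -> (0 < r)%R -> (r <= R0)%R -> (0 < nuB x (lam * r))%R.
Proof.
move=> Ex rp rr; apply: (nuB_gt0 geo) => //; first by rewrite mulr_gt0.
by have := lamr_le rr; have := R0_le; have := r0_gt0; have := lamR0_gt0; lra.
Qed.

Lemma osc_le_energy loc f G x r : admissible mu p loc f G -> E x -> (0 < r)%R -> (r <= R0)%R ->
  (osc mu (B x r) f <= C * A * (nuB x (lam * r) `^ (- q^-1) * energy G x (lam * r) `^ p^-1))%R.
Proof.
move=> af Ex rp rr.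
have lr := lamr_le rr; have lrp : (0 < lam * r)%R by rewrite mulr_gt0.
have lr0 : (lam * r <= r0)%R by have := R0_le; have := lamR0_gt0; lra.
have [_ _ H] := poin; apply: (le_trans (H _ _ _ _ _ af Ex rp lr0)).
have m0 : (0 < muB x (lam * r))%R by apply: (muB_gt0 geo) => //; have := r0_gt0; lra.
have n0 := nu_pos Ex rp rr.
have Ge0 := energy_ge0 mu p G x (lam * r).
rewrite powRM ?invr_ge0 ?(ltW m0)//.
have := ratio Ex lrp lr.
set N := (nuB x (lam * r) `^ q^-1)%R; set M := (muB x (lam * r) `^ p^-1)%R.
have N0 : (0 < N)%R by rewrite powR_gt0.
have M0 : (0 < M)%R by rewrite powR_gt0.
have -> : ((muB x (lam * r))^-1 `^ p^-1 = M^-1)%R.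
  by rewrite -(powR_inv1 (ltW m0)) powRAC powR_inv1// powR_ge0.
rewrite powRN -/N => rat.
have rN : (r * N <= A * M)%R.
  by apply: le_trans rat; rewrite ler_wpM2r ?(ltW N0)// ler_peMl// ltW.
have rM : (r / M <= A / N)%R by rewrite ler_pdivrMr// mulrAC ler_pdivlMr.
have -> : (C * r * (energy G x (lam * r) `^ p^-1 / M) = C * energy G x (lam * r) `^ p^-1 * (r / M))%R by ring.
have -> : (C * A * (N^-1 * energy G x (lam * r) `^ p^-1) = C * energy G x (lam * r) `^ p^-1 * (A / N))%R by ring.
by rewrite ler_wpM2l// mulr_ge0 ?powR_ge0// ltW.
Qed.

Lemma nu_decay x i j : E x -> (i <= j)%N ->
  (nuB x (lam * (R0 / 2 ^+ j)) <= K * th ^+ (j - i) * nuB x (lam * (R0 / 2 ^+ i)))%R.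
Proof.
move=> Ex ij.
have le_ij : (lam * (R0 / 2 ^+ j) <= lam * (R0 / 2 ^+ i))%R.
  rewrite !ler_pM2l// lef_pV2 ?posrE ?exprn_gt0//.
  by rewrite ler_eXn2l// ltr1n.
have := geo_dec geo Ex (mulr_gt0 lam_gt0 (dyad0 j)) le_ij.
have -> : (lam * (R0 / 2 ^+ j) / (lam * (R0 / 2 ^+ i)) = (2 ^+ (j - i))^-1)%R.
  have h1 := lt0r_neq0 lam_gt0; have h2 := lt0r_neq0 R0_gt0.
  have h3 : (2 ^+ i != 0 :> R)%R by rewrite expf_neq0// pnatr_eq0.
  have h4 : (2 ^+ (j - i) != 0 :> R)%R by rewrite expf_neq0// pnatr_eq0.
  rewrite -(subnK ij) exprD addnK; field.
  by rewrite h1 h2 h3 h4.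
have -> : ((2 ^+ (j - i))^-1 `^ delta = th ^+ (j - i) :> R)%R.
  rewrite -powR_inv1 ?exprn_ge0// -powRrM mulN1r exprn_powR//.
apply; have := lamr_le (dyad_le i); have := R0_le; have := lamR0_gt0; lra.
Qed.

Let admI loc f G x r : admissible mu p loc f G -> E x -> (0 < r)%R -> (r <= R0)%R ->
  integrable_on mu (B x r) f.
Proof. by move=> af Ex rp rr; exact: (admissible_integrable hmu p_ge1 af rp (pos_ball Ex rp rr)). Qed.

Lemma good_point_admissible loc f G x : admissible mu p loc f G -> E x -> good_point mu f x.
Proof.
move=> af Ex; exists R0 => // r /andP[rp /ltW rR].
by split; [exact: pos_ball|exact: admI af Ex rp rR].
Qed.

Let half_ball x s r : E x -> (0 < r)%R -> (r <= s)%R -> (s <= R0)%R -> (s / 2 <= r)%R ->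
  (muB x s / muB x r <= K)%R.
Proof.
move=> Ex rp rs sR s2r; have s0 : (0 < s)%R by exact: lt_le_trans rs.
have rR := le_trans rs sR.
have m0 : (0 < muB x r)%R := pos_finite_fine (pos_ball Ex rp rR).
rewrite ler_pdivrMr//.
have -> : (s = 2 * (s / 2))%R by rewrite mulrCA mulfV// mulr1.
have sr0 : (s <= r0)%R by have := R0_le_lam; have := R0_le; have := r0_gt0; have := lamR0_gt0; lra.
apply: (le_trans (geo_dbl_mu geo Ex _ _)); [by rewrite divr_gt0|by lra|].
rewrite ler_pM2l//; apply: (le_muB hmu geo) => //; [by rewrite divr_gt0|lra|lra|].
exact: le_ball.
Qed.

(** Telescoping down to a radius r that need not be dyadic; each comparison involves radii within a
    factor 2 and costs K by doubling of mu. *)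
Lemma chain loc f G x s J r : admissible mu p loc f G -> E x ->
  (0 < s)%R -> (s <= R0)%R -> (s / 2 ^+ J <= r)%R -> (r <= s)%R ->
  (`|avg mu (B x r) f - avg mu (B x s) f| <=
    K * \sum_(j < J) osc mu (B x (s / 2 ^+ j)) f)%R.
Proof.
move=> af Ex s0 sR; elim: J r => [|J IH] r.
  rewrite expr0 divr1 big_ord0 mulr0 => sr rs.
  by have -> : r = s by [apply/eqP; rewrite eq_le rs]; rewrite subrr normr0.
move=> sr rs; have sJ0 : (0 < s / 2 ^+ J)%R by rewrite divr_gt0// exprn_gt0.
have sJs : (s / 2 ^+ J <= s)%R.
  by rewrite ler_pdivrMr ?exprn_gt0// ler_peMr ?(ltW s0)// exprn_ege1// ler1n.
rewrite big_ord_recr /= mulrDr.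
have [sJr|rsJ] := leP (s / 2 ^+ J)%R r.
  by apply: (le_trans (IH r sJr rs)); rewrite lerDl mulr_ge0 ?osc_ge0// ltW.
rewrite -(subrKA (avg mu (B x (s / 2 ^+ J)) f)) addrC.
apply: (le_trans (ler_normD _ _)); apply: lerD; first by apply: IH.
have sr' : (s / 2 ^+ J / 2 <= r)%R.
  by rewrite -mulrA -invfM -exprSr.
have rp : (0 < r)%R by apply: lt_le_trans sr'; rewrite divr_gt0.
have sJR := le_trans sJs sR.
apply: (le_trans (avg_sub_osc (pos_ball Ex sJ0 sJR) (pos_ball Ex rp (le_trans rs sR)) _ (admI af Ex sJ0 sJR))).
  by apply: le_ball; exact: ltW.
by rewrite ler_wpM2r ?osc_ge0//; apply: half_ball => //; exact: ltW.
Qed.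

Lemma dyadic_below (s r : R) : (0 < s)%R -> (0 < r)%R -> exists J : nat, (s / 2 ^+ J <= r)%R.
Proof.
move=> s0 rp; exists (Num.truncn (s / r)).+1.
rewrite ler_pdivrMr ?exprn_gt0// mulrC -ler_pdivrMr//.
apply: ltW; apply: (lt_le_trans (truncnS_gt _)).
by rewrite -natrX ler_nat ltnW// ltn_expl.
Qed.

Definition potential_const : R := (C * hedberg_const K th p^-1 q^-1)%R.

Lemma potential_bound loc f G x tau J : admissible mu p loc f G -> E x -> (0 <= tau)%R ->
  (forall j, energy G x (lam * R0 / 2 ^+ j) <= tau * nuB x (lam * R0 / 2 ^+ j))%R ->
  (\sum_(j < J) osc mu (B x (R0 / 2 ^+ j)) f <=
    potential_const * A * (total_energy G `^ (p^-1 - q^-1) * tau `^ q^-1))%R.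
Proof.
move=> af Ex tau0 Htau; have GLp := adm_Lp af.
apply: (@le_trans _ _ (\sum_(j < J) (C * A * (nuB x (lam * (R0 / 2 ^+ j)) `^ (- q^-1) *
    energy G x (lam * (R0 / 2 ^+ j)) `^ p^-1)))%R).
  by apply: ler_sum => j _; exact: (osc_le_energy af Ex (dyad0 j) (dyad_le j)).
rewrite -mulr_sumr /potential_const (mulrAC C _ A) -[leRHS]mulrA ler_wpM2l//.
  by rewrite mulr_ge0 ?ltW.
apply: (hedberg (N := fun j => nuB x (lam * (R0 / 2 ^+ j)))
    (Gam := fun j => energy G x (lam * (R0 / 2 ^+ j)))) => //.
- exact: th01.
- exact: total_energy_ge0.
- by move=> j; apply: nu_pos.
- by move=> i j ij; exact: nu_decay.
- by move=> j; rewrite energy_ge0 energy_le_total.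
- by move=> j; have := Htau j; rewrite !mulrA.
Qed.

Lemma potential_const_ge0 : (0 <= potential_const)%R.
Proof. by rewrite mulr_ge0 ?(ltW C_gt0)// hedberg_const_ge0//; exact: th01. Qed.

(** Where the maximal function is bounded, the oscillation over the j-th ball is at most a multiple
    of nu(lam B_j)^(1/p - 1/q). The exponent is positive, so the oscillations decay geometrically
    and the averages form a Cauchy sequence. *)
Lemma exists_lebesgue_value loc f G x tau : admissible mu p loc f G -> E x -> (0 <= tau)%R ->
  (forall j, energy G x (lam * R0 / 2 ^+ j) <= tau * nuB x (lam * R0 / 2 ^+ j))%R ->
  exists b, lebesgue_value mu f x b.
Proof.
move=> af Ex tau0 Htau.
pose al := (p^-1 - q^-1)%R; pose eta := (th `^ al)%R.
have [t0 t1] := andP th01.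
have eta0 : (0 < eta)%R by rewrite powR_gt0.
have eta1 : (eta < 1)%R.
  rewrite -[ltRHS](one_powR al); apply: gt0_ltr_powR; rewrite ?nnegrE ?ler01//.
  exact: ltW.
pose N0 := nuB x (lam * R0).
have N00 : (0 < N0)%R by apply: nu_pos.
pose L := (C * A * tau `^ p^-1 * (K * N0) `^ al)%R.
have L0 : (0 <= L)%R by rewrite !mulr_ge0 ?powR_ge0// ltW.
have oscj j : (osc mu (B x (R0 / 2 ^+ j)) f <= L * eta ^+ j)%R.
  apply: (le_trans (osc_le_energy af Ex (dyad0 j) (dyad_le j))).
  rewrite /L -!mulrA !ler_pM2l//.
  have n0 : (0 < nuB x (lam * (R0 / 2 ^+ j)))%R by exact: nu_pos.
  apply: (@le_trans _ _ (nuB x (lam * (R0 / 2 ^+ j)) `^ (- q^-1) *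
      (tau * nuB x (lam * (R0 / 2 ^+ j))) `^ p^-1)%R).
    rewrite ler_wpM2l ?powR_ge0// ler_powR2 ?(ltW ip0)// ?energy_ge0//.
    by have := Htau j; rewrite !mulrA.
  rewrite (powRM p^-1%R tau0 (ltW n0)) mulrCA ler_wpM2l ?powR_ge0//.
  rewrite -powRD; last by rewrite (gt_eqF n0) implybT.
  rewrite addrC -exprn_powR ?(ltW t0)// -powRM ?mulr_ge0 ?exprn_ge0 ?(ltW t0) ?(ltW K_gt0) ?(ltW N00)//.
  apply: ler_powR2; [exact: ltW|exact: ltW|].
  have := nu_decay Ex (leq0n j); rewrite subn0 expr0 divr1 /N0 => /le_trans; apply.
  by rewrite mulrAC.
(* K times the tail of the geometric series from i on: the distance that the averages can still
   travel. *)
pose ep i := (K * (L * eta ^+ i / (1 - eta)))%R.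
have e1 : (0 < 1 - eta)%R by rewrite subr_gt0.
have ep0 i : (0 <= ep i)%R.
  by rewrite mulr_ge0 ?(ltW K_gt0)// mulr_ge0 ?invr_ge0 ?(ltW e1)// mulr_ge0// exprn_ge0// ltW.
have close i r : (0 < r)%R -> (r <= R0 / 2 ^+ i)%R ->
    (`|avg mu (B x r) f - avg mu (B x (R0 / 2 ^+ i)) f| <= ep i)%R.
  move=> rp rR; have [J sJ] := dyadic_below (dyad0 i) rp.
  apply: (le_trans (chain af Ex (dyad0 i) (dyad_le i) sJ rR)).
  rewrite ler_pM2l//.
  apply: (@le_trans _ _ (\sum_(j < J) L * eta ^+ i * eta ^+ j)%R).
    apply: ler_sum => j _; rewrite -mulrA -exprD -mulrA -invfM -exprD.
    exact: oscj.
  rewrite -mulr_sumr; apply: ler_wpM2l; first by rewrite (mulr_ge0 L0)// exprn_ge0// ltW.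
  by apply: sum_geometric_le; rewrite (ltW eta0).
pose a i := avg mu (B x (R0 / 2 ^+ i)) f.
have le_dyad i k : (i <= k)%N -> (R0 / 2 ^+ k <= R0 / 2 ^+ i)%R.
  by move=> ik; rewrite ler_pM2l// lef_pV2 ?posrE ?exprn_gt0// ler_eXn2l// ltr1n.
have nested i k : (a i - ep i <= a k + ep k)%R.
  have [ik|/ltnW ki] := leqP i k.
    have := close i _ (dyad0 k) (le_dyad _ _ ik); rewrite -/(a i) -/(a k) ler_norml => /andP[h _].
    by have := ep0 k; lra.
  have := close k _ (dyad0 i) (le_dyad _ _ ki); rewrite -/(a i) -/(a k) ler_norml => /andP[_ h].
  by have := ep0 i; lra.
(* The limit is the common point of the nested intervals [a_i - ep_i, a_i + ep_i], taken as the
   supremum of their left ends. *)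
pose S := [set (a i - ep i)%R | i in [set: nat]].
have hS : has_sup S.
  split; first by exists (a 0%N - ep 0%N)%R; exists 0%N.
  by exists (a 0%N + ep 0%N)%R => _ [i _ <-]; exact: nested.
pose b := sup S.
have bi i : (`|b - a i| <= ep i)%R.
  rewrite ler_norml; apply/andP; split.
    have : (a i - ep i <= b)%R by apply: ub_le_sup; [exact: hS.2|exists i].
    by lra.
  have : (b <= a i + ep i)%R by apply: ge_sup; [exact: hS.1|move=> _ [k _ <-]; exact: nested].
  by lra.
exists b => e e0.
have [i ei] : exists i, (K * (L * eta ^+ i + ep i) <= e)%R.
  pose M := (K * L * (1 + K / (1 - eta)))%R.
  have M0 : (0 <= M)%R.
    apply: mulr_ge0; first by rewrite mulr_ge0// ltW.
    by rewrite addr_ge0// divr_ge0// ltW.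
  have eM : (0 < e / (M + 1))%R by rewrite divr_gt0// ltr_wpDl.
  have : (fun n => eta ^+ n)%R @ \oo --> (0 : R)%R.
    by apply: cvg_expr; rewrite ger0_norm ?(ltW eta0).
  move=> /cvgrPdist_le /(_ _ eM) [i _ /(_ i (leqnn i))].
  rewrite sub0r normrN ger0_norm ?exprn_ge0 ?(ltW eta0)// => hi.
  exists i.
  have -> : (K * (L * eta ^+ i + ep i) = M * eta ^+ i)%R.
    by rewrite /ep /M; field; rewrite gt_eqF.
  apply: (@le_trans _ _ (M * (e / (M + 1)))%R); first by rewrite ler_wpM2l.
  rewrite mulrCA ler_piMr ?(ltW e0)// ler_pdivrMr ?ltr_wpDl//.
  by rewrite mul1r lerDl.
exists (R0 / 2 ^+ i)%R => // r /andP[rp rRi].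
(* The last dyadic radius that is at least r; doubling compares the two balls. *)
have [j [ij rj rj2]] : exists j, [/\ (i <= j)%N, (r <= R0 / 2 ^+ j)%R & (R0 / 2 ^+ j / 2 <= r)%R].
  have exJ : exists J, (R0 / 2 ^+ J < r)%R.
    have r20 : (0 < r / 2)%R by rewrite divr_gt0.
    have [J hJ] := dyadic_below R0_gt0 r20; exists J.
    by apply: (le_lt_trans hJ); rewrite ltr_pdivrMr// ltr_pMr// ltr1n.
  case: (ex_minnP exJ) => -[|j] hj minj.
    by move: hj; rewrite expr0 divr1 ltNge (le_trans (ltW rRi))// dyad_le.
  have rj : (r <= R0 / 2 ^+ j)%R.
    by rewrite leNgt; apply/negP => /minj; rewrite ltnn.
  exists j; split => //.
    rewrite leqNgt; apply/negP => ji.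
    have := le_dyad _ _ ji; have := lt_trans hj rRi.
    by rewrite ltNge => /negP.
  by apply: ltW; rewrite -mulrA -invfM -exprSr.
have pj := pos_ball Ex (dyad0 j) (dyad_le j).
have Ij := admI af Ex (dyad0 j) (dyad_le j).
have rR := le_trans rj (dyad_le j).
apply: le_trans ei.
apply: (le_trans (avg_subset pj (pos_ball Ex rp rR) (le_ball rj) (integrable_osc b pj Ij) _)) => //.
have avgj : (avg mu (B x (R0 / 2 ^+ j)) (fun y => `|f y - b|) <= L * eta ^+ i + ep i)%R.
  have etaij : (eta ^+ j <= eta ^+ i)%R by rewrite ler_wiXn2l ?(ltW eta0) ?(ltW eta1).
  have epij : (ep j <= ep i)%R.
    by rewrite ler_pM2l// ler_pM2r ?invr_gt0// ler_wpM2l.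
  apply: (@le_trans _ _ (osc mu (B x (R0 / 2 ^+ j)) f + ep j)%R).
    rewrite /osc -(avg_cst (ep j) pj) -avgD//; first last.
    - exact: integrable_on_cst.
    - exact: integrable_osc.
    apply: le_avg => //.
    - exact: integrable_osc.
    - by apply: integrable_onD => //; [exact: integrable_osc|exact: integrable_on_cst].
    move=> y _; rewrite -(subrKA (a j)); apply: (le_trans (ler_normD _ _)).
    by rewrite lerD2l distrC.
  apply: lerD => //; apply: (le_trans (oscj j)).
  by rewrite ler_wpM2l.
apply: ler_pM; [by rewrite divr_ge0// fine_ge0|by apply: avg_ge0| |exact: avgj].
exact: half_ball.
Qed.

Lemma lebesgue_value_close loc f G x b c D : admissible mu p loc f G -> E x ->
  lebesgue_value mu f x b ->
  (forall r, (0 < r)%R -> (r <= R0)%R -> `|avg mu (B x r) f - c| <= D)%R ->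
  (`|b - c| <= D)%R.
Proof.
move=> af Ex Lb H; apply/ler_addgt0Pr => e e0; have [d d0 Hd] := Lb e e0.
pose r := Num.min (d / 2)%R R0.
have rp : (0 < r)%R by rewrite lt_min R0_gt0 divr_gt0.
have rR : (r <= R0)%R by rewrite ge_min lexx orbT.
have rd : (r < d)%R.
  by rewrite gt_min; apply/orP; left; rewrite ltr_pdivrMr// ltr_pMr// ltr1n.
rewrite -(subrKA (avg mu (B x r) f)) addrC; apply: (le_trans (ler_normD _ _)).
apply: lerD; first exact: H.
rewrite distrC; apply: le_trans (Hd r _); last by rewrite rp.
apply: avg_sub_cst; first exact: pos_ball.
exact: admI af Ex rp rR.
Qed.

(** The exceptional set lies where the maximal function exceeds every n + 1, and the measures of
    these sets are O(1/n). Thus the averages with respect to mu converge off a nu-null set without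
    any relation between the null sets of mu and nu. *)
Lemma lebesgue_points loc f G : admissible mu p loc f G ->
  exists Z : set X, [/\ measurable (Z : set XN), nu Z = 0 &
    forall x, E x -> ~ Z x -> exists b, lebesgue_value mu f x b].
Proof.
move=> af; have GLp := adm_Lp af.
have /choice[V HV] (n : nat) := maximal_bound hmu hnu geo tbE GLp lamR0_gt0 R0_le (ltr0Sn R n).
have mV n : measurable (V n : set XN) by have [] := HV n.
exists (\bigcap_n V n); split.
- exact: bigcapT_measurable.
- apply/eqP; rewrite eq_le measure_ge0 andbT; apply/lee_addgt0Pr => e e0.
  rewrite add0e.
  pose M := (K ^+ 4 * total_energy G)%R.
  have M0 : (0 <= M)%R by rewrite mulr_ge0 ?total_energy_ge0// exprn_ge0// ltW.
  have [_ h _] := HV (Num.truncn (M / e)).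
  apply: (@le_trans _ _ (nu (V (Num.truncn (M / e))))).
    apply: le_measure; rewrite ?inE//; first exact: bigcapT_measurable.
    by move=> x; apply.
  apply: (le_trans h); rewrite lee_fin ler_pdivrMr// [leRHS]mulrC -ler_pdivrMr//.
  exact/ltW/truncnS_gt.
move=> x Ex nZ; have [n nV] : exists n, ~ V n x.
  by apply: contrapT => no; apply: nZ => n _; apply: contrapT => nV; apply: no; exists n.
have [_ _ H] := HV n.
exact: (exists_lebesgue_value af Ex (ler0n _ _) (H x Ex nV)).
Qed.

(** Four times the ball around z contains the ball around x, so two doublings give K^2. This lets
    averages at a point of E be replaced by averages at a net point. *)
Lemma near_ratio x z : E x -> E z -> (mdist x z < R0 / 4)%R ->
  [/\ pos_finite mu (B x R0), pos_finite mu (B z (R0 / 2)), B z (R0 / 2) `<=` B x R0 &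
    (muB x R0 / muB z (R0 / 2) <= K ^+ 2)%R].
Proof.
move=> Ex Ez xz; have R20 : (0 < R0 / 2)%R by rewrite divr_gt0.
have R2R : (R0 / 2 <= R0)%R by have := R0_gt0; lra.
split; [exact: pos_ball|exact: pos_ball| |].
  by apply: ball_subset; rewrite metric_sym; have := R0_gt0; lra.
have m0 : (0 < muB z (R0 / 2))%R := pos_finite_fine (pos_ball Ez R20 R2R).
rewrite ler_pdivrMr//.
have R0r0 : (4 * R0 <= r0)%R by have := R0_le; have := R0_le_lam; lra.
apply: (@le_trans _ _ (muB z (2 * (2 * (R0 / 2))))).
  by apply: (le_muB hmu geo) => //; [have := R0_gt0; lra|have := R0_gt0; lra|have := R0_gt0; lra|
     apply: ball_subset; have := R0_gt0; lra].
apply: (le_trans (geo_dbl_mu geo Ez _ _)); [have := R0_gt0; lra|have := R0_gt0; lra|].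
rewrite expr2 -mulrA ler_pM2l//.
by apply: (geo_dbl_mu geo Ez _ _) => //; have := R0_gt0; lra.
Qed.

Lemma avg_near loc f G x z : admissible mu p loc f G -> E x -> E z ->
  (mdist x z < R0 / 4)%R ->
  (`|avg mu (B x R0) f - avg mu (B z (R0 / 2)) f| <= K ^+ 2 * osc mu (B x R0) f)%R.
Proof.
move=> af Ex Ez xz; have [pB pBz sub rK] := near_ratio Ex Ez xz.
rewrite distrC; apply: (le_trans (avg_sub_osc pB pBz sub (admI af Ex R0_gt0 (lexx _)))).
by apply: ler_wpM2r; first exact: osc_ge0.
Qed.

(** K^4 comes from the maximal estimate, K from the chain at x, and K^2 from the passage to a nearby
    centre z; adding 1 makes the base positive. *)
Definition weak_const : R := (K ^+ 4 * ((K + K ^+ 2) * potential_const + 1) `^ q)%R.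

(** The potential bound is at most t outside [V] once tau is chosen with kap A T^(1/p - 1/q)
    tau^(1/q) = t. The statement for nearby centres z reduces the averages at scale R0 to finitely
    many numbers. *)
Lemma weak_type loc f G t : admissible mu p loc f G -> (0 < t)%R ->
  exists V : set X, [/\ measurable (V : set XN),
    nu V <= (weak_const * A `^ q * total_energy G `^ (q / p) * t `^ (- q))%:E &
    forall x b, E x -> ~ V x -> lebesgue_value mu f x b ->
      (`|b - avg mu (B x R0) f| <= t)%R /\
      (forall z, E z -> (mdist x z < R0 / 4)%R -> `|b - avg mu (B z (R0 / 2)) f| <= t)%R].
Proof.
move=> af tp; have GLp := adm_Lp af.
set T := total_energy G.
have T0 : (0 <= T)%R by exact: total_energy_ge0.
pose kap := ((K + K ^+ 2) * potential_const + 1)%R.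
have KK0 : (0 <= K + K ^+ 2)%R by rewrite addr_ge0 ?exprn_ge0 ?(ltW K_gt0).
have kap0 : (0 < kap)%R by rewrite ltr_wpDl// mulr_ge0// potential_const_ge0.
have [tau [tau0 tauV tauW]] : exists tau, [/\ (0 < tau)%R,
    (K ^+ 4 * T / tau <= weak_const * A `^ q * T `^ (q / p) * t `^ (- q))%R &
    (kap * A * (T `^ (p^-1 - q^-1) * tau `^ q^-1) <= t)%R].
  (* Without energy the potential vanishes and any positive tau will do. *)
  have [T00|Tn0] := eqVneq T 0%R.
    exists 1%R; split => //; rewrite T00.
      by rewrite powR0 ?mulr0 ?mul0r// mulf_neq0 ?invr_neq0 ?gt_eqF.
    by rewrite powR0 ?gt_eqF// mul0r mulr0 ltW.
  have Tp : (0 < T)%R by rewrite lt_neqAle eq_sym Tn0.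
  have al : (0 < T `^ (p^-1 - q^-1))%R by rewrite powR_gt0.
  pose W := (kap * A * T `^ (p^-1 - q^-1))%R.
  have W0 : (0 < W)%R by rewrite !mulr_gt0.
  exists ((t / W) `^ q)%R; split.
  - by rewrite powR_gt0// divr_gt0.
  - rewrite /weak_const -/kap.
    have -> : ((t / W) `^ q = t `^ q * (W `^ q)^-1)%R.
      rewrite powRM ?invr_ge0 ?(ltW W0) ?(ltW tp)//.
      by rewrite -(powR_inv1 (ltW W0)) powRAC powR_inv1 ?powR_ge0.
    have -> : (W `^ q = kap `^ q * A `^ q * T `^ (q / p - 1))%R.
      rewrite /W powRM ?mulr_ge0 ?powR_ge0 ?(ltW kap0) ?(ltW A_gt0)//.
      rewrite powRM ?(ltW kap0) ?(ltW A_gt0)// -powRrM mulrBl mulVf ?gt_eqF//.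
      by rewrite (mulrC p^-1%R).
    rewrite powRN (_ : T `^ (q / p) = T * T `^ (q / p - 1))%R; last first.
      transitivity (T `^ 1 * T `^ (q / p - 1))%R; last by rewrite powRr1.
      by rewrite -powRD ?subrKC// Tn0 implybT.
    have h1 : (t `^ q != 0)%R by rewrite gt_eqF// powR_gt0.
    have h2 : (kap `^ q != 0)%R by rewrite gt_eqF// powR_gt0.
    have h3 : (A `^ q != 0)%R by rewrite gt_eqF// powR_gt0.
    have h4 : (T `^ (q / p - 1) != 0)%R by rewrite gt_eqF// powR_gt0.
    by apply: eq_ler; field; rewrite h1 h2 h3 h4.
  - rewrite -powRrM mulfV ?gt_eqF// powRr1 ?divr_ge0 ?(ltW tp) ?(ltW W0)//.
    by rewrite mulrA -/W mulrCA mulfV ?gt_eqF// mulr1.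
have [V [mV nuV HV]] := maximal_bound hmu hnu geo tbE GLp lamR0_gt0 R0_le tau0.
exists V; split => //; first by apply: (le_trans nuV); rewrite lee_fin.
move=> x b Ex nV Lb.
pose P := (potential_const * A * (T `^ (p^-1 - q^-1) * tau `^ q^-1))%R.
have sumP J : (\sum_(j < J) osc mu (B x (R0 / 2 ^+ j)) f <= P)%R.
  exact: (potential_bound J af Ex (ltW tau0) (HV x Ex nV)).
have P0 : (0 <= P)%R by apply: le_trans (sumP 0%N); rewrite big_ord0.
have KP : ((K + K ^+ 2) * P <= t)%R.
  apply: le_trans tauW; rewrite /P /kap.
  have h : (0 <= A * (T `^ (p^-1 - q^-1) * tau `^ q^-1))%R.
    by rewrite !mulr_ge0 ?powR_ge0// ltW.
  rewrite -!(mulrA _ A) [leLHS]mulrA ler_wpM2r//.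
  by rewrite lerDl.
have oscP : (osc mu (B x R0) f <= P)%R.
  by have := sumP 1%N; rewrite big_ord_recl big_ord0 addr0 expr0 divr1.
have bR : (`|b - avg mu (B x R0) f| <= K * P)%R.
  apply: (lebesgue_value_close af Ex Lb) => r rp rR.
  have [J sJ] := dyadic_below R0_gt0 rp.
  apply: (le_trans (chain af Ex R0_gt0 (lexx _) sJ rR)).
  by rewrite ler_wpM2l// ltW.
have K2P : (0 <= K ^+ 2 * P)%R by rewrite mulr_ge0 ?exprn_ge0 ?(ltW K_gt0).
split; first by apply: (le_trans bR); apply: le_trans KP; rewrite mulrDl lerDl.
move=> z Ez xz.
rewrite -(subrKA (avg mu (B x R0) f)); apply: (le_trans (ler_normD _ _)).
apply: le_trans KP; rewrite mulrDl lerD//.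
apply: (le_trans (avg_near af Ex Ez xz)).
by rewrite ler_wpM2l// exprn_ge0// ltW.
Qed.

End lebesgue_points.

Lemma nneseries_le_fin {R : realType} (a : nat -> \bar R) (M : \bar R) : (forall n, 0 <= a n) ->
  (forall n, \sum_(0 <= i < n) a i <= M) -> \sum_(0 <= i <oo) a i <= M.
Proof.
move=> a0 aM; apply: lime_le; first exact: is_cvg_nneseries.
by near=> n; exact: aM.
Unshelve. all: by end_near. Qed.

(** * The strong type estimate *)

Section strong_type.
Context {R : realType} {X : pmetricType R} {Smu Snu : set (set X)}.
Variable mu : {measure set (g_sigma_algebraType Smu) -> \bar R}.
Variable nu : {measure set (g_sigma_algebraType Snu) -> \bar R}.
Hypotheses (hmu : complete_borel_measure mu) (hnu : complete_borel_measure nu).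
Variables (E : set X) (r0 K delta : R).
Hypothesis geo : geometry mu nu E r0 K delta.
Hypothesis tbE : totally_bounded E.
Variables (p q : R) (p_ge1 : (1 <= p)%R) (lt_pq : (p < q)%R).

Local Notation XS := (g_sigma_algebraType Smu).
Local Notation XN := (g_sigma_algebraType Snu).
Local Notation B x r := (ball x r : set XS).
Local Notation total_energy := (total_energy mu p).

Let p_gt0 : (0 < p)%R. Proof. exact: lt_le_trans p_ge1. Qed.
Let q_gt0 : (0 < q)%R. Proof. exact: lt_trans lt_pq. Qed.

Lemma total_energy_restr G D : borel_Lp mu p G -> borel_set D ->
  borel_Lp mu p (G \_ D) /\
  (total_energy (G \_ D))%:E = \int[mu]_(x in D) (G x `^ p).
Proof.
move=> GLp bD; have [bG G0 _] := GLp.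
have GD : borel_Lp mu p (G \_ D).
  apply: (borel_Lp_le hmu p_gt0 _ _ _ GLp).
  - apply/(measurable_restrictT _ _).1 => //; exact: measurable_funTS.
  - by move=> x; rewrite patchE; case: ifP.
  - by move=> x; rewrite patchE; case: ifP.
split => //; rewrite -total_energyE// [RHS]integral_mkcond.
apply: eq_integral => x _; rewrite !patchE; case: ifP => // _.
by change (0%:E `^ p = 0%:E :> \bar R); rewrite poweR_EFin powR0// gt_eqF.
Qed.

(** The Borel supersets need not be disjoint, but they exceed the disjoint sets only by null sets,
    so the energies still add up. *)
Lemma disjoint_energies G (D : nat -> set X) : borel_Lp mu p G ->
  (forall j, measurable (D j : set XS)) -> trivIset setT D ->
  exists B : nat -> set X, (forall j, borel_set (B j) /\ D j `<=` B j) /\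
    forall n, (\sum_(j < n) total_energy (G \_ (B j)) <= total_energy G)%R.
Proof.
move=> GLp mD tD; have [bG G0 _] := GLp.
have /choice[B HB] := fun j => borel_superset hmu (mD j).
exists B; split=> [j|n]; first by have [] := HB j.
have mGp : measurable_fun setT (fun x : XS => G x `^ p).
  by apply: (borel_fun_measurable hmu); exact: borel_poweR.
have eE j : (total_energy (G \_ (B j)))%:E = \int[mu]_(x in (D j : set XS)) (G x `^ p).
  have [bB DB nB] := HB j; have [_ ->] := total_energy_restr GLp bB.
  have mB : measurable (B j : set XS) by exact: (borel_measurable hmu).
  rewrite (@ge0_negligible_integral _ _ _ mu (B j) (B j `\` D j))//.
  - by rewrite setDD setIC; congr integral; apply/setIidPl.
  - exact: measurableD.
  - exact: measurable_funTS.
  - by move=> x _; exact: poweR_ge0.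
rewrite -lee_fin -sumEFin; under eq_bigr do rewrite eE.
rewrite -total_energyE// -(big_mkord xpredT (fun j => \int[mu]_(x in (D j : set XS)) (G x `^ p))).
rewrite -(@ge0_integral_bigsetU _ _ _ mu _ (fun j => D j : set XS))//.
- apply: ge0_subset_integral => //; last by move=> x _; exact: poweR_ge0.
  by apply: bigsetU_measurable => j _.
- exact: iota_uniq.
- by apply: sub_trivIset tD.
- by apply: measurable_funTS.
- by move=> x _; exact: poweR_ge0.
Qed.

(** The slice min(max(|f| - a, 0), a), for a > 0. Subtracting a keeps it below |f|, hence as
    integrable as f. *)
Definition band (a : R) (f : X -> R) (x : X) : R := (clamp a (2 * a) `|f x| - a)%R.

Lemma band_bounds a f x : (0 < a)%R -> (0 <= band a f x <= `|f x|)%R.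
Proof.
move=> a0; have a2 : (a <= 2 * a)%R by rewrite ler_peMl ?ler1n// ltW.
rewrite /band subr_ge0 /clamp le_max lexx/= lerBlDr ge_max lerDr normr_ge0/=.
by rewrite ge_min lerDl (ltW a0).
Qed.

Lemma band_top a f x : (0 < a)%R -> (2 * a <= `|f x|)%R -> band a f x = a.
Proof.
move=> a0 af; rewrite /band /clamp (min_idPr af) (max_idPr _); first by lra.
by rewrite ler_peMl ?ler1n// ltW.
Qed.

Lemma measurable_band a f : measurable_fun setT (f : XS -> R) ->
  measurable_fun setT (band a f : XS -> R).
Proof.
move=> mf; apply: measurable_funB => //.
apply: (measurableT_comp (@measurable_clamp R a (2 * a))).
exact: (measurableT_comp (@normr_measurable R setT)).
Qed.

Lemma base_integrable_le loc f h : measurable_fun setT (f : XS -> R) ->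
  measurable_fun setT (h : XS -> R) -> (forall x, `|h x| <= `|f x|)%R ->
  base_integrable mu p loc f -> base_integrable mu p loc h.
Proof.
move=> mf mh hf; case: loc => /=.
  move=> /(in_Lploc1P hmu) If; apply/(in_Lploc1P hmu) => x r r_gt0.
  apply: le_integrable (If x r r_gt0).
  - exact: (measurable_ballX hmu).
  - by apply: measurable_funTS; exact/measurable_EFinP.
  - by move=> y _ /=; rewrite lee_fin.
apply: le_lt_trans; have mp k : measurable_fun setT (k : XS -> R) ->
    measurable_fun setT (fun y : XS => (`|k y| `^ p)%:E).
  move=> mk; apply/measurable_EFinP; apply: (measurableT_comp (measurable_powR p)).
  exact: (measurableT_comp (@normr_measurable R setT)).
apply: ge0_le_integral => //.
- exact: mp.
- exact: mp.
- by move=> x _; rewrite lee_fin ler_powR2// ltW.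
Qed.

Lemma admissible_norm loc f G : admissible mu p loc f G ->
  admissible mu p loc (fun x => `|f x|)%R G.
Proof.
move=> af; have [mf bf _ _] := af.
have mn : measurable_fun setT ((fun x => `|f x|)%R : XS -> R).
  exact: (measurableT_comp (@normr_measurable R setT)).
apply: (admissible_lip hmu p_ge1 af mn).
  by apply: base_integrable_le bf => // x; rewrite normr_id.
by move=> x y; exact: ler_dist_dist.
Qed.

Lemma admissible_band loc f G B a : (0 < a)%R -> admissible mu p loc f G ->
  borel_set B -> [set x | (a < `|f x| < 2 * a)%R] `<=` B ->
  admissible mu p loc (band a f) (G \_ B).
Proof.
move=> a0 af bB fB; have [mf bf _ GLp] := af.
have [_ _ wug _] := admissible_norm af.
have aa : (a < 2 * a)%R by rewrite ltr_pMl// ltr1n.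
have [GBLp _] := total_energy_restr GLp bB.
have := weak_upper_gradient_clamp hmu p_gt0 aa wug GLp bB fB => wugB.
split.
- exact: measurable_band.
- apply: base_integrable_le bf => //; first exact: measurable_band.
  by move=> x; have /andP[h1 h2] := band_bounds f x a0; rewrite ger0_norm.
- apply: (weak_upper_gradient_lip hmu p_gt0) wugB _; last exact: pae_curve_lty.
  move=> x y _ _ /=; rewrite lee_fin /band.
  by rewrite opprB addrA subrK.
- exact: GBLp.
Qed.

Variables (C lam R0 A : R).
Hypothesis poin : poincare_const mu E r0 p C lam.
Hypotheses (R0_gt0 : (0 < R0)%R) (R0_le : (4 * (lam * R0) <= r0)%R) (A_gt0 : (0 < A)%R).
Hypothesis ratio : ratio_bound mu nu E p q A (lam * R0).

(** On the level set |F| is below 4 a, while the weak type estimate is applied at height a/2; the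
    quotient of the two is 8. *)
Definition strong_const : R := (8 `^ q * weak_const K delta p q C)%R.

Lemma weak_const_ge0 : (0 <= weak_const K delta p q C)%R.
Proof.
have K1 := geo_K geo.
by rewrite mulr_ge0 ?powR_ge0// exprn_ge0// (le_trans ler01).
Qed.

(* Truncating |f| between the levels a and 2a, where a runs over 4H, 8H, ...,
   splits the energy of f into disjoint pieces, and the weak type estimate for
   each piece controls one dyadic level set. *)
Lemma strong_type loc f G (F : X -> R) (Z : set X) (H : R) : admissible mu p loc f G -> (0 < H)%R ->
  (forall x, E x -> ~ Z x -> lebesgue_value mu f x (F x)) ->
  (forall x, E x -> ~ Z x -> avg mu (B x R0) (fun y => `|f y|)%R <= H)%R ->
  exists h : X -> \bar R, [/\ measurable_fun setT (h : XN -> \bar R), (forall x, 0 <= h x),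
    \int[nu]_x h x <= (strong_const * A `^ q * total_energy G `^ (q / p))%:E &
    forall x, E x -> ~ Z x -> (8 * H < `|F x|)%R -> (`|F x| `^ q)%:E <= h x].
Proof.
move=> af H0 LF HH; have [mf bf _ GLp] := af.
(* The slice at level a_j has average at most H <= a_j / 4 over B(x, R0). Where |F| >= 2 a_j its
   value is a_j, so it deviates from the average by more than a_j / 2 and x lies in the exceptional
   set V_j. *)
pose a (j : nat) := (4 * H * 2 ^+ j)%R.
have a0 j : (0 < a j)%R by rewrite !mulr_gt0// exprn_gt0.
have a2 j : (a j.+1 = 2 * a j)%R by rewrite /a exprS mulrCA.
pose D (j : nat) := [set x | (a j < `|f x| < 2 * a j)%R].
have mD j : measurable (D j : set XS).
  have -> : D j = setT `&` (fun x => `|f x|)%R @^-1` `]a j, (2 * a j)%R[%classic.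
    by rewrite setTI; apply/seteqP; split=> x /=; rewrite in_itv.
  by apply: (measurableT_comp (@normr_measurable R setT) mf).
have leE i j : (i <= j)%N -> (a i <= a j)%R.
  by move=> ij; rewrite ler_pM2l ?mulr_gt0// ler_eXn2l// ltr1n.
have tD : trivIset setT D.
  apply/trivIsetP => i j _ _; wlog ij : i j / (i < j)%N.
    move=> W; rewrite neq_ltn => /orP[ij|ji]; first by rewrite W ?ltn_eqF.
    by rewrite setIC W ?ltn_eqF.
  move=> _; rewrite -subset0 => x [/andP[_ h1] /andP[h2 _]].
  have := leE _ _ ij; rewrite a2 => h3.
  by have := lt_trans h1 (le_lt_trans h3 h2); rewrite ltxx.
have [Bs [HB sumB]] := disjoint_energies GLp mD tD.
have ab j : admissible mu p loc (band (a j) f) (G \_ (Bs j)).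
  by have [bB DB] := HB j; exact: admissible_band.
have ha j : (0 < a j / 2)%R by rewrite divr_gt0.
have /choice[V HV] := fun j => weak_type hmu hnu geo tbE p_ge1 lt_pq poin R0_gt0 R0_le A_gt0 ratio (ab j) (ha j).
have mV j : measurable (V j : set XN) by have [] := HV j.
(* A dominating function whose measurability is clear: it is at least |F|^q on each set 2 a_j <= |F|
   < 4 a_j, by its j-th term. *)
pose h x := \sum_(0 <= j <oo) (((4 * a j) `^ q)%:E * (\1_(V j) x)%:E).
have t0 j : forall x, 0 <= ((4 * a j) `^ q)%:E * (\1_(V j) x)%:E.
  by move=> x; rewrite -EFinM lee_fin mulr_ge0// powR_ge0.
have mt j : measurable_fun setT (fun x : XN => ((4 * a j) `^ q)%:E * (\1_(V j) x)%:E).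
  apply: measurable_funeM; apply/measurable_EFinP.
  exact: measurable_indic.
have [_ lam1 _] := poin.
have sA0 : (0 <= strong_const * A `^ q)%R.
  by rewrite mulr_ge0 ?powR_ge0// (mulr_ge0 (powR_ge0 _ _) weak_const_ge0).
exists h; split.
- have := @ge0_emeasurable_sum _ XN R setT (fun j x => ((4 * a j) `^ q)%:E * (\1_(V j) x)%:E)
    xpredT (fun j x _ _ => t0 j x) (fun j _ => mt j).
  by apply: eq_measurable_fun => x _; apply: eq_eseriesl.
- by move=> x; apply: nneseries_ge0.
- rewrite integral_nneseries//.
  apply: nneseries_le_fin => [j|n]; first exact: integral_ge0.
  pose T := total_energy G.
  have T0 : (0 <= T)%R by exact: total_energy_ge0.
  apply: (@le_trans _ _ (\sum_(0 <= j < n)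
      (strong_const * A `^ q * (T `^ (q / p - 1) * total_energy (G \_ (Bs j))))%:E)).
    apply: lee_sum => j _; rewrite ge0_integralZl_EFin//; last 2 first.
    - by apply/measurable_EFinP; exact: measurable_indic.
    - exact: powR_ge0.
    rewrite integral_indic// setIT.
    have [_ nV _] := HV j.
    apply: (@le_trans _ _ (((4 * a j) `^ q)%:E * (weak_const K delta p q C * A `^ q *
      total_energy (G \_ (Bs j)) `^ (q / p) * (a j / 2) `^ (- q))%:E)).
      by apply: lee_wpmul2l => //; rewrite lee_fin powR_ge0.
    rewrite -EFinM lee_fin /strong_const.
    have -> : ((4 * a j) `^ q = 8 `^ q * (a j / 2) `^ q)%R.
      rewrite -powRM ?(ltW (ha j))//; congr (_ `^ _)%R; by field.
    rewrite powRN.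
    have h1 : ((a j / 2) `^ q != 0)%R by rewrite gt_eqF// powR_gt0.
    set Tj := total_energy _.
    have -> : (8 `^ q * (a j / 2) `^ q * (weak_const K delta p q C * A `^ q * Tj `^ (q / p) *
       ((a j / 2) `^ q)^-1) = 8 `^ q * weak_const K delta p q C * A `^ q * Tj `^ (q / p))%R.
      by field.
    apply: (ler_wpM2l sA0).
    have Tj0 : (0 <= Tj)%R by exact: total_energy_ge0.
    have TjT : (Tj <= T)%R.
      apply: le_trans (sumB j.+1); rewrite big_ord_recr /= lerDr.
      by apply: sumr_ge0 => i _; exact: total_energy_ge0.
    (* Since q > p, one factor of T_j can be kept and the remaining power q/p - 1 bounded by that of
       the total energy; the pieces then sum linearly. *)
    have qp : (0 < q / p - 1)%R by rewrite subr_gt0 ltr_pdivlMr// mul1r.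
    have [->|Tn0] := eqVneq Tj 0%R.
      by rewrite mulr0 powR0// gt_eqF// divr_gt0.
    have -> : (Tj `^ (q / p) = Tj `^ (q / p - 1) * Tj)%R.
      transitivity (Tj `^ (q / p - 1) * Tj `^ 1)%R; last by rewrite powRr1.
      by rewrite -powRD ?subrK// Tn0 implybT.
    by rewrite ler_wpM2r// ler_powR2// ltW.
  rewrite sumEFin lee_fin -mulr_sumr -mulr_sumr; apply: (ler_wpM2l sA0).
  rewrite big_mkord; apply: (@le_trans _ _ (T `^ (q / p - 1) * T)%R).
    by rewrite ler_wpM2l ?powR_ge0.
  have [->|Tn0] := eqVneq T 0%R; first by rewrite mulr0 powR_ge0.
  apply: eq_ler; transitivity (T `^ (q / p - 1) * T `^ 1)%R; first by rewrite powRr1.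
  by rewrite -powRD ?subrK// Tn0 implybT.
move=> x Ex nZ HF.
have exJ : exists j, (`|F x| < a j)%R.
  have q0 : (0 < `|F x| / (4 * H))%R.
    by rewrite divr_gt0 ?mulr_gt0// (le_lt_trans _ HF)// mulr_ge0// ltW.
  exists (Num.truncn (`|F x| / (4 * H))).+1.
  rewrite /a mulrC -ltr_pdivrMr ?mulr_gt0//; apply: (lt_trans (truncnS_gt _)).
  by rewrite -natrX ltr_nat ltn_expl.
(* |F x| > 8 H = a_1, so the first level above |F x| has index at least 2. Written j + 2, it gives 2
   a_j <= |F x| < 4 a_j. *)
case: (ex_minnP exJ) => -[|[|j]] hj minj.
- by move: hj; rewrite /a expr0 mulr1 ltNge => /negP[]; lra.
- by move: hj; rewrite /a expr1 ltNge => /negP[]; lra.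
have Fj : (2 * a j <= `|F x|)%R.
  by rewrite -a2 leNgt; apply/negP => /minj; rewrite ltnn.
have Vx : V j x.
  apply: contrapT => nV; have [_ _ HVx] := HV j.
  have Lb : lebesgue_value mu (band (a j) f) x (band (a j) F x).
    apply: (@lebesgue_value_lip _ _ _ mu f x (F x) (fun s => clamp (a j) (2 * a j) `|s| - a j)%R) => //.
    - apply: measurable_funB => //.
      apply: (measurableT_comp (@measurable_clamp R (a j) (2 * a j))).
      exact: normr_measurable.
    - move=> s t; rewrite opprB addrA subrK.
      apply: le_trans (clamp_lip _ _ _) (ler_dist_dist _ _).
      by rewrite ler_peMl ?ler1n// ltW.
    - exact: (good_point_admissible hmu geo p_ge1 poin R0_gt0 R0_le af).
    - exact: LF.
  have [+ _] := HVx x _ Ex nV Lb.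
  rewrite band_top//.
  have := HH x Ex nZ; set av := avg _ _ _ => avH.
  have [_ lR] := (lam1, R0_le).
  have pB : pos_finite mu (B x R0).
    apply: (geo_mu geo) => //; have := R0_le.
    have : (R0 <= lam * R0)%R by rewrite ler_peMl// ltW.
    by have := geo_r0 geo; have := R0_gt0; lra.
  have If := admissible_integrable hmu p_ge1 af R0_gt0 pB.
  have Ib := admissible_integrable hmu p_ge1 (ab j) R0_gt0 pB.
  have : (avg mu (B x R0) (band (a j) f) <= av)%R.
    apply: le_avg => //; first exact: integrable_on_norm.
    by move=> y _; have /andP[] := band_bounds f y (a0 j).
  rewrite ler_norml => h1 /andP[_ h2].
  have : (4 * H <= a j)%R by rewrite /a ler_peMr ?mulr_ge0 ?(ltW H0)// exprn_ege1// ler1n.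
  by have := H0; lra.
apply: le_trans (nneseries_lim_ge j.+1 _) => //; rewrite big_nat_recr//=.
apply: (@le_trans _ _ (((4 * a j) `^ q)%:E * (\1_(V j) x)%:E)); last first.
  by rewrite leeDr// sume_ge0.
rewrite indicE mem_set// mule1 lee_fin ler_powR2 ?(ltW q_gt0)//.
by apply: ltW; apply: (lt_le_trans hj); rewrite !a2 mulrA -natrM.
Qed.

End strong_type.

(** * Sufficiency of the conditions (1) and (2) *)

Section measurable_averages.
Context {R : realType} {X : pmetricType R} {Smu Snu : set (set X)}.
Variable mu : {measure set (g_sigma_algebraType Smu) -> \bar R}.
Variable nu : {measure set (g_sigma_algebraType Snu) -> \bar R}.
Hypotheses (hmu : complete_borel_measure mu) (hnu : complete_borel_measure nu).

Local Notation XS := (g_sigma_algebraType Smu).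
Local Notation XN := (g_sigma_algebraType Snu).
Local Notation B x r := (ball x r : set XS).

(** Lower semicontinuity: by monotone convergence a slightly smaller concentric ball already has
    integral above a, and nearby balls contain it. Open sets belong to both sigma-algebras, which
    makes averages with respect to mu measurable for nu. *)
Lemma open_ball_integral (g : X -> \bar R) (r : R) (a : \bar R) :
  measurable_fun setT (g : XS -> \bar R) -> (forall x, 0 <= g x) ->
  open [set x | a < \int[mu]_(y in B x r) g y].
Proof.
move=> mg g0; rewrite openE => x /= ax.
have mB z s : measurable (B z s) by exact: (measurable_ballX hmu).
pose D n := B x (r - n.+1%:R^-1).
have [n an] : exists n, a < \int[mu]_(y in D n) g y.
  apply: contrapT => no.
  have Dcvg : \int[mu]_(y in D n) g y @[n --> \oo] --> \int[mu]_(y in \bigcup_n D n) g y.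
    apply: ge0_nondecreasing_set_cvg_integral => //.
    - move=> m n mn; apply/subsetPset; apply: le_ball.
      by rewrite lerD2l lerN2 lef_pV2 ?posrE// ler_nat.
    - by move=> i; exact: mB.
    - by move=> i; exact: measurable_funTS.
  have UD : \bigcup_n D n = B x r.
    apply/seteqP; split=> [y [n _]|y].
      by apply: le_ball; rewrite gerBl invr_ge0.
    rewrite ballEmdist /= => xy.
    have d0 : (0 < r - mdist x y)%R by rewrite subr_gt0.
    exists (Num.truncn (r - mdist x y)^-1) => //; rewrite /D ballEmdist /=.
    rewrite ltrBrDr -ltrBrDl -[ltRHS]invrK ltf_pV2 ?posrE ?invr_gt0//.
    exact: truncnS_gt.
  move: ax; rewrite -UD ltNge => /negP; apply; apply: (cvge_le _ Dcvg).
  apply: nearW => n; rewrite leNgt; apply/negP => an; apply: no.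
  by exists n.
apply/nbhs_ballP; exists (n.+1%:R^-1)%R; first by rewrite /= invr_gt0.
move=> y; rewrite ballEmdist /= => xy; apply: (lt_le_trans an).
apply: (@ge0_subset_integral _ XS R mu (D n) (B y r) (mB _ _) (mB _ _) g (measurable_funTS mg)) => //.
by apply: ball_subset; rewrite addrCA gerDl subr_le0 ltW.
Qed.

Lemma measurable_ball_integral (g : X -> \bar R) (r : R) :
  measurable_fun setT (g : XS -> \bar R) -> (forall x, 0 <= g x) ->
  measurable_fun setT ((fun x => \int[mu]_(y in B x r) g y) : XN -> \bar R).
Proof.
move=> mg g0; apply: (measurability _ (ErealGenOInfty.measurableE R)) => // _ [_ [a ->] <-].
rewrite setTI preimage_itvoy; apply: (open_measurableX hnu).
exact: open_ball_integral.
Qed.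

Lemma measurable_avg (f : X -> R) (r : R) : measurable_fun setT (f : XS -> R) ->
  measurable_fun setT ((fun x => avg mu (B x r) f) : XN -> R).
Proof.
move=> mf; have mF : measurable_fun setT (EFin \o f : XS -> \bar R) by exact/measurable_EFinP.
have mfine (g : X -> \bar R) : measurable_fun setT (g : XN -> \bar R) ->
    measurable_fun setT (fine \o g : XN -> R).
  by move=> mg; exact: (measurableT_comp (fine_measurable measurableT)).
apply: measurable_funM.
  rewrite (_ : (fun x => _) = (fun x => fine (mu (ball x r)) `^ (-1))%R); last first.
    by apply/funext => x; rewrite powR_inv1.
  apply: (measurableT_comp (measurable_powR (-1)%R)).
  apply: mfine; have -> : (fun x : X => mu (ball x r)) = (fun x => \int[mu]_(y in B x r) 1).
    by apply/funext => x; rewrite integral_cst ?mul1e//; exact: (measurable_ballX hmu).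
  by apply: measurable_ball_integral.
rewrite /Rintegral; apply: mfine.
rewrite (_ : (fun x => _) = (fun x => \int[mu]_(y in B x r) (EFin \o f)^\+ y -
    \int[mu]_(y in B x r) (EFin \o f)^\- y)); last first.
  by apply/funext => x; rewrite integralE.
apply: emeasurable_funB; apply: measurable_ball_integral => //.
- exact: measurable_funepos.
- exact: measurable_funeneg.
Qed.

Lemma lebesgue_value_cvg f x b (a : nat -> R) : good_point mu f x -> lebesgue_value mu f x b ->
  (forall n, (0 < a n)%R) -> (a n @[n --> \oo] --> (0 : R))%R ->
  (avg mu (B x (a n)) f @[n --> \oo] --> b)%R.
Proof.
move=> [d1 d10 good] Lb a0 acvg; apply/cvgrPdist_le => e e0.
have [d d0 Hd] := Lb e e0.
have dd : (0 < Num.min d d1)%R by rewrite lt_min d0.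
have /cvgrPdist_lt/(_ _ dd) := acvg; apply: filterS => n.
rewrite sub0r normrN (gtr0_norm (a0 n)) lt_min => /andP[ad ad1].
have [pB If] := good (a n) (introT andP (conj (a0 n) ad1)).
rewrite distrC; apply: le_trans (Hd (a n) _); last by rewrite a0.
exact: avg_sub_cst.
Qed.

(** The upper limit runs over uncountably many radii, but off [Z] it equals the limit along s/(n+1);
    completeness of nu absorbs [Z]. *)
Lemma measurable_limsup_average (E Z : set X) (f : X -> R) (F : X -> R) (s : R) :
  measurable (E : set XN) -> measurable (Z : set XN) -> nu Z = 0 ->
  measurable_fun setT (f : XS -> R) -> (0 < s)%R ->
  (forall x, E x -> good_point mu f x) ->
  (forall x, E x -> ~ Z x -> lebesgue_value mu f x (F x)) ->
  measurable_fun (E : set XN) (limsup_average mu (EFin \o f) : XN -> \bar R).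
Proof.
move=> mE mZ nZ mf s0 good LF.
have mEZ : measurable (E `\` Z : set XN) by exact: measurableD.
have a0 n : (0 < s / n.+1%:R)%R by rewrite divr_gt0.
have acvg : (s / n.+1%:R @[n --> \oo] --> (0 : R))%R.
  by rewrite -[X in _ --> X](mulr0 s); apply: cvgMr; exact: cvg_harmonic.
have mF : measurable_fun (E `\` Z : set XN) (F : XN -> R).
  apply: (@measurable_fun_cvg _ XN R (E `\` Z : set XN) (fun n (x : XN) => avg mu (B x (s / n.+1%:R)%R) f)).
    by move=> n; apply: measurable_funTS; exact: measurable_avg.
  by move=> x [Ex nZx]; apply: lebesgue_value_cvg => //; [exact: good|exact: LF].
pose g := (EFin \o F) \_ (E `\` Z).
have mg : measurable_fun setT (g : XN -> \bar R).
  apply/(measurable_restrictT _ _).1 => //; exact/measurable_EFinP.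
apply: (ae_measurable_fun (cbm_complete hnu) (f := g)); last exact: measurable_funTS.
exists Z; split => // x /= nx; apply: contrapT => nZx; apply: nx => Ex.
rewrite /g patchE mem_set//.
by rewrite (limsup_average_lebesgue (good x Ex) (LF x Ex nZx)).
Qed.

End measurable_averages.

(** * Control of the averages at the top scale by the norm *)

Section control.
Context {R : realType} {X : pmetricType R} {Smu Snu : set (set X)}.
Variable mu : {measure set (g_sigma_algebraType Smu) -> \bar R}.
Variable nu : {measure set (g_sigma_algebraType Snu) -> \bar R}.
Hypotheses (hmu : complete_borel_measure mu) (hnu : complete_borel_measure nu).
Variables (E : set X) (r0 K delta : R).
Hypothesis geo : geometry mu nu E r0 K delta.
Hypothesis tbE : totally_bounded E.
Hypothesis mE : Snu E.
Variables (p q : R) (p_ge1 : (1 <= p)%R) (lt_pq : (p < q)%R).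

Local Notation XS := (g_sigma_algebraType Smu).
Local Notation XN := (g_sigma_algebraType Snu).
Local Notation B x r := (ball x r : set XS).
Local Notation total_energy := (total_energy mu p).
Local Notation muB := (muB mu).

Let p_gt0 : (0 < p)%R. Proof. exact: lt_le_trans p_ge1. Qed.
Let q_gt0 : (0 < q)%R. Proof. exact: lt_trans lt_pq. Qed.
Let r0_gt0 : (0 < r0)%R. Proof. exact: geo_r0 geo. Qed.
Let K_gt0 : (0 < K)%R. Proof. exact: lt_le_trans (geo_K geo). Qed.
Let mEN : measurable (E : set XN). Proof. exact: S_measurable. Qed.

Lemma seq_lower_bound (T : eqType) (s : seq T) (a : T -> R) :
  (forall z, z \in s -> 0 < a z)%R ->
  exists2 m : R, (0 < m)%R & forall z, z \in s -> (m <= a z)%R.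
Proof.
elim: s => [|y s IH] a0; first by exists 1%R.
have [|m m0 Hm] := IH; first by move=> z zs; apply: a0; rewrite in_cons zs orbT.
exists (Num.min m (a y)); first by rewrite lt_min m0 a0// mem_head.
move=> z; rewrite in_cons => /predU1P[->|/Hm mz]; first by rewrite ge_min lexx orbT.
by rewrite ge_min mz.
Qed.

Lemma muB_lower_bound s : (0 < s)%R -> (s <= r0)%R ->
  exists2 m : R, (0 < m)%R & forall x, E x -> (m <= muB x s)%R.
Proof.
move=> s0 sr; have s20 : (0 < s / 2)%R by rewrite divr_gt0.
have [F [FE Fcov]] := totally_bounded_net tbE s20.
have s2r : (s / 2 <= 2 * r0)%R by have := r0_gt0; lra.
have [|m m0 Hm] := @seq_lower_bound _ F (fun z => muB z (s / 2)).
  by move=> z zF; apply: (muB_gt0 geo) => //; exact: FE.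
exists m => // x Ex; have [z zF zx] := Fcov x Ex.
apply: (le_trans (Hm z zF)); apply: (le_muB hmu geo) => //; first exact: FE.
- by have := r0_gt0; lra.
- have {}zx : (mdist z x < s / 2)%R by move: zx; rewrite ballEmdist.
  apply: ball_subset; lra.
Qed.

Lemma nu_E_lty : nu E < +oo.
Proof.
have [F [FE Fcov]] := totally_bounded_net tbE r0_gt0.
apply: (@le_lt_trans _ _ (nu (\big[setU/set0]_(z <- F) (ball z r0 : set XN)))).
  apply: le_measure; rewrite ?inE//.
    by apply: bigsetU_measurable => z _; exact: (measurable_ballX hnu).
  by move=> x Ex; have [z zF zx] := Fcov x Ex; rewrite -bigcup_seq; exists z.
elim: F FE {Fcov} => [|z F IH] FE; first by rewrite big_nil measure0.
rewrite big_cons; apply: le_lt_trans (measureU2 _ _ _) _.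
- exact: (measurable_ballX hnu).
- by apply: bigsetU_measurable => y _; exact: (measurable_ballX hnu).
apply: lte_add_pinfty; last by apply: IH => y yF; apply: FE; rewrite in_cons yF orbT.
have Ez : E z by apply: FE; exact: mem_head.
by have [] := geo_nu geo Ez r0_gt0 (ler_peMl (ltW r0_gt0) (ler1n R 2)).
Qed.

(** An L^1(E, nu) bound says something only about sets of positive measure. Net balls meeting E in a
    null set are discarded, and [N] is what they covered. *)
Lemma good_net e : (0 < e)%R -> exists (F : seq X) (N : set X),
  [/\ measurable (N : set XN), nu N = 0,
    forall z, z \in F -> E z /\ 0 < nu (ball z e `&` E) &
    forall x, E x -> ~ N x -> exists2 z, z \in F & ball z e x].
Proof.
move=> e0; have [F [FE Fcov]] := totally_bounded_net tbE e0.
pose U z : set XN := ball z e `&` E.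
have mU z : measurable (U z).
  by apply: measurableI => //; exact: (measurable_ballX hnu).
exists [seq z <- F | 0 < nu (U z)], (\big[setU/set0]_(z <- [seq z <- F | ~~ (0 < nu (U z))]) U z).
split.
- exact: bigsetU_measurable.
- elim: (F) => [|z s IH] /=; first by rewrite big_nil measure0.
  case: ifP => //; rewrite -leNgt => nz; rewrite big_cons setUC measureU0//.
    exact: bigsetU_measurable.
  by apply/eqP; rewrite eq_le nz/=.
- by move=> z; rewrite mem_filter => /andP[nz zF]; split => //; exact: FE.
move=> x Ex nNx; have [z zF zx] := Fcov x Ex; exists z => //.
rewrite mem_filter zF andbT; apply: contrapT => /negP nz; apply: nNx.
by rewrite -bigcup_seq; exists z => //=; rewrite mem_filter nz.
Qed.

(** The real-valued ubar; infinite values become a default, which affects only a nu-null subset of E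
    for the functions considered. *)
Definition precise (f : X -> R) (x : X) : R := fine (limsup_average mu (EFin \o f) x).

Variables (C lam R0 A : R).
Hypothesis poin : poincare_const mu E r0 p C lam.
Hypotheses (R0_gt0 : (0 < R0)%R) (R0_le : (4 * (lam * R0) <= r0)%R) (A_gt0 : (0 < A)%R).
Hypothesis ratio : ratio_bound mu nu E p q A (lam * R0).

Let lam_ge1 : (1 <= lam)%R. Proof. by case: poin. Qed.
Let C_gt0 : (0 < C)%R. Proof. by case: poin. Qed.
Let R0_le_lam : (R0 <= lam * R0)%R. Proof. by rewrite ler_peMl// ltW. Qed.

Lemma precise_lebesgue loc f G : admissible mu p loc f G ->
  measurable_fun (E : set XN) (limsup_average mu (EFin \o f) : XN -> \bar R) /\
  exists Z : set X, [/\ measurable (Z : set XN), nu Z = 0 &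
    forall x, E x -> ~ Z x -> lebesgue_value mu f x (precise f x) /\
      limsup_average mu (EFin \o f) x = (precise f x)%:E].
Proof.
move=> af; have [Z [mZ nZ HZ]] := lebesgue_points hmu hnu geo tbE p_ge1 lt_pq poin R0_gt0 R0_le A_gt0 ratio af.
have good x : E x -> good_point mu f x := good_point_admissible hmu geo p_ge1 poin R0_gt0 R0_le af.
have LE x : E x -> ~ Z x -> lebesgue_value mu f x (precise f x) /\
      limsup_average mu (EFin \o f) x = (precise f x)%:E.
  move=> Ex nZx; have [b Lb] := HZ x Ex nZx.
  by rewrite /precise (limsup_average_lebesgue (good x Ex) Lb).
split; last by exists Z.
have [mf _ _ _] := af.
apply: (@measurable_limsup_average _ _ _ _ mu nu hmu hnu E Z f (precise f) R0) => //.
by move=> x Ex nZx; have [] := LE x Ex nZx.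
Qed.

Lemma measurable_precise loc f G : admissible mu p loc f G ->
  measurable_fun (E : set XN) (precise f : XN -> R).
Proof.
move=> /precise_lebesgue[mL _].
exact: (measurableT_comp (fine_measurable measurableT) mL).
Qed.

(** The norm of either space is at most [kap], witnessed by an arbitrary admissible gradient. For
    the Dirichlet space each of the two summands is bounded separately. *)
Definition norm_le loc (f : X -> R) G (kap : R) : Prop :=
  [/\ admissible mu p loc f G, (total_energy G <= kap `^ p)%R &
    if loc then \int[nu]_(x in (E : set XN)) `|precise f x|%:E <= kap%:E
    else \int[mu]_x (`|f x| `^ p)%:E <= (kap `^ p)%:E].

Let pos_ballE x : E x -> pos_finite mu (B x R0).
Proof.
move=> Ex; apply: (geo_mu geo) => //; have := R0_le; have := R0_le_lam.
by have := r0_gt0; have := R0_gt0; lra.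
Qed.

(** From t <= 1 + t^p with t = |f| / k one gets |f| <= k + k^(1-p) |f|^p. Integration over a ball of
    measure at least m gives the constant 1 + 1/m. *)
Let control_Lp : exists2 Cc : R, (0 < Cc)%R & forall f G kap, (0 < kap)%R ->
  norm_le false f G kap -> forall x, E x -> (avg mu (B x R0) (fun y => `|f y|) <= Cc * kap)%R.
Proof.
have R0r : (R0 <= r0)%R by have := R0_le; have := R0_le_lam; have := R0_gt0; lra.
have [m m0 Hm] := muB_lower_bound R0_gt0 R0r.
exists (1 + m^-1)%R; first by rewrite addr_gt0// invr_gt0.
move=> f G k k0 [af _ fk] x Ex; have pB := pos_ballE Ex.
have If := integrable_on_norm pB (admissible_integrable hmu p_ge1 af R0_gt0 pB).
have M0 := pos_finite_fine pB; have [mB _ Moo] := pB.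
have [mf _ _ _] := af.
have mfn : measurable_fun setT (fun y : XS => `|f y|%:E).
  by apply/measurable_EFinP; exact: (measurableT_comp (@normr_measurable R setT)).
have mfp : measurable_fun setT (fun y : XS => (`|f y| `^ p)%:E).
  apply/measurable_EFinP; apply: (measurableT_comp (measurable_powR p)).
  exact: (measurableT_comp (@normr_measurable R setT)).
have kp0 : (0 <= k `^ (1 - p))%R by exact: powR_ge0.
have bound : \int[mu]_(y in B x R0) `|f y|%:E <= (k * muB x R0 + k)%:E.
  apply: (@le_trans _ _ (\int[mu]_(y in B x R0) (k%:E + (k `^ (1 - p))%:E * (`|f y| `^ p)%:E))).
    apply: ge0_le_integral => //.
    - exact: measurable_funTS.
    - apply: emeasurable_funD => //; apply: measurable_funeM; exact: measurable_funTS.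
    - move=> y _; rewrite -EFinM -EFinD lee_fin.
      have := @le_1_powR _ p p_ge1 (`|f y| / k)%R (divr_ge0 (normr_ge0 _) (ltW k0)).
      rewrite powRM ?invr_ge0 ?(ltW k0)// -(powR_inv1 (ltW k0)) -powRrM mulN1r.
      rewrite (powR_inv1 (ltW k0)) ler_pdivrMr// mulrDl mul1r => /le_trans; apply.
      rewrite lerD2l -mulrA mulrC ler_wpM2r ?powR_ge0//.
      rewrite -{2}(powRr1 (ltW k0)) -powRD; last by rewrite (gt_eqF k0) implybT.
      by rewrite (addrC (- p)%R).
  rewrite ge0_integralD//; last 3 first.
  - by move=> y _; rewrite lee_fin ltW.
  - by move=> y _; rewrite -EFinM lee_fin mulr_ge0// powR_ge0.
  - by apply: measurable_funeM; exact: measurable_funTS.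
  rewrite integral_cst// EFinD; apply: leeD.
    by rewrite -[mu _]fineK ?ge0_fin_numE// EFinM.
  rewrite ge0_integralZl_EFin//; last exact: measurable_funTS.
  apply: (@le_trans _ _ ((k `^ (1 - p))%:E * (k `^ p)%:E)).
    apply: lee_wpmul2l => //; apply: le_trans fk.
    by apply: ge0_subset_integral.
  rewrite -EFinM lee_fin -powRD; last by rewrite (gt_eqF k0) implybT.
  by rewrite subrK powRr1// ltW.
rewrite /avg ler_pdivrMl//.
have mM : (m <= fine (mu (B x R0)))%R := Hm x Ex.
rewrite -lee_fin /Rintegral fineK; last exact: integrable_fin_num If.
apply: (le_trans bound); rewrite lee_fin -/(muB x R0) mulrCA mulrDl mul1r.
by rewrite (mulrC k) lerD2l mulrA ler_peMl ?(ltW k0)// ler_pdivlMl// mulr1.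
Qed.

(* In the Dirichlet case, the weak type estimate and the L^1(E, nu) bound
   provide one good point near each point of E, apart from a null set. *)
Let control_loc : exists2 Cc : R, (0 < Cc)%R & forall f G kap, (0 < kap)%R ->
  norm_le true f G kap -> exists Z : set X, [/\ measurable (Z : set XN), nu Z = 0 &
    forall x, E x -> ~ Z x -> (avg mu (B x R0) (fun y => `|f y|) <= Cc * kap)%R].
Proof.
have lR0 : (0 < lam * R0)%R by rewrite mulr_gt0// (lt_le_trans ltr01).
have lRr : (lam * R0 <= r0)%R by have := R0_le; lra.
have [m m0 Hm] := muB_lower_bound lR0 lRr.
have R40 : (0 < R0 / 4)%R by rewrite divr_gt0.
have [F [N [mN nN FE Fcov]]] := good_net R40.
pose U z : set XN := ball z (R0 / 4) `&` E.
have mU z : measurable (U z).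
  by apply: measurableI => //; exact: (measurable_ballX hnu).
have Uoo z : nu (U z) < +oo.
  apply: le_lt_trans nu_E_lty; apply: le_measure; rewrite ?inE//.
  exact: subIsetr.
pose n z := fine (nu (U z)).
have nE z : nu (U z) = (n z)%:E by rewrite fineK// ge0_fin_numE.
have [|eta eta0 Heta] := @seq_lower_bound _ F n.
  by move=> z /FE[_]; rewrite -[ball z _ `&` E]/(U z) nE lte_fin.
pose W := (weak_const K delta p q C * A `^ q)%R.
have W0 : (0 <= W)%R by rewrite mulr_ge0 ?powR_ge0// (weak_const_ge0 geo).
(* At height L k the exceptional set of the weak type estimate has measure at most eta/3, a third of
   what each net ball contains of E. *)
pose L0 := (3 * (W + 1) / eta)%R.
have L00 : (0 < L0)%R by rewrite divr_gt0// mulr_gt0// ltr_wpDl.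
pose L := (L0 `^ q^-1)%R.
have Lp : (0 < L)%R by rewrite powR_gt0.
have WL : (W * L `^ (- q) <= eta / 3)%R.
  rewrite /L -powRrM mulrN mulVf ?gt_eqF// (powR_inv1 (ltW L00)) /L0 invf_div mulrA.
  rewrite ler_pdivrMr ?mulr_gt0 ?ltr_wpDl// mulrC.
  have -> : (eta / 3 * (3 * (W + 1)) = eta * (W + 1))%R by field.
  by rewrite ler_pM2l// lerDl.
pose D := (C * R0 * m `^ (- p^-1))%R.
have D0 : (0 <= D)%R by rewrite !mulr_ge0 ?powR_ge0 ?(ltW C_gt0) ?(ltW R0_gt0).
(* 3/eta comes from Chebyshev's inequality at a good point, L from the weak type estimate there, K^2
   D from moving the average from z to x, and D from replacing |avg f| by the average of |f|. *)
exists (3 / eta + L + (K ^+ 2 + 1) * D)%R.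
  rewrite ltr_wpDr ?addr_gt0 ?divr_gt0// mulr_ge0// addr_ge0// exprn_ge0//.
  exact: ltW.
move=> f G k k0 [af Tk fk].
have [_ [Z [mZ nZ HZ]]] := precise_lebesgue af.
have mr := measurable_precise af.
have Lk : (0 < L * k)%R by rewrite mulr_gt0.
have [V [mV nV HV]] := weak_type hmu hnu geo tbE p_ge1 lt_pq poin R0_gt0 R0_le A_gt0 ratio af Lk.
have {}nV : nu V <= (eta / 3)%:E.
  apply: (le_trans nV); rewrite lee_fin; apply: le_trans WL.
  rewrite -/W -mulrA; apply: ler_wpM2l => //.
  apply: (@le_trans _ _ (k `^ q * (L * k) `^ (- q))%R).
    rewrite ler_wpM2r ?powR_ge0//.
    apply: (le_trans (ler_powR2 _ (total_energy_ge0 _ _ _) Tk)); first by rewrite divr_ge0 ?ltW.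
    by rewrite -powRrM mulrCA mulfV ?gt_eqF// mulr1.
  rewrite powRM ?(ltW Lp) ?(ltW k0)// mulrCA -powRD; last by rewrite (gt_eqF k0) implybT.
  by rewrite subrr powRr0 mulr1.
have good z : z \in F ->
    (`|avg mu (B z (R0 / 2)) f| <= (3 / eta + L) * k)%R.
  move=> zF; have eta_n : (eta <= n z)%R by exact: Heta.
  pose S : set XN := U z `\` (V `|` Z).
  have mS : measurable S by apply: measurableD => //; exact: measurableU.
  have nS : (2 * (eta / 3))%:E <= nu S.
    have : nu (U z) <= nu S + nu (V `|` Z).
      apply: (@le_trans _ _ (nu (S `|` (V `|` Z)))).
        apply: le_measure; rewrite ?inE//; first exact: measurableU (measurableU _ _ _ _).
        by move=> y Uy; have [VZ|nVZ] := pselect ((V `|` Z) y); [right|left].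
      by apply: measureU2 => //; exact: measurableU.
    rewrite measureU0// nE => h.
    have : (n z)%:E <= nu S + (eta / 3)%:E by apply: (le_trans h); rewrite leeD2l.
    rewrite -leeBlDr// => h2; apply: le_trans h2.
    rewrite -EFinB lee_fin; lra.
  (* Otherwise |ubar| > 3 k / eta on a set of measure at least 2 eta / 3, and its integral would be
     at least 2 k. *)
  have [x [Sx xk]] : exists x, S x /\ (`|precise f x| <= 3 / eta * k)%R.
    apply: contrapT => no.
    have : (3 / eta * k)%:E * nu S <= k%:E.
      rewrite -integral_cst//; apply: le_trans fk.
      apply: (@le_trans _ _ (\int[nu]_(y in S) `|precise f y|%:E)).
        apply: ge0_le_integral => //.
        - by move=> y _; rewrite lee_fin mulr_ge0 ?divr_ge0 ?(ltW eta0) ?(ltW k0).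
        - apply/measurable_EFinP; apply: (measurableT_comp (@normr_measurable R setT)).
          by apply: measurable_funS mr => // y [[]].
        - move=> y Sy; rewrite lee_fin leNgt; apply/negP => /ltW h; apply: no.
          by exists y.
      apply: ge0_subset_integral => //; last by move=> y [[]].
      apply/measurable_EFinP; apply: (measurableT_comp (@normr_measurable R setT)).
      exact: mr.
    apply/negP; rewrite -ltNge.
    apply: (@lt_le_trans _ _ ((3 / eta * k)%:E * (2 * (eta / 3))%:E)).
      rewrite -EFinM lte_fin.
      have -> : (3 / eta * k * (2 * (eta / 3)) = 2 * k)%R by field; rewrite gt_eqF.
      by rewrite ltr_pMl// ltr1n.
    by apply: lee_wpmul2l => //; rewrite lee_fin mulr_ge0 ?divr_ge0 ?(ltW eta0) ?(ltW k0).
  have [[zx Ex] nVZ] := Sx.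
  have [Lb _] := HZ x Ex (fun Zx => nVZ (or_intror Zx)).
  have [_ /(_ z (FE z zF).1)] := HV x _ Ex (fun Vx => nVZ (or_introl Vx)) Lb.
  have {}zx : (mdist x z < R0 / 4)%R by move: zx; rewrite ballEmdist /= metric_sym.
  move=> /(_ zx) h.
  have -> : (avg mu (B z (R0 / 2)) f = precise f x - (precise f x - avg mu (B z (R0 / 2)) f))%R.
    by rewrite subKr.
  by apply: (le_trans (ler_normB _ _)); rewrite mulrDl lerD.
exists N; split => // x Ex nNx; have [z zF zx] := Fcov x Ex nNx.
have {}zx : (mdist x z < R0 / 4)%R by move: zx; rewrite ballEmdist /= metric_sym.
have pB := pos_ballE Ex.
have If := admissible_integrable hmu p_ge1 af R0_gt0 pB.
have osck : (osc mu (B x R0) f <= D * k)%R.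
  have [_ _ H] := poin; apply: (le_trans (H _ _ _ _ _ af Ex R0_gt0 lRr)).
  rewrite /D -!mulrA ler_pM2l// ler_pM2l//.
  apply: (@le_trans _ _ ((m^-1 * k `^ p) `^ p^-1)%R).
    apply: ler_powR2; first by rewrite invr_ge0 ltW.
      by rewrite divr_ge0 ?energy_ge0// fine_ge0.
    rewrite mulrC; apply: ler_pM; [by rewrite invr_ge0 fine_ge0|exact: energy_ge0| |].
      by rewrite lef_pV2 ?posrE ?Hm// (lt_le_trans m0)// Hm.
    apply: le_trans Tk; apply: (energy_le_total hmu); by case: af.
  rewrite powRM ?invr_ge0 ?(ltW m0) ?powR_ge0// -powRrM mulfV ?gt_eqF// powRr1 ?(ltW k0)//.
  by rewrite -(powR_inv1 (ltW m0)) -powRrM mulN1r.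
have near := avg_near hmu geo p_ge1 poin R0_gt0 R0_le af Ex (FE z zF).1 zx.
have gz := good z zF.
apply: (le_trans (avg_norm_le pB If)); rewrite mulrDl (mulrDl _ 1%R) mul1r mulrDl addrA.
apply: lerD => //.
rewrite -[X in (`|X|)%R](subrK (avg mu (B z (R0 / 2)) f)) addrC.
apply: (le_trans (ler_normD _ _)); apply: lerD => //.
by apply: (le_trans near); rewrite -mulrA ler_wpM2l// exprn_ge0// ltW.
Qed.

Lemma control : exists2 Cc : R, (0 < Cc)%R & forall loc f G kap, (0 < kap)%R ->
  norm_le loc f G kap -> exists Z : set X, [/\ measurable (Z : set XN), nu Z = 0 &
    forall x, E x -> ~ Z x -> (avg mu (B x R0) (fun y => `|f y|) <= Cc * kap)%R].
Proof.
have [C1 C10 H1] := control_Lp; have [C2 C20 H2] := control_loc.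
exists (C1 + C2)%R; first exact: addr_gt0.
move=> [] f G k k0 nk.
  have [Z [mZ nZ HZ]] := H2 f G k k0 nk; exists Z; split=> // x Ex nZx.
  by apply: (le_trans (HZ x Ex nZx)); rewrite ler_pM2r// lerDr ltW.
exists set0; split=> // x Ex _; apply: (le_trans (H1 f G k k0 nk x Ex)).
by rewrite ler_pM2r// lerDl ltW.
Qed.

End control.

Lemma poweR_root_lt {R : realType} (a : \bar R) (p k : R) : (0 < p)%R -> (0 < k)%R ->
  a `^ p^-1 < k%:E -> a < (k `^ p)%:E.
Proof.
move=> p0 k0; rewrite !ltNge; apply: contra => ka.
have := @lee_poweR R p^-1%R _ _ _ _ ka; rewrite poweR_EFin -powRrM mulfV ?gt_eqF//.
rewrite powRr1 ?(ltW k0)//; apply; first by rewrite invr_ge0 ltW.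
by rewrite lee_fin powR_ge0.
Qed.

Lemma fine_norm_le {R : realType} (a : \bar R) : `|fine a|%:E <= `|a|.
Proof. by case: a => [r| |] /=; rewrite ?normr0 ?leey. Qed.

(** * Reduction of both spaces to admissible pairs *)

Section reduction.
Context {R : realType} {X : pmetricType R} {Smu Snu : set (set X)}.
Variable mu : {measure set (g_sigma_algebraType Smu) -> \bar R}.
Variable nu : {measure set (g_sigma_algebraType Snu) -> \bar R}.
Hypotheses (hmu : complete_borel_measure mu) (hnu : complete_borel_measure nu).
Variables (E : set X) (p : R).
Hypotheses (mE : Snu E) (p_ge1 : (1 <= p)%R).

Local Notation XS := (g_sigma_algebraType Smu).
Local Notation XN := (g_sigma_algebraType Snu).
Local Notation B x r := (ball x r : set XS).
Local Notation total_energy := (total_energy mu p).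

Let p_gt0 : (0 < p)%R. Proof. exact: lt_le_trans p_ge1. Qed.
Let mEN : measurable (E : set XN). Proof. exact: S_measurable. Qed.

Implicit Types (u g : X -> \bar R).

Let wug_fine u g : weak_upper_gradient mu p u g -> borel_Lp mu p g ->
  weak_upper_gradient mu p (EFin \o (fine \o u)) g.
Proof.
move=> ug gLp; apply: (weak_upper_gradient_lip hmu p_gt0) ug _; last exact: pae_curve_lty.
by move=> x y ux uy; rewrite -(fineK ux) -(fineK uy).
Qed.

Let limsup_average_fine u : (forall x r, (0 < r)%R -> measurable_fun (B x r) (u : XS -> \bar R)) ->
  (forall x r, (0 < r)%R -> {ae mu, forall y, B x r y -> u y \is a fin_num}) ->
  limsup_average mu u = limsup_average mu (EFin \o (fine \o u)).
Proof.
move=> mu_ fu; apply/funext => x; apply: (@limsup_average_congr _ _ _ _ _ _ _ 1%R) => // r /andP[rp _].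
rewrite /average; congr *%E; apply: ae_eq_integral.
- exact: (measurable_ballX hmu).
- exact: mu_.
- apply/measurable_EFinP.
  exact: (measurableT_comp (fine_measurable measurableT) (mu_ x r rp)).
have := fu x r rp; apply: filterS => y fy By /=.
by rewrite fineK ?fy.
Qed.

Let le_total_energy g (k : R) : borel_Lp mu p g -> \int[mu]_y (g y `^ p) <= (k `^ p)%:E ->
  (total_energy g <= k `^ p)%R.
Proof. by move=> gLp; rewrite total_energyE// lee_fin. Qed.

Let measurable_normp u : measurable_fun setT (u : XS -> \bar R) ->
  measurable_fun setT ((fun y => `|u y| `^ p) : XS -> \bar R).
Proof.
move=> mu'; apply: (measurableT_comp (measurable_poweR p)).
exact: (measurableT_comp (@abse_measurable R setT)).
Qed.

(** All that the sufficiency proof needs of the space. The inequality on the norm is strict because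
    the infimum over gradients in the Newtonian norm need not be attained. *)
Definition reduces loc (Y : @function_space R X) := forall u, fs_mem Y u ->
  [/\ limsup_average mu u = limsup_average mu (EFin \o (fine \o u)),
      0 <= fs_norm Y u < +oo &
      forall k : R, (0 < k)%R -> fs_norm Y u < k%:E ->
        exists G, norm_le mu nu E p loc (fine \o u) G k].

Lemma newtonian_reduces : reduces false (newtonian_space mu p).
Proof.
move=> u [mu' unorm] /=.
have mup := measurable_normp mu'.
have iu0 : 0 <= \int[mu]_y (`|u y| `^ p) by apply: integral_ge0 => y _; exact: poweR_ge0.
have ig0 : 0 <= ereal_inf [set \int[mu]_y (g y `^ p) | g in upper_gradient u].
  apply: le_ereal_inf_tmp => _ [g _ <-]; apply: integral_ge0 => y _; exact: poweR_ge0.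
have Hk (k : R) : (0 < k)%R -> newtonian_norm mu p u < k%:E ->
    \int[mu]_y (`|u y| `^ p) < (k `^ p)%:E /\
    exists2 g, upper_gradient u g & \int[mu]_y (g y `^ p) < (k `^ p)%:E.
  move=> k0 /(poweR_root_lt p_gt0 k0) h; split.
    by apply: le_lt_trans h; rewrite leeDl.
  have /ereal_inf_lt[_ [g ug <-] gk] :
      ereal_inf [set \int[mu]_y (g y `^ p) | g in upper_gradient u] < (k `^ p)%:E.
    by apply: le_lt_trans h; rewrite leeDr.
  by exists g.
have fu : {ae mu, forall y : XS, u y \is a fin_num}.
  have [k k0 uk] : exists2 k : R, (0 < k)%R & newtonian_norm mu p u < k%:E.
    exists (fine (newtonian_norm mu p u) + 1)%R.
      by rewrite ltr_wpDl// fine_ge0// poweR_ge0.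
    by rewrite EFinD fineK ?lteDl// ge0_fin_numE// poweR_ge0.
  have [uoo _] := Hk k k0 uk.
  have : mu.-integrable setT (fun y : XS => `|u y| `^ p).
    apply/integrableP; split => //; apply: lt_trans (ltry (k `^ p)).
    move: uoo; congr (_ < _); apply: eq_integral => y _.
    by rewrite (@gee0_abs _ (`|u y| `^ p)) ?poweR_ge0.
  move/(integrable_ae measurableT); apply: filterS => y /(_ I) fy.
  have : `|u y| < +oo by apply: (@lty_poweRy _ _ p); rewrite ?gt_eqF// ltey_eq fy.
  by rewrite fin_num_abs.
split.
- apply: limsup_average_fine; first by move=> x r _; exact: measurable_funTS.
  by move=> x r _; apply: filterS fu.
- by rewrite poweR_ge0.
move=> k k0 uk; have [uk' [g ug gk]] := Hk k k0 uk.
have gLp : borel_Lp mu p g.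
  by have [bg g0 _] := ug; split => //; exact: lt_trans gk (ltry _).
have mf : measurable_fun setT (fine \o u : XS -> R).
  exact: (measurableT_comp (fine_measurable measurableT) mu').
have fp : \int[mu]_x (`|fine (u x)| `^ p)%:E <= \int[mu]_y (`|u y| `^ p).
  apply: ge0_le_integral => //.
  - by apply: (@measurable_normp (EFin \o (fine \o u))); exact/measurable_EFinP.
  move=> y _; rewrite -poweR_EFin; apply: lee_poweR; first exact: ltW.
    by rewrite lee_fin.
  exact: fine_norm_le.
exists g; split.
- split => //.
  + by apply: (le_lt_trans fp); exact: lt_trans uk' (ltry _).
  + by apply: wug_fine => //; exact: (upper_gradient_weak hmu p_gt0).
- by apply: le_total_energy => //; exact: ltW.
- by apply: (le_trans fp); exact: ltW.
Qed.

Lemma min_upper_gradient_le u g : weak_upper_gradient mu p u g -> borel_Lp mu p g ->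
  [/\ minimal_weak_upper_gradient mu p u (min_upper_gradient mu p u),
      borel_Lp mu p (min_upper_gradient mu p u) &
      \int[mu]_y (min_upper_gradient mu p u y `^ p) <= \int[mu]_y (g y `^ p)].
Proof.
move=> ug gLp; have [g' gmin gLp'] := exists_minimal_weak_upper_gradient hmu p_gt0 ug gLp.
have Gmin : minimal_weak_upper_gradient mu p u (min_upper_gradient mu p u).
  by apply: (@xgetPex _ (cst +oo) [set g | minimal_weak_upper_gradient mu p u g]); exists g'.
set G := min_upper_gradient mu p u in Gmin *.
have [[bG G_ge0 _] _ Gle] := Gmin; have [bg g_ge0 goo] := gLp.
have mp h : borel_fun h -> measurable_fun setT ((fun y => h y `^ p) : XS -> \bar R).
  by move=> bh; apply: (borel_fun_measurable hmu); exact: borel_poweR.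
have GlegE : \int[mu]_y (G y `^ p) <= \int[mu]_y (g y `^ p).
  apply: ae_ge0_le_integral => //.
  - by move=> y _; exact: poweR_ge0.
  - exact: mp.
  - by move=> y _; exact: poweR_ge0.
  - exact: mp.
  have : {ae mu, forall y : XS, G y <= g y}.
    by apply: Gle => //; exact: (borel_Lp_loc hmu p_gt0 gLp).
  apply: filterS => y h _.
  by apply: lee_poweR => //; exact: ltW.
by split => //; split => //; exact: le_lt_trans goo.
Qed.

Lemma dirichlet_reduces : reduces true (dirichlet_space mu nu p E).
Proof.
move=> u [[uloc [g0 ug0 g0Lp]] ubar] /=.
have Iu := (in_Lploc1P hmu u).1 uloc.
have mB x r : measurable (B x r) by exact: (measurable_ballX hmu).
have muB' x r : (0 < r)%R -> measurable_fun (B x r) (u : XS -> \bar R).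
  by move=> rp; exact: measurable_int (Iu x r rp).
have mu' : measurable_fun setT (u : XS -> \bar R).
  have UB : \bigcup_n B point n.+1%:R = setT :> set XS.
    apply/seteqP; split => // y _; exists (Num.truncn (mdist point y)) => //.
    by rewrite ballEmdist /=; exact: truncnS_gt.
  by rewrite -UB; apply/measurable_fun_bigcup => // n; exact: muB'.
have g0bLp : borel_Lp mu p g0.
  have [bg g0_ge0 _] := ug0; split => //.
  have [_ +] := (in_LpP mu g0 p_gt0 measurableT).1 g0Lp.
  by congr (_ < _); apply: eq_integral => y _; rewrite gee0_abs.
have ug0' := upper_gradient_weak hmu p_gt0 ug0.
have [Gmin GLp _] := min_upper_gradient_le ug0' g0bLp.
set G := min_upper_gradient mu p u in Gmin GLp *.
have [ugG _ _] := Gmin; have [bG G_ge0 _] := ugG.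
have EN : Lpnorm nu E 1 (limsup_average mu u) =
    \int[nu]_(x in (E : set XN)) `|limsup_average mu u x|.
  rewrite LpnormE// invr1 poweRe1.
    by apply: eq_integral => x _; rewrite poweRe1.
  by apply: integral_ge0 => x _; exact: poweR_ge0.
have GN : Lpnorm mu setT p G = (\int[mu]_y (G y `^ p)) `^ p^-1.
  by rewrite LpnormE//; congr (_ `^ _); apply: eq_integral => y _; rewrite gee0_abs.
have limE : limsup_average mu u = limsup_average mu (EFin \o (fine \o u)).
  apply: limsup_average_fine => // x r rp.
  exact: integrable_ae (Iu x r rp).
have e0 : 0 <= Lpnorm nu E 1 (limsup_average mu u).
  by rewrite EN; apply: integral_ge0.
have g0' : 0 <= Lpnorm mu setT p G by rewrite GN poweR_ge0.
split; first exact: limE.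
  apply/andP; split; first exact: adde_ge0.
  apply: lte_add_pinfty; last by case: ubar.
  by rewrite GN; apply: poweR_lty; case: GLp.
move=> k k0 uk; exists G.
have Gk : Lpnorm mu setT p G < k%:E by apply: le_lt_trans uk; rewrite leeDl.
have Ek : Lpnorm nu E 1 (limsup_average mu u) < k%:E by apply: le_lt_trans uk; rewrite leeDr.
have mf : measurable_fun setT (fine \o u : XS -> R).
  exact: (measurableT_comp (fine_measurable measurableT) mu').
split.
- split; [exact: mf| |exact: wug_fine|exact: GLp].
  + apply/(in_Lploc1P hmu) => x r rp; apply: (le_integrable (mB x r) _ _ (Iu x r rp)).
      by apply: measurable_funTS; exact/measurable_EFinP.
    by move=> y _ /=; exact: fine_norm_le.
- by apply: (le_total_energy GLp); apply/ltW/(poweR_root_lt p_gt0 k0); rewrite -GN.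
- apply: le_trans (ltW Ek); rewrite EN.
  have [mL _] := ubar.
  have preciseE x : precise mu (fine \o u) x = fine (limsup_average mu u x) by rewrite limE.
  under eq_integral do rewrite preciseE.
  apply: ge0_le_integral => //.
  - apply/measurable_EFinP; apply: (measurableT_comp (@normr_measurable R setT)).
    exact: (measurableT_comp (fine_measurable measurableT) mL).
  - exact: (measurableT_comp (@abse_measurable R setT) mL).
  - by move=> y _; exact: fine_norm_le.
Qed.

End reduction.

(** Letting k decrease to N avoids dividing by the norm, which may be 0. *)
Lemma poweR_le_homogeneous {R : realType} (q M N : R) (a : \bar R) : (0 < q)%R -> (0 < M)%R ->
  (0 <= N)%R -> 0 <= a -> (forall k : R, (N < k)%R -> a <= (M * k `^ q)%:E) ->
  a `^ q^-1 <= (M `^ q^-1)%:E * N%:E.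
Proof.
move=> q0 M0 N0 a0 H; rewrite -EFinM; apply/lee_addgt0Pr => e e0.
have Mq : (0 < M `^ q^-1)%R by exact: powR_gt0.
pose k := (N + e / M `^ q^-1)%R.
have Nk : (N < k)%R by rewrite ltrDl divr_gt0.
have k0 : (0 <= k)%R by apply: le_trans (ltW Nk).
apply: (@le_trans _ _ ((M * k `^ q)%:E `^ q^-1)).
  by apply: lee_poweR; [rewrite invr_ge0 ltW|exact: a0|exact: H].
rewrite poweR_EFin powRM ?powR_ge0 ?(ltW M0)// -powRrM mulfV ?gt_eqF// powRr1//.
by rewrite -EFinD lee_fin /k mulrDr lerD2l mulrCA mulfV ?mulr1// gt_eqF.
Qed.

(** * Estimates in L^q and boundedness *)

Section embedding.
Context {R : realType} {X : pmetricType R} {Smu Snu : set (set X)}.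
Variable mu : {measure set (g_sigma_algebraType Smu) -> \bar R}.
Variable nu : {measure set (g_sigma_algebraType Snu) -> \bar R}.
Hypotheses (hmu : complete_borel_measure mu) (hnu : complete_borel_measure nu).
Variables (E : set X) (r0 K delta : R).
Hypothesis geo : geometry mu nu E r0 K delta.
Hypothesis tbE : totally_bounded E.
Hypothesis mE : Snu E.
Variables (p q : R) (p_ge1 : (1 <= p)%R) (lt_pq : (p < q)%R).

Local Notation XS := (g_sigma_algebraType Smu).
Local Notation XN := (g_sigma_algebraType Snu).
Local Notation B x r := (ball x r : set XS).
Local Notation muB := (muB mu).
Local Notation nuB := (nuB nu).
Local Notation precise := (precise mu).

Let p_gt0 : (0 < p)%R. Proof. exact: lt_le_trans p_ge1. Qed.
Let q_gt0 : (0 < q)%R. Proof. exact: lt_trans lt_pq. Qed.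
Let r0_gt0 : (0 < r0)%R. Proof. exact: geo_r0 geo. Qed.
Let mEN : measurable (E : set XN). Proof. exact: S_measurable. Qed.

Lemma ratioE x r : E x -> (0 < r)%R -> (r <= 2 * r0)%R ->
  r%:E * nu (ball x r) `^ q^-1 / mu (ball x r) `^ p^-1 =
  (r * nuB x r `^ q^-1 / muB x r `^ p^-1)%:E.
Proof.
move=> Ex rp rr; rewrite (nuBE geo)// (muBE geo)// !poweR_EFin inver gt_eqF//.
by rewrite powR_gt0// (muB_gt0 geo).
Qed.

Lemma sup_ratio_bound (A r : R) x : E x -> (0 < r)%R -> (r <= 2 * r0)%R ->
  sup_ratio mu nu E p q r <= A%:E ->
  (r * nuB x r `^ q^-1 <= A * muB x r `^ p^-1)%R.
Proof.
move=> Ex rp rr supA; rewrite -ler_pdivrMr ?powR_gt0 ?(muB_gt0 geo)//.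
rewrite -lee_fin -ratioE//; apply: le_trans supA.
by apply: ereal_sup_ubound; exists x.
Qed.

Lemma ratio_bound_le (A s s' : R) : (s' <= s)%R -> ratio_bound mu nu E p q A s ->
  ratio_bound mu nu E p q A s'.
Proof. by move=> ss H x r Ex rp rs; apply: H => //; exact: le_trans ss. Qed.

Lemma bounded_ratio :
  ereal_sup [set sup_ratio mu nu E p q r | r in `]0%R, r0[] < +oo ->
  exists2 A : R, (0 < A)%R & ratio_bound mu nu E p q A (r0 / 2).
Proof.
set S := ereal_sup _ => Soo.
exists (Num.max 1 (fine S))%R; first by rewrite lt_max ltr01.
move=> x r Ex rp rr; apply: sup_ratio_bound => //; first by have := r0_gt0; lra.
apply: (@le_trans _ _ S).
  by apply: ereal_sup_ubound; exists r => //=; rewrite in_itv /= rp; have := r0_gt0; lra.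
move: Soo; case: (S) => [s| |] //= _; last by rewrite leNye.
by rewrite lee_fin le_max lexx orbT.
Qed.

Lemma vanishing_ratio : sup_ratio mu nu E p q r @[r --> 0^'+] --> 0 ->
  forall A, (0 < A)%R -> exists2 s : R, (0 < s)%R & ratio_bound mu nu E p q A s.
Proof.
move=> cvg0 A A0.
have : \forall r \near (0%R : R)^'+, sup_ratio mu nu E p q r < A%:E.
  by apply: (cvg0 [set y | y < A%:E]); apply: open_nbhs_nbhs; split; [exact: open_ereal_lt_ereal|rewrite /= lte_fin].
move=> [d /= d0 Hd]; exists (Num.min (d / 2) (2 * r0))%R.
  by rewrite lt_min divr_gt0 ?mulr_gt0.
move=> x r Ex rp; rewrite le_min => /andP[rd rr].
apply: sup_ratio_bound => //; apply/ltW/Hd => //=.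
by rewrite sub0r normrN gtr0_norm//; move: rd d0; rewrite /ball_/=; lra.
Qed.

Lemma measurable_level (F : X -> R) (e : R) : measurable_fun (E : set XN) (F : XN -> R) ->
  measurable (E `&` [set x | (e < `|F x|)%R] : set XN).
Proof.
move=> mF.
have -> : E `&` [set x | (e < `|F x|)%R] = E `&` (fun x => `|F x|)%R @^-1` `]e, +oo[%classic.
  by congr (_ `&` _); apply/seteqP; split=> x /=; rewrite in_itv /= andbT.
by apply: (measurableT_comp (@normr_measurable R setT) mF).
Qed.

Lemma measurable_norm_powR (F : X -> R) : measurable_fun (E : set XN) (F : XN -> R) ->
  measurable_fun (E : set XN) (fun x : XN => (`|F x| `^ q)%:E).
Proof.
move=> mF; apply/measurable_EFinP; apply: (measurableT_comp (measurable_powR q)).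
exact: (measurableT_comp (@normr_measurable R setT)).
Qed.

Lemma limsup_average_precise f (Z : set X) : measurable (Z : set XN) -> nu Z = 0 ->
  (forall x, E x -> ~ Z x -> limsup_average mu (EFin \o f) x = (precise f x)%:E) ->
  {ae nu, forall x : XN, E x -> limsup_average mu (EFin \o f) x = (precise f x)%:E}.
Proof.
move=> mZ nZ H; exists Z; split => // x /= nx; apply: contrapT => nZx; apply: nx => Ex.
exact: H.
Qed.

Section scale.
Variables (C lam R0 A : R).
Hypothesis poin : poincare_const mu E r0 p C lam.
Hypotheses (R0_gt0 : (0 < R0)%R) (R0_le : (4 * (lam * R0) <= r0)%R) (A_gt0 : (0 < A)%R).
Hypothesis ratio : ratio_bound mu nu E p q A (lam * R0).

Let W := (weak_const K delta p q C)%R.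
Let S := (strong_const K delta p q C)%R.

Let energy_powR loc f G k : (0 < k)%R -> norm_le mu nu E p loc f G k ->
  (total_energy mu p G `^ (q / p) <= k `^ q)%R.
Proof.
move=> k0 [_ Tk _].
apply: (le_trans (ler_powR2 _ (total_energy_ge0 _ _ _) Tk)); first by rewrite divr_ge0 ?ltW.
by rewrite -powRrM mulrCA mulfV ?gt_eqF// mulr1.
Qed.

(** E is split according to |ubar| <= e, e < |ubar| <= 8 Cc k, and larger values. Only the last part
    needs the strong type estimate and carries A^q; the middle part is bounded and left to an
    estimate of its measure. *)
Lemma Lq_estimate : exists2 Cc : R, (0 < Cc)%R & forall loc f G k e,
  (0 < k)%R -> (0 < e)%R -> norm_le mu nu E p loc f G k ->
  \int[nu]_(x in (E : set XN)) (`|precise f x| `^ q)%:E <=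
  (e `^ q)%:E * nu E + (Cc * k `^ q)%:E * nu (E `&` [set x | (e < `|precise f x|)%R]) +
  (S * A `^ q * k `^ q)%:E.
Proof.
have [Cc Cc0 HC] := control hmu hnu geo tbE mE p_ge1 lt_pq poin R0_gt0 R0_le A_gt0 ratio.
exists ((8 * Cc) `^ q)%R; first by apply: powR_gt0; rewrite mulr_gt0.
move=> loc f G k e k0 e0 nk; have [af Tk _] := nk.
have Tq := energy_powR k0 nk.
have [Z1 [mZ1 nZ1 H1]] := HC loc f G k k0 nk.
have [_ [Z2 [mZ2 nZ2 H2]]] := precise_lebesgue hmu hnu geo tbE mE p_ge1 lt_pq poin R0_gt0 R0_le A_gt0 ratio af.
have mr := measurable_precise hmu hnu geo tbE mE p_ge1 lt_pq poin R0_gt0 R0_le A_gt0 ratio af.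
have H0 : (0 < Cc * k)%R by rewrite mulr_gt0.
have [|x Ex nZ|h [mh h_ge0 hint hF]] := @strong_type _ _ _ _ mu nu hmu hnu E r0 K delta geo tbE p q p_ge1 lt_pq C lam R0 A
   poin R0_gt0 R0_le A_gt0 ratio loc f G (precise f) (Z1 `|` Z2) (Cc * k)%R af H0.
- by move=> x Ex nZ; have [] := H2 x Ex (fun h => nZ (or_intror h)).
- by apply: H1 => // h; apply: nZ; left.
set D := E `&` _.
have mD : measurable (D : set XN).
  exact: measurable_level mr.
have mF := measurable_norm_powR mr.
have c0 : (0 <= (8 * Cc) `^ q * k `^ q)%R by rewrite mulr_ge0 ?powR_ge0.
have mI : measurable_fun (E : set XN) (fun x : XN => ((8 * Cc) `^ q * k `^ q)%:E * (\1_D x)%:E).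
  by apply: measurable_funeM; apply/measurable_EFinP; exact: measurable_indic.
have mh' : measurable_fun (E : set XN) (h : XN -> \bar R) by exact: measurable_funTS.
have I0 (x : XN) : 0 <= ((8 * Cc) `^ q * k `^ q)%:E * (\1_D x)%:E.
  by rewrite -EFinM lee_fin mulr_ge0.
apply: (@le_trans _ _ (\int[nu]_(x in (E : set XN))
   ((e `^ q)%:E + ((8 * Cc) `^ q * k `^ q)%:E * (\1_D x)%:E + h x))).
  apply: ae_ge0_le_integral => //.
  - by move=> x _; rewrite !adde_ge0// lee_fin powR_ge0.
  - by apply: emeasurable_funD => //; apply: emeasurable_funD.
  exists (Z1 `|` Z2); split; [exact: measurableU|by rewrite measureU0|].
  move=> x /= nx; apply: contrapT => nZ; apply: nx => Ex.
  have [big|small] := ltP (8 * (Cc * k))%R `|precise f x|%R.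
    by apply: (le_trans (hF x Ex nZ big)); rewrite leeDr// adde_ge0// lee_fin powR_ge0.
  have [xe|ex] := leP `|precise f x|%R e.
    apply: (@le_trans _ _ (e `^ q)%:E); first by rewrite lee_fin ler_powR2// ltW.
    by rewrite -addeA leeDl// adde_ge0.
  apply: le_trans (leeDl _ (h_ge0 x)); apply: le_trans (leeDr _ _); last by rewrite lee_fin powR_ge0.
  rewrite indicE mem_set// mule1 lee_fin.
  rewrite -powRM ?mulr_ge0 ?(ltW Cc0) ?(ltW k0)// ler_powR2 ?(ltW q_gt0)//.
  by rewrite -mulrA.
rewrite ge0_integralD//; last 2 first.
- by move=> x _; rewrite adde_ge0// lee_fin powR_ge0.
- exact: emeasurable_funD.
rewrite ge0_integralD//; last by move=> x _; rewrite lee_fin powR_ge0.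
rewrite integral_cst// ge0_integralZl_EFin//; last by apply/measurable_EFinP; exact: measurable_indic.
rewrite integral_indic// (_ : D `&` E = D); last by apply/setIidPl => x [].
apply: leeD => //.
apply: (@le_trans _ _ (\int[nu]_x h x)); first exact: ge0_subset_integral.
apply: (le_trans hint); rewrite lee_fin ler_wpM2l// mulr_ge0 ?powR_ge0//.
by rewrite /S /strong_const mulr_ge0 ?powR_ge0 ?(weak_const_ge0 geo).
Qed.

(** If the averages at the net points are at most e/2, then |ubar| > e forces a deviation above e/2
    from one of them, which is the weak type event. *)
Lemma level_estimate loc f G k e (F : seq X) (N : set X) : (0 < k)%R -> (0 < e)%R ->
  norm_le mu nu E p loc f G k -> measurable (N : set XN) -> nu N = 0 ->
  (forall z, z \in F -> E z) ->
  (forall x, E x -> ~ N x -> exists2 z, z \in F & ball z (R0 / 4) x) ->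
  (forall z, z \in F -> `|avg mu (B z (R0 / 2)) f| <= e / 2)%R ->
  nu (E `&` [set x | (e < `|precise f x|)%R]) <= (W * A `^ q * k `^ q * (e / 2) `^ (- q))%:E.
Proof.
move=> k0 e0 nk mN nN FE Fcov Favg; have [af Tk _] := nk.
have e20 : (0 < e / 2)%R by rewrite divr_gt0.
have [V [mV nV HV]] := weak_type hmu hnu geo tbE p_ge1 lt_pq poin R0_gt0 R0_le A_gt0 ratio af e20.
have [_ [Z [mZ nZ HZ]]] := precise_lebesgue hmu hnu geo tbE mE p_ge1 lt_pq poin R0_gt0 R0_le A_gt0 ratio af.
have mr := measurable_precise hmu hnu geo tbE mE p_ge1 lt_pq poin R0_gt0 R0_le A_gt0 ratio af.
set D := E `&` _.
have mD : measurable (D : set XN).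
  exact: measurable_level mr.
apply: (@le_trans _ _ (nu (V `|` (Z `|` N)))).
  apply: le_measure; rewrite ?inE//; first by apply: measurableU => //; exact: measurableU.
  move=> x [Ex /= ex]; apply: contrapT => nVZ.
  have [Lb _] := HZ x Ex (fun Zx => nVZ (or_intror (or_introl Zx))).
  have [z zF zx] := Fcov x Ex (fun Nx => nVZ (or_intror (or_intror Nx))).
  have [_ /(_ z (FE z zF))] := HV x _ Ex (fun Vx => nVZ (or_introl Vx)) Lb.
  have {}zx : (mdist x z < R0 / 4)%R by move: zx; rewrite ballEmdist /= metric_sym.
  move=> /(_ zx) h; move: ex; rewrite ltNge => /negP; apply.
  rewrite -[precise f x](subrK (avg mu (B z (R0 / 2)) f)).
  by apply: (le_trans (ler_normD _ _)); rewrite (splitr e) lerD// Favg.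
rewrite measureU0//; [|exact: measurableU|by rewrite measureU0].
apply: (le_trans nV); rewrite lee_fin ler_wpM2r ?powR_ge0//.
rewrite ler_wpM2l ?(energy_powR k0 nk)// mulr_ge0 ?powR_ge0//.
exact: (weak_const_ge0 geo).
Qed.

Lemma bounded_of_reduces loc (Y : @function_space R X) :
  reduces mu nu E p loc Y -> bounded_embedding mu nu Y E q.
Proof.
move=> redY; have [Cc Cc0 HC] := Lq_estimate.
have nEoo := nu_E_lty hnu geo tbE mE.
have nE : nu E = (fine (nu E))%:E by rewrite fineK// ge0_fin_numE.
pose M := (fine (nu E) + Cc * fine (nu E) + S * A `^ q + 1)%R.
have S0 : (0 <= S * A `^ q)%R.
  exact: (mulr_ge0 (mulr_ge0 (powR_ge0 _ _) (weak_const_ge0 geo _ _ _)) (powR_ge0 _ _)).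
have n0 : (0 <= fine (nu E))%R by exact: fine_ge0.
have M0 : (0 < M)%R by rewrite ltr_wpDl// !addr_ge0// mulr_ge0// ltW.
exists (M `^ q^-1)%R; first exact: powR_gt0.
move=> u Yu; have [limE /andP[norm0 normoo] red] := redY u Yu.
set f := fine \o u in limE red.
have intE (k : R) : (0 < k)%R -> fs_norm Y u < k%:E ->
    [/\ measurable_fun (E : set XN) (limsup_average mu u : XN -> \bar R) &
     \int[nu]_(x in (E : set XN)) (`|limsup_average mu u x| `^ q) <= (M * k `^ q)%:E].
  move=> k0 uk; have [G nk] := red k k0 uk; have [af _ _] := nk.
  have [mL [Z [mZ nZ HZ]]] := precise_lebesgue hmu hnu geo tbE mE p_ge1 lt_pq poin R0_gt0 R0_le A_gt0 ratio af.
  rewrite limE; split; first exact: mL.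
  have aeL := limsup_average_precise mZ nZ (fun x Ex nx => (HZ x Ex nx).2).
  rewrite (_ : \int[nu]_(x in _) _ = \int[nu]_(x in (E : set XN)) (`|precise f x| `^ q)%:E); last first.
    apply: ae_eq_integral; first exact: mEN.
    - apply: (measurableT_comp (measurable_poweR q)).
      exact: (measurableT_comp (@abse_measurable R setT) mL).
    - exact: (measurable_norm_powR (measurableT_comp (fine_measurable measurableT) mL)).
    by apply: filterS aeL => x Hx Ex; rewrite Hx.
  (* With e = k all three parts are homogeneous of degree q in k; the level set is bounded by E,
     which has finite measure. *)
  apply: (le_trans (HC loc f G k k k0 k0 nk)).
  apply: (@le_trans _ _ ((k `^ q)%:E * nu E + (Cc * k `^ q)%:E * nu E + (S * A `^ q * k `^ q)%:E)).
    apply: leeD2r; apply: leeD2l; apply: lee_wpmul2l.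
      by rewrite lee_fin (mulr_ge0 (ltW Cc0) (powR_ge0 _ _)).
    apply: le_measure; [| |exact: subIsetl]; rewrite inE; last exact: mEN.
    exact: (measurable_level _ (measurableT_comp (fine_measurable measurableT) mL)).
  rewrite nE -!EFinM -!EFinD lee_fin /M !mulrDl mul1r.
  rewrite (mulrC (k `^ q)%R) -!mulrA (mulrC (k `^ q)%R (fine _)) lerDl powR_ge0//.
pose N := fine (fs_norm Y u); have N0 : (0 <= N)%R by exact: fine_ge0.
have normE : fs_norm Y u = N%:E by rewrite fineK// ge0_fin_numE.
clearbody N; rewrite normE in intE *.
have [mL Loo] := intE (N + 1)%R (ltr_wpDl N0 ltr01) (ltac:(by rewrite lte_fin ltrDl)).
split; first by apply/(in_LpP nu _ q_gt0 mEN); split; [exact: mL|exact: le_lt_trans Loo (ltry _)].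
rewrite (LpnormE _ _ q_gt0 mEN); apply: (poweR_le_homogeneous q_gt0 M0 N0).
  by apply: integral_ge0 => x _; exact: poweR_ge0.
by move=> k Nk; have [] := intE k (le_lt_trans N0 Nk) Nk.
Qed.

End scale.
End embedding.

(* All bounded real sequences converge along one free ultrafilter; this replaces
   the successive extraction of subsequences. *)
Section ultrafilters.
Context {R : realType}.
Variable U : set_system nat.
Hypotheses (UU : UltraFilter U) (Uoo : \oo `<=` U).
Let PU : ProperFilter U. Proof. exact: ultra_proper. Qed.
Local Existing Instance PU.

Lemma ultra_bounded_limit (a : nat -> R) (M : R) : (forall n, `|a n| <= M)%R ->
  exists g : R, forall e, (0 < e)%R -> U [set n | (`|a n - g| <= e)%R].
Proof.
move=> aM; have aB : (a @ U) `[(- M)%R, M]%classic.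
  by apply: (@filterS _ U _ setT) filterT => n _; rewrite /= in_itv /= -ler_norml aM.
have [g [_ Cg]] := @segment_compact R (- M) M (a @ U) _ aB.
exists g => e e0; have [//|nU] := in_ultra_setVsetC [set n | (`|a n - g| <= e)%R] UU.
have nU' : (a @ U) [set t | (e < `|t - g|)%R].
  by apply: (@filterS _ U) nU => n /= /negP; rewrite -ltNge.
have [t [/= te]] := Cg _ _ nU' (nbhsx_ballx g e e0).
by rewrite -ball_normE /= distrC => /(lt_trans te); rewrite ltxx.
Qed.

Lemma filter_forall_seq (T : eqType) (s : seq T) (P : T -> set nat) :
  (forall z, z \in s -> U (P z)) -> U [set n | forall z, z \in s -> P z n].
Proof.
elim: s => [_|y s IH H]; first by apply: filterS filterT.
have Us : U [set n | forall z, z \in s -> P z n].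
  by apply: IH => z zs; apply: H; rewrite in_cons zs orbT.
apply: filterS (filterI (H y (mem_head _ _)) Us) => n [Py Ps] z.
by rewrite in_cons => /predU1P[->//|]; exact: Ps.
Qed.

(** Back from the ultrafilter to a sequence: finite intersections of the [S i] belong to [U], and as
    [U] is free they contain arbitrarily large indices. *)
Lemma ultra_subsequence (S : nat -> set nat) : (forall k, U (S k)) ->
  exists phi : nat -> nat, {homo phi : m n / (m < n)%N} /\
    forall i k, (i <= k)%N -> S i (phi k).
Proof.
move=> US; have UT k : U [set n | forall i, (i <= k)%N -> S i n].
  have := @filter_forall_seq _ (iota 0 k.+1) S (fun i _ => US i).
  by apply: filterS => n H i ik; apply: H; rewrite mem_iota.
have /choice[h Hh] (mk : nat * nat) :
    exists n, (mk.1 < n)%N /\ forall i, (i <= mk.2)%N -> S i n.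
  have Um : U [set n | (mk.1 < n)%N] by apply: Uoo; exact: nbhs_infty_gt.
  by have [n [? ?]] := filter_ex (filterI Um (UT mk.2)); exists n.
pose phi := fix phi k := if k is k'.+1 then h (phi k', k) else h (0%N, 0%N).
exists phi; split.
  apply: homo_ltn; first exact: ltn_trans.
  by move=> k; have [] := Hh (phi k, k.+1).
move=> i [|k] ik; first by have [_] := Hh (0%N, 0%N); apply.
by have [_] := Hh (phi k, k.+1); apply.
Qed.

End ultrafilters.

(** * Completeness of L^q *)

Section Lq_complete.
Context d (T : measurableType d) (R : realType).
Variable nu : {measure set T -> \bar R}.
Variables (E : set T) (mE : measurable E) (q : R) (q_gt0 : (0 < q)%R).
Variable F : nat -> T -> R.
Hypothesis mF : forall n, measurable_fun E (F n).

Let c : R := 2^-1.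
Let c0 : (0 < c)%R. Proof. by rewrite invr_gt0. Qed.
Let c1 : (c < 1)%R. Proof. by rewrite invf_lt1// ltr1n. Qed.
Let cn n : (0 < c ^+ n)%R. Proof. by rewrite exprn_gt0. Qed.

Hypothesis dF : forall n, \int[nu]_(x in E) (`|F n.+1 x - F n x| `^ q)%:E <=
  (((2^-1) ^+ n) `^ q * (2^-1) ^+ n)%:E.

(** The increments, weighted by 2^(nq), still have integrals at most 2^-n. Where their sum h is
    finite, |F_(n+1) - F_n| <= h^(1/q) 2^-n. *)
Let t n x : \bar R := ((((c ^+ n) `^ q)^-1)%:E * (`|F n.+1 x - F n x| `^ q)%:E).

Let h x := \sum_(0 <= n <oo) t n x.

Let t_ge0 n x : 0 <= t n x.
Proof. by rewrite /t -EFinM lee_fin mulr_ge0 ?invr_ge0 ?powR_ge0. Qed.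

Let mdiff n : measurable_fun E (fun x => (`|F n.+1 x - F n x| `^ q)%:E).
Proof.
apply/measurable_EFinP; apply: (measurableT_comp (measurable_powR q)).
by apply: (measurableT_comp (@normr_measurable R setT)); exact: measurable_funB.
Qed.

Let mt n : measurable_fun E (t n).
Proof. exact: measurable_funeM. Qed.

Let mh : measurable_fun E h.
Proof.
have := @ge0_emeasurable_sum _ T R E t xpredT (fun n x _ _ => t_ge0 n x) (fun n _ => mt n).
by apply: eq_measurable_fun => x _; apply: eq_eseriesl.
Qed.

Let h_ge0 x : 0 <= h x. Proof. exact: nneseries_ge0. Qed.

Let int_h : \int[nu]_(x in E) h x <= 2%:E.
Proof.
rewrite integral_nneseries//; apply: nneseries_le_fin => [n|J]; first exact: integral_ge0.
apply: (@le_trans _ _ (\sum_(0 <= n < J) (c ^+ n)%:E)).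
  apply: lee_sum => n _; rewrite ge0_integralZl_EFin//; last by rewrite invr_ge0 powR_ge0.
  apply: (@le_trans _ _ ((((c ^+ n) `^ q)^-1)%:E * ((c ^+ n) `^ q * c ^+ n)%:E)).
    by apply: lee_wpmul2l; [rewrite lee_fin invr_ge0 powR_ge0|exact: dF].
  by rewrite -EFinM lee_fin mulrA mulVf ?mul1r// gt_eqF// powR_gt0.
rewrite sumEFin lee_fin big_mkord; apply: (le_trans (sum_geometric_le _ _)).
  by rewrite (ltW c0).
by apply: eq_ler; rewrite /c; field.
Qed.

Let step x n : h x \is a fin_num ->
  (`|F n.+1 x - F n x| <= fine (h x) `^ q^-1 * c ^+ n)%R.
Proof.
move=> hfin; have th : t n x <= h x.
  apply: le_trans (nneseries_lim_ge n.+1 _) => //.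
  by rewrite big_nat_recr//= leeDr// sume_ge0.
have : (`|F n.+1 x - F n x| `^ q <= fine (h x) * (c ^+ n) `^ q)%R.
  move: th; rewrite -(fineK hfin) /t -EFinM lee_fin mulrC.
  by rewrite ler_pdivrMr// powR_gt0.
move=> H; have := ler_powR2 (ltW (ltac:(by rewrite invr_gt0) : (0 < q^-1)%R)) (powR_ge0 _ _) H.
rewrite powRM ?fine_ge0 ?powR_ge0// -!powRrM mulfV ?gt_eqF// !powRr1//.
exact: ltW.
Qed.

Let steps x n j : h x \is a fin_num ->
  (`|F (n + j)%N x - F n x| <= fine (h x) `^ q^-1 * (2 * c ^+ n))%R.
Proof.
move=> hfin; apply: (@le_trans _ _ (fine (h x) `^ q^-1 * (c ^+ n * \sum_(i < j) c ^+ i))%R).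
  elim: j => [|j IH]; first by rewrite addn0 subrr normr0 big_ord0 !mulr0.
  rewrite big_ord_recr /= !mulrDr addnS -(subrKA (F (n + j)%N x)) addrC.
  apply: (le_trans (ler_normD _ _)); apply: lerD => //.
  by apply: (le_trans (step _ hfin)); rewrite exprD.
rewrite ler_wpM2l ?powR_ge0// mulrC ler_wpM2r ?(ltW (cn n))//.
apply: (le_trans (sum_geometric_le _ _)); first by rewrite (ltW c0).
by apply: eq_ler; rewrite /c; field.
Qed.

(** Where h is finite the increments sum geometrically, so F_n converges and |F_n - v| <= 2 h^(1/q)
    2^-n; the rate in L^q follows from the integral of h. *)
Lemma Lq_complete : exists v : T -> R, measurable_fun E v /\
  forall n, \int[nu]_(x in E) (`|F n x - v x| `^ q)%:E <= ((2 * (2^-1) ^+ n) `^ q * 2)%:E.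
Proof.
have ih : nu.-integrable E h.
  apply/integrableP; split => //; under eq_integral do rewrite gee0_abs//.
  exact: le_lt_trans int_h (ltry _).
have [Z [mZ nZ HZ]] := integrable_ae mE ih.
have hfin x : E x -> ~ Z x -> h x \is a fin_num.
  by move=> Ex nZx; apply: contrapT => nh; apply: nZx; apply: HZ => /= /(_ Ex).
pose D := E `\` Z; have mD : measurable D by exact: measurableD.
have Fcvg x : D x -> cvgn (F ^~ x).
  move=> [Ex nZx]; have hx := hfin x Ex nZx.
  apply: cauchy_cvg; apply: cauchy_exP => e e0.
  pose s := (fine (h x) `^ q^-1)%R.
  have s0 : (0 <= s)%R by exact: powR_ge0.
  have es : (0 < e / (s * 2 + 1))%R by rewrite divr_gt0// ltr_wpDl// mulr_ge0.
  have : (fun n => c ^+ n)%R @ \oo --> (0 : R)%R by apply: cvg_expr; rewrite gtr0_norm.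
  move=> /cvgrPdist_lt /(_ _ es) [n _ /(_ n (leqnn n))].
  rewrite sub0r normrN gtr0_norm// ltr_pdivlMr ?ltr_wpDl ?mulr_ge0// => ne.
  exists (F n x); exists n => // m /= nm; rewrite -ball_normE /= distrC -(subnKC nm).
  apply: (le_lt_trans (steps _ _ hx)); apply: le_lt_trans ne.
  by rewrite -/s mulrA (mulrC (c ^+ n)%R) ler_wpM2r ?(ltW (cn n))// lerDl.
pose v := (fun x => lim (F n x @[n --> \oo])) \_ D.
have vE x : D x -> F n x @[n --> \oo] --> v x by move=> Dx; rewrite /v patchE mem_set//; exact: Fcvg.
have mv : measurable_fun setT v.
  apply/(measurable_restrictT _ _).1 => //.
  apply: (@measurable_fun_cvg _ _ _ _ F) => [n|x Dx]; last exact: Fcvg.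
  by apply: measurable_funS (mF n) => // x [].
exists v; split; first exact: measurable_funTS.
move=> n; have mFv : measurable_fun E (fun x => (`|F n x - v x| `^ q)%:E).
  apply/measurable_EFinP; apply: (measurableT_comp (measurable_powR q)).
  apply: (measurableT_comp (@normr_measurable R setT)); apply: measurable_funB => //.
  exact: measurable_funTS.
have k0 : (0 <= (2 * c ^+ n) `^ q)%R by exact: powR_ge0.
apply: (@le_trans _ _ (\int[nu]_(x in E) (((2 * c ^+ n) `^ q)%:E * h x))).
  apply: ae_ge0_le_integral => //.
  - by move=> x _; rewrite mule_ge0.
  - exact: measurable_funeM.
  exists Z; split => // x /= nx; apply: contrapT => nZx; apply: nx => Ex.
  have hx := hfin x Ex nZx; rewrite -(fineK hx) -EFinM lee_fin.
  have : (`|F n x - v x| <= fine (h x) `^ q^-1 * (2 * c ^+ n))%R.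
    apply/ler_addgt0Pr => e e0.
    have /cvgrPdist_le/(_ e e0)[m0 _ Hm] := vE x (conj Ex nZx).
    have := Hm (n + m0)%N (leq_addl _ _) => h1; have h2 := steps n m0 hx.
    rewrite distrC -(subrKA (F (n + m0)%N x)); apply: (le_trans (ler_normD _ _)).
    by rewrite addrC lerD.
  move=> H; apply: (le_trans (ler_powR2 (ltW q_gt0) (normr_ge0 _) H)).
  rewrite powRM ?powR_ge0 ?mulr_ge0 ?(ltW (cn n))// -powRrM mulVf ?gt_eqF// powRr1 ?fine_ge0//.
  by rewrite mulrC.
rewrite ge0_integralZl_EFin// EFinM.
by apply: lee_wpmul2l; rewrite ?lee_fin.
Qed.

End Lq_complete.

Lemma powRD_le {R : realType} (p a b : R) : (0 <= p)%R -> (0 <= a)%R -> (0 <= b)%R ->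
  ((a + b) `^ p <= 2 `^ p * (a `^ p + b `^ p))%R.
Proof.
move=> p0 a0 b0; wlog ab : a b a0 b0 / (a <= b)%R.
  move=> H; have [/H|/ltW/H] := leP a b; first exact.
  by rewrite addrC (addrC (b `^ p)%R); apply.
apply: (@le_trans _ _ ((2 * b) `^ p)%R).
  by apply: ler_powR2 => //; [rewrite addr_ge0|lra].
by rewrite powRM// ler_wpM2l ?powR_ge0// lerDr powR_ge0.
Qed.

Lemma poweRD_le {R : realType} (p : R) (a b : \bar R) : (0 < p)%R -> 0 <= a -> 0 <= b ->
  (a + b) `^ p <= (2 `^ p)%:E * (a `^ p + b `^ p).
Proof.
move=> p0; case: a => [a| |] //; case: b => [b| |] // a0 b0.
- by rewrite -EFinD !poweR_EFin -EFinD -EFinM lee_fin powRD_le// ltW.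
all: by rewrite ?addey ?addye// poweRyr ?gt_eqF// ?addey ?addye ?poweR_EFin// gt0_muley
  ?lte_fin ?powR_gt0// ?leey.
Qed.

Lemma powRB_le {R : realType} (p a b : R) : (0 <= p)%R ->
  (`|a - b| `^ p <= 2 `^ p * (`|a| `^ p + `|b| `^ p))%R.
Proof.
move=> p0; apply: le_trans (powRD_le p0 (normr_ge0 _) (normr_ge0 _)).
by apply: ler_powR2 => //; exact: ler_normB.
Qed.

Lemma ge0_le_integralZD d (T : measurableType d) {R : realType} (mu : {measure set T -> \bar R})
  (D : set T) (c : R) (f g h : T -> \bar R) : measurable D -> (0 <= c)%R ->
  measurable_fun D f -> measurable_fun D g -> measurable_fun D h ->
  (forall x, D x -> 0 <= f x) -> (forall x, D x -> 0 <= g x) -> (forall x, D x -> 0 <= h x) ->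
  (forall x, D x -> h x <= c%:E * (f x + g x)) ->
  \int[mu]_(x in D) h x <= c%:E * (\int[mu]_(x in D) f x + \int[mu]_(x in D) g x).
Proof.
move=> mD c0 mf mg mh f0 g0 h0 H.
have mfg : measurable_fun D (fun x => f x + g x) by exact: emeasurable_funD.
have fg0 x : D x -> 0 <= f x + g x by move=> Dx; rewrite adde_ge0 ?f0 ?g0.
rewrite -ge0_integralD// -ge0_integralZl_EFin//; apply: ge0_le_integral => //.
exact: measurable_funeM.
Qed.

(** * Differences of admissible functions *)

Section compactness.
Context {R : realType} {X : pmetricType R} {Smu Snu : set (set X)}.
Variable mu : {measure set (g_sigma_algebraType Smu) -> \bar R}.
Variable nu : {measure set (g_sigma_algebraType Snu) -> \bar R}.
Hypotheses (hmu : complete_borel_measure mu) (hnu : complete_borel_measure nu).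
Variables (E : set X) (r0 K delta : R).
Hypothesis geo : geometry mu nu E r0 K delta.
Hypothesis tbE : totally_bounded E.
Hypothesis mE : Snu E.
Variables (p q : R) (p_ge1 : (1 <= p)%R) (lt_pq : (p < q)%R).
Variables (C lam : R).
Hypothesis poin : poincare_const mu E r0 p C lam.
Hypothesis vanish : forall A, (0 < A)%R -> exists2 s : R, (0 < s)%R & ratio_bound mu nu E p q A s.

Local Notation XS := (g_sigma_algebraType Smu).
Local Notation XN := (g_sigma_algebraType Snu).
Local Notation B x r := (ball x r : set XS).
Local Notation precise := (precise mu).
Local Notation norm_le := (norm_le mu nu E p).

Let p_gt0 : (0 < p)%R. Proof. exact: lt_le_trans p_ge1. Qed.
Let q_gt0 : (0 < q)%R. Proof. exact: lt_trans lt_pq. Qed.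
Let r0_gt0 : (0 < r0)%R. Proof. exact: geo_r0 geo. Qed.
Let mEN : measurable (E : set XN). Proof. exact: S_measurable. Qed.
Let lam_gt0 : (0 < lam)%R. Proof. by case: poin => _ h _; exact: lt_le_trans h. Qed.

Lemma exists_scale A : (0 < A)%R -> exists R0, [/\ (0 < R0)%R, (4 * (lam * R0) <= r0)%R &
  ratio_bound mu nu E p q A (lam * R0)].
Proof.
move=> A0; have [s s0 Hs] := vanish A0.
exists (Num.min s (r0 / 4) / lam)%R.
have e : (lam * (Num.min s (r0 / 4) / lam) = Num.min s (r0 / 4))%R.
  by rewrite mulrCA mulfV ?mulr1// gt_eqF.
rewrite e; split.
- by rewrite divr_gt0// lt_min s0 divr_gt0.
- by rewrite mulrC -ler_pdivlMr// ge_min lexx orbT.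
- by apply: ratio_bound_le Hs; rewrite ge_min lexx.
Qed.

Lemma admissible_sub loc f G f' G' : admissible mu p loc f G -> admissible mu p loc f' G' ->
  admissible mu p loc (fun x => f x - f' x)%R (fun x => G x + G' x).
Proof.
move=> [mf bf ug GLp] [mf' bf' ug' GLp'].
have [bG G0 Goo] := GLp; have [bG' G0' Goo'] := GLp'.
have mp (k : X -> R) : measurable_fun setT (k : XS -> R) ->
    measurable_fun setT (fun y : XS => (`|k y| `^ p)%:E).
  move=> mk; apply/measurable_EFinP; apply: (measurableT_comp (measurable_powR p)).
  exact: (measurableT_comp (@normr_measurable R setT)).
have mg (g : X -> \bar R) : borel_fun g -> measurable_fun setT (fun y : XS => g y `^ p).
  by move=> bg; apply: (borel_fun_measurable hmu); exact: borel_poweR.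
have bGG : borel_fun (fun x => G x + G' x) by exact: emeasurable_funD.
have mff : measurable_fun setT ((fun x => f x - f' x)%R : XS -> R) by exact: measurable_funB.
split; [exact: mff| |exact: (weak_upper_gradient_sub hmu)|].
  move: bf bf'; rewrite /base_integrable; case: loc => [bf bf'|foo foo'].
    apply/(in_Lploc1P hmu) => x r rp.
    have := integrableB (measurable_ballX hmu x r) ((in_Lploc1P hmu _).1 bf x r rp)
      ((in_Lploc1P hmu _).1 bf' x r rp).
    by apply: eq_integrable => //; exact: (measurable_ballX hmu).
  apply: (@le_lt_trans _ _ ((2 `^ p)%:E * (\int[mu]_x (`|f x| `^ p)%:E + \int[mu]_x (`|f' x| `^ p)%:E))).
    apply: ge0_le_integralZD => //; rewrite ?powR_ge0//; [exact: mp|exact: mp|exact: mp|].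
    by move=> x _; rewrite -EFinD -EFinM lee_fin powRB_le// ltW.
  by apply: lte_mul_pinfty; rewrite ?lee_fin ?powR_ge0// lte_add_pinfty.
split => //; first by move=> x; rewrite adde_ge0.
apply: (@le_lt_trans _ _ ((2 `^ p)%:E * (\int[mu]_x (G x `^ p) + \int[mu]_x (G' x `^ p)))).
  apply: ge0_le_integralZD => //; rewrite ?powR_ge0//; [exact: mg|exact: mg|exact: mg|
    by move=> x _; exact: poweR_ge0|by move=> x _; exact: poweR_ge0|by move=> x _; exact: poweR_ge0|].
  by move=> x _; exact: poweRD_le.
by apply: lte_mul_pinfty; rewrite ?lee_fin ?powR_ge0// lte_add_pinfty.
Qed.

(** Upper limits are not additive, but off a null set they are Lebesgue values, and these are. *)
Lemma precise_sub loc f G f' G' : admissible mu p loc f G -> admissible mu p loc f' G' ->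
  exists Z : set X, [/\ measurable (Z : set XN), nu Z = 0 & forall x, E x -> ~ Z x ->
    precise (fun y => f y - f' y)%R x = (precise f x - precise f' x)%R].
Proof.
move=> af af'; have [R0 [R00 R0le rat]] := exists_scale ltr01.
have [_ [Z [mZ nZ HZ]]] := precise_lebesgue hmu hnu geo tbE mE p_ge1 lt_pq poin R00 R0le ltr01 rat af.
have [_ [Z' [mZ' nZ' HZ']]] := precise_lebesgue hmu hnu geo tbE mE p_ge1 lt_pq poin R00 R0le ltr01 rat af'.
exists (Z `|` Z'); split; [exact: measurableU|by rewrite measureU0|].
move=> x Ex nZx; have [L _] := HZ x Ex (fun h => nZx (or_introl h)).
have [L' _] := HZ' x Ex (fun h => nZx (or_intror h)).
have good h H : admissible mu p loc h H -> good_point mu h x.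
  by move=> ah; exact: (good_point_admissible hmu geo p_ge1 poin R00 R0le ah Ex).
have Ls := lebesgue_valueB (good _ _ af) (good _ _ af') L L'.
by rewrite {1}/precise (limsup_average_lebesgue (good _ _ (admissible_sub af af')) Ls).
Qed.

Let measurable_precise' loc f G : admissible mu p loc f G ->
  measurable_fun (E : set XN) (precise f : XN -> R).
Proof.
move=> af; have [R0 [R00 R0le rat]] := exists_scale ltr01.
exact: (measurable_precise hmu hnu geo tbE mE p_ge1 lt_pq poin R00 R0le ltr01 rat af).
Qed.

(** The factor 4 comes from (s + t)^p <= 2^p (s^p + t^p) and 2 <= 2^p. *)
Lemma norm_le_sub loc f G f' G' k : (0 < k)%R -> norm_le loc f G k -> norm_le loc f' G' k ->
  norm_le loc (fun x => f x - f' x)%R (fun x => G x + G' x) (4 * k).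
Proof.
move=> k0 [af Tk bk] [af' Tk' bk']; have asub := admissible_sub af af'.
have k4 : (2 `^ p * (k `^ p + k `^ p) <= (4 * k) `^ p)%R.
  have -> : (4 * k = 2 * 2 * k)%R by ring.
  rewrite !powRM ?(ltW k0)// -mulrA ler_wpM2l ?powR_ge0//.
  rewrite -mulr2n -[leLHS]mulr_natl ler_wpM2r ?powR_ge0//.
  by rewrite -[leLHS](@powRr1 _ 2)// ler_powR// ler1n.
have [_ _ _ GLp] := af; have [_ _ _ GLp'] := af'; have [_ _ _ GLps] := asub.
have [bG G0 _] := GLp; have [bG' G0' _] := GLp'; have [bGs _ _] := GLps.
have mg (g : X -> \bar R) : borel_fun g -> measurable_fun setT (fun y : XS => g y `^ p).
  by move=> bg; apply: (borel_fun_measurable hmu); exact: borel_poweR.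
split => //.
  rewrite -lee_fin -total_energyE//.
  apply: (@le_trans _ _ ((2 `^ p)%:E * (\int[mu]_x (G x `^ p) + \int[mu]_x (G' x `^ p)))).
    apply: ge0_le_integralZD => //; rewrite ?powR_ge0//; [exact: mg|exact: mg|exact: mg|
    by move=> x _; exact: poweR_ge0|by move=> x _; exact: poweR_ge0|by move=> x _; exact: poweR_ge0|].
    by move=> x _; exact: poweRD_le.
  rewrite !total_energyE// -EFinD -EFinM lee_fin; apply: le_trans k4.
  by rewrite ler_wpM2l ?powR_ge0// lerD.
case: loc bk bk' af af' asub => bk bk' af af' asub.
  have [Z [mZ nZ HZ]] := precise_sub af af'.
  have mn h H : admissible mu p true h H ->
      measurable_fun (E : set XN) (fun x : XN => `|precise h x|%:E).
    move=> ah; apply/measurable_EFinP; apply: (measurableT_comp (@normr_measurable R setT)).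
    exact: measurable_precise' ah.
  apply: (@le_trans _ _ (\int[nu]_(x in (E : set XN)) (`|precise f x|%:E + `|precise f' x|%:E))).
    apply: ae_ge0_le_integral => //.
    - exact: mn asub.
    - by move=> x _; rewrite -EFinD lee_fin addr_ge0.
    - by apply: emeasurable_funD; [exact: mn af|exact: mn af'].
    exists Z; split => // x /= nx; apply: contrapT => nZx; apply: nx => Ex.
    by rewrite HZ// -EFinD lee_fin ler_normB.
  rewrite ge0_integralD//; [|exact: mn af|exact: mn af'].
  apply: (le_trans (leeD bk bk')); rewrite -EFinD lee_fin; lra.
have [mf _ _ _] := af; have [mf' _ _ _] := af'; have [mfs _ _ _] := asub.
have mp (h : X -> R) : measurable_fun setT (h : XS -> R) ->
    measurable_fun setT (fun y : XS => (`|h y| `^ p)%:E).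
  move=> mk; apply/measurable_EFinP; apply: (measurableT_comp (measurable_powR p)).
  exact: (measurableT_comp (@normr_measurable R setT)).
apply: (@le_trans _ _ ((2 `^ p)%:E * (\int[mu]_x (`|f x| `^ p)%:E + \int[mu]_x (`|f' x| `^ p)%:E))).
  apply: ge0_le_integralZD => //; rewrite ?powR_ge0//; [exact: mp|exact: mp|exact: mp|].
  by move=> x _; rewrite -EFinD -EFinM lee_fin powRB_le// ltW.
apply: (@le_trans _ _ ((2 `^ p)%:E * ((k `^ p)%:E + (k `^ p)%:E))).
  by apply: lee_wpmul2l; [rewrite lee_fin powR_ge0|exact: leeD].
by rewrite -EFinD -EFinM lee_fin.
Qed.

End compactness.

Lemma small_powR {R : realType} (q c e : R) : (0 < q)%R -> (0 <= c)%R -> (0 < e)%R ->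
  exists2 a : R, (0 < a)%R & (c * a `^ q <= e)%R.
Proof.
move=> q0 c0 e0; have c1 : (0 < c + 1)%R by rewrite ltr_wpDl.
exists ((e / (c + 1)) `^ q^-1)%R; first by rewrite powR_gt0// divr_gt0.
rewrite -powRrM mulVf ?gt_eqF// powRr1 ?divr_ge0 ?(ltW e0) ?(ltW c1)//.
by rewrite mulrA ler_pdivrMr// mulrC ler_pM2l// lerDl.
Qed.

(** * Compactness *)

Section compact_embedding.
Context {R : realType} {X : pmetricType R} {Smu Snu : set (set X)}.
Variable mu : {measure set (g_sigma_algebraType Smu) -> \bar R}.
Variable nu : {measure set (g_sigma_algebraType Snu) -> \bar R}.
Hypotheses (hmu : complete_borel_measure mu) (hnu : complete_borel_measure nu).
Variables (E : set X) (r0 K delta : R).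
Hypothesis geo : geometry mu nu E r0 K delta.
Hypothesis tbE : totally_bounded E.
Hypothesis mE : Snu E.
Variables (p q : R) (p_ge1 : (1 <= p)%R) (lt_pq : (p < q)%R).
Variables (C lam : R).
Hypothesis poin : poincare_const mu E r0 p C lam.

Local Notation XS := (g_sigma_algebraType Smu).
Local Notation XN := (g_sigma_algebraType Snu).
Local Notation B x r := (ball x r : set XS).
Local Notation precise := (precise mu).
Local Notation norm_le := (norm_le mu nu E p).

Let p_gt0 : (0 < p)%R. Proof. exact: lt_le_trans p_ge1. Qed.
Let q_gt0 : (0 < q)%R. Proof. exact: lt_trans lt_pq. Qed.
Let r0_gt0 : (0 < r0)%R. Proof. exact: geo_r0 geo. Qed.
Let mEN : measurable (E : set XN). Proof. exact: S_measurable. Qed.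

(** The norm controls averages only off a null set that may contain z. Since the ball around z meets
    E in positive measure, a point x outside the null set is found near z, and the average at z is
    compared with that at x. *)
Lemma avg_net_bound R0 A : (0 < R0)%R -> (4 * (lam * R0) <= r0)%R -> (0 < A)%R ->
  ratio_bound mu nu E p q A (lam * R0) ->
  exists M : R, forall loc f G k z, (0 < k)%R -> norm_le loc f G k -> E z ->
    0 < nu (ball z (R0 / 4) `&` E) -> (`|avg mu (B z (R0 / 2)) f| <= M * k)%R.
Proof.
move=> R00 R0le A0 rat.
have [Cc Cc0 HC] := control hmu hnu geo tbE mE p_ge1 lt_pq poin R00 R0le A0 rat.
exists (K ^+ 2 * Cc)%R => loc f G k z k0 nk Ez nuz; have [af _ _] := nk.
have [Z [mZ nZ HZ]] := HC _ _ _ _ k0 nk.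
have mU : measurable (ball z (R0 / 4) `&` E : set XN).
  by apply: measurableI => //; exact: (measurable_ballX hnu).
have [x [[zx Ex] nZx]] : (ball z (R0 / 4) `&` E) `\` Z !=set0.
  apply/set0P/negP => /eqP U0; move: nuz; rewrite lt_neqAle => /andP[/negP + _]; apply.
  rewrite eq_sym eq_le measure_ge0 andbT -nZ; apply: le_measure; rewrite ?inE//.
  by move=> y Uy; apply: contrapT => nZy; have : set0 y by rewrite -U0.
have {}zx : (mdist x z < R0 / 4)%R by move: zx; rewrite ballEmdist /= metric_sym.
have [pB pBz sub rK] := near_ratio hmu geo poin R00 R0le Ex Ez zx.
have If := admissible_integrable hmu p_ge1 af R00 pB.
have Ifz := integrable_onS pB pBz sub If.
apply: (le_trans (avg_norm pBz Ifz)).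
apply: (le_trans (avg_subset pB pBz sub (integrable_on_norm pB If) _)) => //.
rewrite -[leRHS]mulrA; apply: ler_pM; [by rewrite divr_ge0// fine_ge0|by apply: avg_ge0|exact: rK|].
exact: HZ.
Qed.

Hypothesis vanish : forall A, (0 < A)%R -> exists2 s : R, (0 < s)%R & ratio_bound mu nu E p q A s.

Let scale := exists_scale geo poin vanish.

Let precise_diff_le loc f G f' G' : admissible mu p loc f G -> admissible mu p loc f' G' ->
  \int[nu]_(x in (E : set XN)) (`|precise f x - precise f' x| `^ q)%:E <=
  \int[nu]_(x in (E : set XN)) (`|precise (fun y => f y - f' y)%R x| `^ q)%:E.
Proof.
move=> af af'; have asub := admissible_sub hmu p_ge1 af af'.
have [R0 [R00 R0le rat]] := scale ltr01.
have mr h H : admissible mu p loc h H -> measurable_fun (E : set XN) (precise h : XN -> R).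
  exact: (measurable_precise hmu hnu geo tbE mE p_ge1 lt_pq poin R00 R0le ltr01 rat).
have [Z [mZ nZ HZ]] := precise_sub hmu hnu geo tbE mE p_ge1 lt_pq poin vanish af af'.
apply: ae_ge0_le_integral => //.
- apply: measurable_norm_powR; apply: measurable_funB; [exact: mr af|exact: mr af'].
- by apply: measurable_norm_powR; exact: mr asub.
exists Z; split => // x /= nx; apply: contrapT => nZx; apply: nx => Ex.
by rewrite HZ.
Qed.

(** Each part of the L^q estimate gets e/3. The scale R1 makes the strong type part small and fixes
    [Cc]; then t is chosen for the small values; only then the second scale R2, for which the level
    set at t has measure at most dl. The averages over the net at R2 converge along [U]. *)
Lemma ultra_cauchy (U : set_system nat) loc (f : nat -> X -> R) (G : nat -> X -> \bar R) k :
  UltraFilter U -> (0 < k)%R -> (forall n, norm_le loc (f n) (G n) k) ->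
  forall e, (0 < e)%R -> exists2 S, U S & forall m n, S m -> S n ->
    \int[nu]_(x in (E : set XN)) (`|precise (f m) x - precise (f n) x| `^ q)%:E <= e%:E.
Proof.
move=> UU k0 nf e e0; have PU : ProperFilter U by exact: ultra_proper.
pose k' := (4 * k)%R; have k'0 : (0 < k')%R by rewrite mulr_gt0.
have kq0 : (0 <= k' `^ q)%R by exact: powR_ge0.
pose eta := (e / 3)%R; have eta0 : (0 < eta)%R by rewrite divr_gt0.
have nEoo := nu_E_lty hnu geo tbE mE.
have nE : nu E = (fine (nu E))%:E by rewrite fineK// ge0_fin_numE.
have n0 : (0 <= fine (nu E))%R by exact: fine_ge0.
have W0 c : (0 <= weak_const K delta p q c)%R by exact: (weak_const_ge0 geo).
have S0 : (0 <= strong_const K delta p q C * k' `^ q)%R.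
  by rewrite mulr_ge0// (mulr_ge0 (powR_ge0 _ _) (W0 _)).
have [A1 A10 HA1] := small_powR q_gt0 S0 eta0.
have [R1 [R10 R1le rat1]] := scale A10.
have [Cc Cc0 HC] := Lq_estimate hmu hnu geo tbE mE p_ge1 lt_pq poin R10 R1le A10 rat1.
have [t t0 Ht] := small_powR q_gt0 n0 eta0.
have Ck0 : (0 <= Cc * k' `^ q)%R by rewrite mulr_ge0// ltW.
have Ck1 : (0 < Cc * k' `^ q + 1)%R by rewrite ltr_wpDl.
pose dl := (eta / (Cc * k' `^ q + 1))%R; have dl0 : (0 < dl)%R by rewrite divr_gt0.
have D0 : (0 <= weak_const K delta p q C * k' `^ q * (t / 2) `^ (- q))%R.
  by rewrite mulr_ge0 ?powR_ge0// mulr_ge0.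
have [A2 A20 HA2] := small_powR q_gt0 D0 dl0.
have [R2 [R20 R2le rat2]] := scale A20.
have R240 : (0 < R2 / 4)%R by rewrite divr_gt0.
have [F [N [mN nN FE Fcov]]] := good_net hnu tbE mE R240.
have [M HM] := avg_net_bound R20 R2le A20 rat2.
pose a z n := avg mu (B z (R2 / 2)) (f n).
have t40 : (0 < t / 4)%R by rewrite divr_gt0.
have Ug z : exists g : R, z \in F -> U [set n | (`|a z n - g| <= t / 4)%R].
  have [zF|zF] := boolP (z \in F); last by exists 0%R.
  have [Ez nz] := FE z zF.
  have [g Hg] := ultra_bounded_limit UU (fun n => HM _ _ _ _ z k0 (nf n) Ez nz).
  by exists g => _; exact: Hg.
have /choice[g Hg] := Ug.
exists [set n | forall z, z \in F -> (`|a z n - g z| <= t / 4)%R].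
  exact: (filter_forall_seq UU Hg).
move=> m n Sm Sn; have [am _ _] := nf m; have [an _ _] := nf n.
have nmn := norm_le_sub hmu hnu geo tbE mE p_ge1 lt_pq poin vanish k0 (nf m) (nf n).
apply: (le_trans (precise_diff_le am an)); apply: (le_trans (HC _ _ _ _ _ k'0 t0 nmn)).
set h := (fun x => f m x - f n x)%R.
have lev : nu (E `&` [set x | (t < `|precise h x|)%R]) <= dl%:E.
  apply: (le_trans (level_estimate hmu hnu geo tbE mE p_ge1 lt_pq poin R20 R2le A20 rat2
    k'0 t0 nmn mN nN (fun z zF => (FE z zF).1) Fcov _)).
    move=> z zF; have [Ez _] := FE z zF.
    have R22 : (0 < R2 / 2)%R by rewrite divr_gt0.
    have pB : pos_finite mu (B z (R2 / 2)).
      apply: (geo_mu geo) => //; have [_ lam1 _] := poin.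
      have : (R2 <= lam * R2)%R by rewrite ler_peMl// ltW.
      by move: R2le R20 r0_gt0; lra.
    rewrite avgB//; [|exact: (admissible_integrable hmu p_ge1 am)|exact: (admissible_integrable hmu p_ge1 an)].
    rewrite -/(a z m) -/(a z n) -(subrKA (g z)); apply: (le_trans (ler_normD _ _)).
    have := Sm z zF; have := Sn z zF; rewrite (distrC (a z n)); lra.
  rewrite lee_fin; apply: le_trans HA2; apply: eq_ler; rewrite /k'; ring.
have -> : e%:E = eta%:E + eta%:E + eta%:E by rewrite -!EFinD; congr EFin; rewrite /eta; field.
apply: leeD; last first.
  by rewrite lee_fin; apply: le_trans HA1; apply: eq_ler; rewrite -/k'; ring.
apply: leeD; first by rewrite nE -EFinM lee_fin mulrC.
apply: (@le_trans _ _ ((Cc * k' `^ q)%:E * dl%:E)).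
  by apply: lee_wpmul2l; rewrite ?lee_fin.
by rewrite -EFinM lee_fin /dl mulrA ler_pdivrMr// mulrC ler_pM2l// lerDl.
Qed.

Lemma compact_of_reduces loc (Y : @function_space R X) :
  reduces mu nu E p loc Y -> bounded_embedding mu nu Y E q -> compact_embedding mu nu Y E q.
Proof.
move=> redY [Cb _ bdY] u M HuM.
have [R0 [R00 R0le rat]] := scale ltr01.
(* Positive, and strictly larger than M, as the reduction asks for a strict bound. *)
pose k := (`|M| + 1)%R; have k0 : (0 < k)%R by rewrite ltr_wpDl.
pose f n := fine \o u n.
have HG n : exists G, norm_le loc (f n) G k.
  have [Yu uM] := HuM n; have [_ _ red] := redY _ Yu.
  apply: red => //; apply: (le_lt_trans uM); rewrite lte_fin /k.
  by rewrite ltr_pwDr// ler_norm.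
have /choice[G nf] := HG.
have limE n : limsup_average mu (u n) = limsup_average mu (EFin \o f n).
  by have [Yu _] := HuM n; have [] := redY _ Yu.
have [U [UU Uoo]] := @ultraFilterLemma nat \oo _.
pose ep n : R := ((2^-1 ^+ n) `^ q * 2^-1 ^+ n)%R.
have ep0 n : (0 < ep n)%R by rewrite mulr_gt0 ?powR_gt0 ?exprn_gt0 ?invr_gt0.
have HS n := ultra_cauchy UU k0 nf (ep0 n).
have /choice[S HS'] (n : nat) : exists S, U S /\ forall m m', S m -> S m' ->
    \int[nu]_(x in (E : set XN)) (`|precise (f m) x - precise (f m') x| `^ q)%:E <= (ep n)%:E.
  by have [S US H] := HS n; exists S.
have [phi [phi_incr phiS]] := ultra_subsequence UU Uoo (fun n => (HS' n).1).
have mr n : measurable_fun (E : set XN) (precise (f n) : XN -> R).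
  have [af _ _] := nf n.
  exact: (measurable_precise hmu hnu geo tbE mE p_ge1 lt_pq poin R00 R0le ltr01 rat af).
have aeL n : {ae nu, forall x : XN, E x -> limsup_average mu (u n) x = (precise (f n) x)%:E}.
  have [af _ _] := nf n; rewrite limE.
  have [_ [Z [mZ nZ HZ]]] := precise_lebesgue hmu hnu geo tbE mE p_ge1 lt_pq poin R00 R0le ltr01 rat af.
  exact: (limsup_average_precise mZ nZ (fun x Ex nx => (HZ x Ex nx).2)).
have [v [mv Hv]] := @Lq_complete _ XN R nu E mEN q q_gt0 (fun n => precise (f (phi n)))
  (fun n => mr (phi n)) (fun n => (HS' n).2 _ _ (phiS n n.+1 (leqnSn n)) (phiS n n (leqnn n))).
have inL n : in_Lp nu E q (limsup_average mu (u n)) by have [] := bdY _ (HuM n).1.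
have mL n : measurable_fun (E : set XN) (limsup_average mu (u n) : XN -> \bar R) := (inL n).1.
have mEv : measurable_fun (E : set XN) (EFin \o v : XN -> \bar R) by exact/measurable_EFinP.
have diffE n : Lpnorm nu E q (fun x => limsup_average mu (u (phi n)) x - (EFin \o v) x) <=
    (2 * (2^-1 ^+ n) * 2 `^ q^-1)%:E.
  rewrite (LpnormE _ _ q_gt0 mEN).
  apply: (@le_trans _ _ (((2 * 2^-1 ^+ n) `^ q * 2)%:E `^ q^-1)); last first.
    rewrite poweR_EFin powRM ?powR_ge0// -powRrM mulfV ?gt_eqF// powRr1//.
  apply: lee_poweR; first by rewrite invr_ge0 ltW.
    by apply: integral_ge0 => x _; exact: poweR_ge0.
  apply: le_trans (Hv n); apply: ae_ge0_le_integral => //.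
  - by move=> x _; exact: poweR_ge0.
  - apply: (measurableT_comp (measurable_poweR q)).
    apply: (measurableT_comp (@abse_measurable R setT)).
    by apply: emeasurable_funB; [exact: mL|exact: mEv].
  - by apply: measurable_norm_powR; apply: measurable_funB; [exact: mr|exact: mv].
  by apply: filterS (aeL (phi n)) => x Hx Ex; rewrite Hx.
(* The limit is q-integrable because it differs from the first function of the subsequence by a
   q-integrable one. *)
exists phi, (EFin \o v); split; [exact: phi_incr|by move=> n; exact: inL| |].
- apply/(in_LpP nu _ q_gt0 mEN); split; first exact: mEv.
  have [_ Loo] := (in_LpP nu _ q_gt0 mEN).1 (inL (phi 0%N)).
  have Foo : \int[nu]_(x in (E : set XN)) (`|precise (f (phi 0%N)) x| `^ q)%:E < +oo.
    apply: le_lt_trans Loo; apply: ae_ge0_le_integral => //.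
    + by apply: measurable_norm_powR; exact: mr.
    + by move=> x _; exact: poweR_ge0.
    + apply: (measurableT_comp (measurable_poweR q)).
      exact: (measurableT_comp (@abse_measurable R setT) (mL _)).
    by apply: filterS (aeL (phi 0%N)) => x Hx Ex; rewrite Hx.
  apply: (@le_lt_trans _ _ ((2 `^ q)%:E *
     (\int[nu]_(x in (E : set XN)) (`|precise (f (phi 0%N)) x| `^ q)%:E +
      \int[nu]_(x in (E : set XN)) (`|precise (f (phi 0%N)) x - v x| `^ q)%:E))).
    apply: ge0_le_integralZD => //; rewrite ?powR_ge0//.
    + by apply: measurable_norm_powR; exact: mr.
    + by apply: measurable_norm_powR; apply: measurable_funB; [exact: mr|exact: mv].
    + apply: (measurableT_comp (measurable_poweR q)).
      exact: (measurableT_comp (@abse_measurable R setT) mEv).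
    + by move=> x _; exact: poweR_ge0.
    move=> x _ /=; rewrite -EFinD -EFinM lee_fin.
    have -> : `|v x|%R = `|precise (f (phi 0%N)) x - (precise (f (phi 0%N)) x - v x)|%R by rewrite subKr.
    by apply: powRB_le; exact: ltW.
  apply: lte_mul_pinfty; [by rewrite lee_fin powR_ge0|by []|].
  by apply: lte_add_pinfty; [exact: Foo|exact: le_lt_trans (Hv 0%N) (ltry _)].
have bcvg : (2 * (2^-1 ^+ n) * 2 `^ q^-1)%:E @[n --> \oo] --> (0 : \bar R).
  apply: cvg_EFin; first by near=> n.
  rewrite -[X in _ --> X](mul0r (2 `^ q^-1)%R); apply: cvgMl.
  rewrite -[X in _ --> X](mulr0 2%R); apply: cvgMr; apply: cvg_expr.
  by rewrite ger0_norm// invf_lt1// ltr1n.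
apply: (squeeze_cvge _ _ bcvg); last exact: cvg_cst.
apply: nearW => n; rewrite diffE andbT (LpnormE _ _ q_gt0 mEN); exact: poweR_ge0.
Unshelve. all: by end_near. Qed.

End compact_embedding.

(** * Necessity of the conditions (1) and (2) *)

Section tent.
Context {R : realType} {X : pmetricType R}.
Implicit Types (x y z : X) (a r : R).

Definition tent a x r y : R := clamp 0 a (2 * a - 2 * a / r * mdist x y).

Definition tent_gradient a x r : X -> \bar R := (cst (2 * a / r)%:E) \_ (ball x r).

Lemma tent_bounds a x r y : (0 < a)%R -> (0 <= tent a x r y <= a)%R.
Proof.
move=> a0; rewrite /tent /clamp le_max lexx/= ge_max (ltW a0)/=.
by rewrite ge_min lexx orbT.
Qed.

Lemma tent_in a x r y : (0 < a)%R -> (0 < r)%R -> (mdist x y <= r / 2)%R -> tent a x r y = a.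
Proof.
move=> a0 r0 xy; rewrite /tent clamp_ge ?(ltW a0)//.
suff : (2 * a / r * mdist x y <= a)%R by lra.
by rewrite mulrAC ler_pdivrMr// -mulrA mulrCA ler_pM2l// mulrC -ler_pdivlMr.
Qed.

Lemma tent_out a x r y : (0 < a)%R -> (0 < r)%R -> (r <= mdist x y)%R -> tent a x r y = 0%R.
Proof.
move=> a0 r0 xy; rewrite /tent clamp_le ?(ltW a0)// subr_le0.
by rewrite mulrAC ler_pdivlMr// ler_pM2l ?mulr_gt0.
Qed.

Lemma tent_lip a x r y z : (0 < a)%R -> (0 < r)%R ->
  (`|tent a x r y - tent a x r z| <= 2 * a / r * mdist y z)%R.
Proof.
move=> a0 r0; apply: (le_trans (clamp_lip _ _ (ltW a0))).
have ar : (0 < 2 * a / r)%R by rewrite divr_gt0// mulr_gt0.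
have -> : (2 * a - 2 * a / r * mdist x y - (2 * a - 2 * a / r * mdist x z) =
  2 * a / r * (mdist x z - mdist x y))%R by ring.
rewrite normrM (gtr0_norm ar) ler_pM2l// ler_norml; apply/andP; split.
  by have := metric_triangle x z y; rewrite (metric_sym z y); lra.
by have := metric_triangle x y z; lra.
Qed.

Lemma borel_tent_gradient a x r : borel_fun (tent_gradient a x r).
Proof.
pose XB := g_sigma_algebraType (open : set (set X)).
have bB : measurable (ball x r : set XB) by apply: sub_sigma_algebra; exact: open_ballX.
apply: (@measurable_restrictT _ _ XB _ (ball x r) (cst (2 * a / r)%:E) bB).1.
exact: measurable_cst.
Qed.

Lemma tent_gradient_ge0 a x r y : (0 < a)%R -> (0 < r)%R -> 0 <= tent_gradient a x r y.
Proof.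
move=> a0 r0; rewrite /tent_gradient patchE; case: ifP => // _ /=.
by rewrite lee_fin divr_ge0 ?mulr_ge0 ?(ltW a0) ?(ltW r0).
Qed.

(** Along a curve the tent is the clamp of a Lipschitz function with slope 2a/r, and the clamp is
    active only inside the ball. *)
Lemma tent_upper_gradient a x r : (0 < a)%R -> (0 < r)%R ->
  upper_gradient (EFin \o tent a x r) (tent_gradient a x r).
Proof.
move=> a0 r0; split=> [|y|c l rc]; [exact: borel_tent_gradient|exact: tent_gradient_ge0|].
have l0 : (0 < l)%R by case: rc.
apply: upper_gradient_along_real => //=.
have ar : (0 < 2 * a / r)%R by rewrite divr_gt0// mulr_gt0.
apply: (@increments_clamp_le _ (fun t => 2 * a - 2 * a / r * mdist x (c t))%R l
   (cst (2 * a / r)%:E)) => //.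
- exact: ltW.
- by move=> t /=; rewrite lee_fin ltW.
- rewrite integral_cst//= lebesgue_measure_itv/=; case: ifP => _; last by rewrite mule0.
  by rewrite -EFinD -EFinM ltry.
- move=> s t /andP[s0 st] tl; rewrite integral_cst//= lebesgue_measure_itv/=.
  have lip := rectifiable_lip rc s0 st tl.
  have H : (`|2 * a - 2 * a / r * mdist x (c t) - (2 * a - 2 * a / r * mdist x (c s))| <=
     2 * a / r * (t - s))%R.
    have -> : (2 * a - 2 * a / r * mdist x (c t) - (2 * a - 2 * a / r * mdist x (c s)) =
      2 * a / r * (mdist x (c s) - mdist x (c t)))%R by ring.
    rewrite normrM (gtr0_norm ar) ler_pM2l//.
    apply: le_trans lip; rewrite ler_norml; apply/andP; split.
      by have := metric_triangle x (c s) (c t); lra.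
    by have := metric_triangle x (c t) (c s); rewrite (metric_sym (c t)); lra.
  case: ifP => [_|]; first by rewrite -EFinD -EFinM lee_fin.
  move=> /negbT; rewrite lte_fin -leNgt => ts.
  have {H} : (t = s)%R by apply/eqP; rewrite eq_le st ts.
  by move=> ->; rewrite subrr normr0 mule0.
- exact: (borel_fun_curve (borel_tent_gradient a x r) rc).
- by move=> t; exact: tent_gradient_ge0.
move=> t _ /andP[f0 fa]; rewrite /tent_gradient patchE ifT// inE ballEmdist /=.
by move: f0; rewrite subr_gt0 mulrAC ltr_pdivrMr// ltr_pM2l// mulr_gt0.
Qed.

End tent.

Section tent_space.
Context {R : realType} {X : pmetricType R} {S : set (set X)}.
Variable mu : {measure set (g_sigma_algebraType S) -> \bar R}.
Hypothesis hmu : complete_borel_measure mu.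
Local Notation XS := (g_sigma_algebraType S).
Local Notation B x r := (ball x r : set XS).
Implicit Types (x y z : X) (a r p : R).

Lemma measurable_mdist x : measurable_fun setT (mdist x : XS -> R).
Proof.
apply: (measurability _ (RGenInftyO.measurableE R)) => // _ [_ [r ->] <-].
rewrite setTI preimage_itvNyo; have := measurable_ballX hmu x r.
by rewrite ballEmdist.
Qed.

Lemma measurable_tent a x r : measurable_fun setT (tent a x r : XS -> R).
Proof.
apply: (measurableT_comp (@measurable_clamp R 0 a)).
apply: measurable_funB; first exact: measurable_cst.
apply: measurable_funM; [exact: measurable_cst|exact: measurable_mdist].
Qed.

Lemma tent_gradient_energy a x r p : (0 < a)%R -> (0 < r)%R -> (0 < p)%R ->
  \int[mu]_y (tent_gradient a x r y `^ p) = ((2 * a / r) `^ p)%:E * mu (ball x r).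
Proof.
move=> a0 r0 p0; rewrite -integral_cst; last exact: (measurable_ballX hmu).
rewrite [RHS]integral_mkcond; apply: eq_integral => y _.
rewrite /tent_gradient !patchE; case: ifP => _ //=.
by change (0%:E `^ p = 0%:E :> \bar R); rewrite poweR_EFin powR0// gt_eqF.
Qed.

Lemma tent_gradient_Lp a x r p : (0 < a)%R -> (0 < r)%R -> (0 < p)%R -> mu (ball x r) < +oo ->
  borel_Lp mu p (tent_gradient a x r).
Proof.
move=> a0 r0 p0 moo; split; [exact: borel_tent_gradient|by move=> y; exact: tent_gradient_ge0|].
by rewrite tent_gradient_energy//; apply: lte_mul_pinfty; rewrite ?lee_fin ?powR_ge0.
Qed.

Lemma tent_integral_le a x r p (D : set X) : (0 < a)%R -> (0 < r)%R -> (0 < p)%R ->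
  measurable (D : set XS) ->
  \int[mu]_(y in (D : set XS)) (`|tent a x r y| `^ p)%:E <= (a `^ p)%:E * mu (ball x r).
Proof.
move=> a0 r0 p0 mD; have mB := measurable_ballX hmu x r.
have mb : measurable_fun setT (fun y : XS => (`|tent a x r y| `^ p)%:E).
  apply/measurable_EFinP; apply: (measurableT_comp (measurable_powR p)).
  exact: (measurableT_comp (@normr_measurable R setT) (measurable_tent a x r)).
rewrite -integral_cst// [leRHS]integral_mkcond.
apply: (@le_trans _ _ (\int[mu]_y (`|tent a x r y| `^ p)%:E)).
  by apply: ge0_subset_integral => // y _; rewrite lee_fin powR_ge0.
apply: ge0_le_integral => //.
- by apply/(measurable_restrictT _ _).1 => //; exact: measurable_cst.
move=> y _; rewrite patchE; case: ifPn => [_|].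
  have /andP[b0 ba] := tent_bounds x r y a0.
  by rewrite /= lee_fin ler_powR2 ?(ltW p0)// ger0_norm.
rewrite notin_setE ballEmdist /= => /negP; rewrite -leNgt => xy.
by rewrite tent_out// normr0 powR0// gt_eqF.
Qed.

Lemma tent_integral_ge a x r p (D : set X) : (0 < a)%R -> (0 < r)%R -> (0 < p)%R ->
  measurable (D : set XS) ->
  (a `^ p)%:E * mu (ball x (r / 2) `&` D) <=
  \int[mu]_(y in (D : set XS)) (`|tent a x r y| `^ p)%:E.
Proof.
move=> a0 r0 p0 mD; have mB := measurable_ballX hmu x (r / 2).
have mb : measurable_fun setT (fun y : XS => (`|tent a x r y| `^ p)%:E).
  apply/measurable_EFinP; apply: (measurableT_comp (measurable_powR p)).
  exact: (measurableT_comp (@normr_measurable R setT) (measurable_tent a x r)).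
have mBD : measurable (ball x (r / 2) `&` D : set XS) by exact: measurableI.
rewrite -integral_cst//.
apply: (@le_trans _ _ (\int[mu]_(y in (ball x (r / 2) `&` D : set XS)) (`|tent a x r y| `^ p)%:E)).
  apply: ge0_le_integral => //.
  - by move=> y _; rewrite /= lee_fin powR_ge0.
  - exact: measurable_funTS.
  move=> y [xy _]; rewrite tent_in ?(gtr0_norm a0)//.
  by move: xy; rewrite ballEmdist /= => /ltW.
apply: ge0_subset_integral => //; first exact: measurable_funTS.
Qed.

Lemma tent_integrable a x r (D : set X) : (0 < a)%R -> (0 < r)%R -> mu (ball x r) < +oo ->
  measurable (D : set XS) -> mu.-integrable (D : set XS) (EFin \o tent a x r).
Proof.
move=> a0 r0 moo mD; apply/integrableP; split.
  by apply: measurable_funTS; apply/measurable_EFinP; exact: measurable_tent.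
apply: le_lt_trans (_ : (a `^ 1)%:E * mu (ball x r) < +oo).
  apply: le_trans (tent_integral_le x a0 r0 ltr01 mD).
  apply: (@le_trans _ _ (\int[mu]_(y in (D : set XS)) (`|tent a x r y| `^ 1)%:E)); last exact: lexx.
  by under [leRHS]eq_integral do rewrite powRr1//.
by apply: lte_mul_pinfty; rewrite ?lee_fin ?powR_ge0.
Qed.

Lemma limsup_average_tent a x r y (s : R) : (0 < a)%R -> (0 < r)%R -> mu (ball x r) < +oo ->
  (0 < s)%R -> (forall t, (0 < t)%R -> (t < s)%R -> pos_finite mu (B y t)) ->
  limsup_average mu (EFin \o tent a x r) y = (tent a x r y)%:E.
Proof.
move=> a0 r0 moo s0 pos; have ar : (0 < 2 * a / r)%R by rewrite divr_gt0// mulr_gt0.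
have If t : integrable_on mu (B y t) (tent a x r).
  by apply: tent_integrable => //; exact: (measurable_ballX hmu).
apply: limsup_average_lebesgue.
  by exists s => // t /andP[t0 ts]; split; [exact: pos|exact: If].
move=> e e0; exists (Num.min s (e / (2 * a / r)))%R; first by rewrite lt_min s0 divr_gt0.
move=> t /andP[t0]; rewrite lt_min => /andP[ts te].
have pB := pos t t0 ts; rewrite -[leRHS](avg_cst e pB); apply: le_avg => //.
- exact: integrable_osc.
- exact: integrable_on_cst.
move=> z; rewrite ballEmdist /= => yz.
apply: (le_trans (tent_lip x z y a0 r0)); rewrite mulrC -ler_pdivlMr//.
by rewrite metric_sym (le_trans (ltW yz))// ltW.
Qed.

End tent_space.

Lemma powR_root_mul {R : realType} (s p b : R) : (0 < p)%R -> (0 <= s)%R -> (0 <= b)%R ->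
  ((s `^ p * b) `^ p^-1 = s * b `^ p^-1)%R.
Proof.
by move=> p0 s0 b0; rewrite powRM ?powR_ge0// -powRrM mulfV ?gt_eqF// powRr1.
Qed.

(** * Testing with tents *)

Section necessity.
Context {R : realType} {X : pmetricType R} {Smu Snu : set (set X)}.
Variable mu : {measure set (g_sigma_algebraType Smu) -> \bar R}.
Variable nu : {measure set (g_sigma_algebraType Snu) -> \bar R}.
Hypotheses (hmu : complete_borel_measure mu) (hnu : complete_borel_measure nu).
Variables (E : set X) (r0 K delta : R).
Hypothesis geo : geometry mu nu E r0 K delta.
Hypothesis tbE : totally_bounded E.
Hypothesis mE : Snu E.
Variables (p q : R) (p_ge1 : (1 <= p)%R) (lt_pq : (p < q)%R).

Local Notation XS := (g_sigma_algebraType Smu).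
Local Notation XN := (g_sigma_algebraType Snu).
Local Notation B x r := (ball x r : set XS).
Local Notation muB := (muB mu).
Local Notation nuB := (nuB nu).

Implicit Types (a r s : R) (x y z : X).

Let p_gt0 : (0 < p)%R. Proof. exact: lt_le_trans p_ge1. Qed.
Let q_gt0 : (0 < q)%R. Proof. exact: lt_trans lt_pq. Qed.
Let r0_gt0 : (0 < r0)%R. Proof. exact: geo_r0 geo. Qed.
Let K_gt0 : (0 < K)%R. Proof. exact: lt_le_trans (geo_K geo). Qed.
Let mEN : measurable (E : set XN). Proof. exact: S_measurable. Qed.
Let le2r0 r : (r <= r0)%R -> (r <= 2 * r0)%R. Proof. by have := r0_gt0; lra. Qed.
Let ip0 : (0 < p^-1)%R. Proof. by rewrite invr_gt0. Qed.
Let iq0 : (0 < q^-1)%R. Proof. by rewrite invr_gt0. Qed.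

Let mu_lty x r : E x -> (0 < r)%R -> (r <= r0)%R -> mu (ball x r) < +oo.
Proof. by move=> Ex rp rr; have [] := geo_mu geo Ex rp (le2r0 rr). Qed.

Lemma limsup_average_tent_E a x r y : (0 < a)%R -> E x -> (0 < r)%R -> (r <= r0)%R -> E y ->
  limsup_average mu (EFin \o tent a x r) y = (tent a x r y)%:E.
Proof.
move=> a0 Ex rp rr Ey; apply: (limsup_average_tent hmu a0 rp (mu_lty Ex rp rr) r0_gt0).
by move=> t t0 /ltW tr; apply: (geo_mu geo) => //; exact: le2r0.
Qed.

Lemma measurable_limsup_tent a x r : (0 < a)%R -> E x -> (0 < r)%R -> (r <= r0)%R ->
  measurable_fun (E : set XN) (limsup_average mu (EFin \o tent a x r) : XN -> \bar R).
Proof.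
move=> a0 Ex rp rr.
have mb : measurable_fun (E : set XN) (EFin \o tent a x r : XN -> \bar R).
  by apply: measurable_funTS; apply/measurable_EFinP; exact: measurable_tent hnu _ _ _.
apply: eq_measurable_fun mb => y; rewrite inE => Ey.
by rewrite limsup_average_tent_E.
Qed.

Lemma Lpnorm_tent a x r s : (0 < a)%R -> E x -> (0 < r)%R -> (r <= r0)%R -> (0 < s)%R ->
  Lpnorm nu E s (limsup_average mu (EFin \o tent a x r)) =
  (\int[nu]_(y in (E : set XN)) (`|tent a x r y| `^ s)%:E) `^ s^-1.
Proof.
move=> a0 Ex rp rr s0; rewrite (LpnormE _ _ s0 mEN); congr (_ `^ _).
by apply: eq_integral => y; rewrite inE => Ey; rewrite limsup_average_tent_E.
Qed.

Lemma Lpnorm_tent_le a x r s : (0 < a)%R -> E x -> (0 < r)%R -> (r <= r0)%R -> (0 < s)%R ->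
  Lpnorm nu E s (limsup_average mu (EFin \o tent a x r)) <= (a * nuB x r `^ s^-1)%:E.
Proof.
move=> a0 Ex rp rr s0; rewrite Lpnorm_tent//.
have H := tent_integral_le hnu x a0 rp s0 mEN.
apply: (@le_trans _ _ ((a `^ s * nuB x r)%:E `^ s^-1)).
  apply: lee_poweR; first by rewrite invr_ge0 ltW.
    by apply: integral_ge0 => y _; rewrite lee_fin powR_ge0.
  by apply: (le_trans H); rewrite (nuBE geo)// ?EFinM// le2r0.
by rewrite poweR_EFin powR_root_mul ?fine_ge0// ltW.
Qed.

Definition tests (Y : @function_space R X) := exists2 C1 : R, (0 < C1)%R &
  forall a x r, (0 < a)%R -> E x -> (0 < r)%R -> (r <= r0)%R ->
    fs_mem Y (EFin \o tent a x r) /\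
    fs_norm Y (EFin \o tent a x r) <= (a * C1 * (muB x r `^ p^-1 / r + nuB x r))%:E.

Lemma newtonian_tests : tests (newtonian_space mu p).
Proof.
have C0 : (0 < r0 `^ p + 2 `^ p)%R by rewrite addr_gt0// powR_gt0.
(* r0^p absorbs the L^p norm of the tent, since a <= a r0 / r, and 2^p comes from the slope 2a/r. *)
exists ((r0 `^ p + 2 `^ p) `^ p^-1)%R; first exact: powR_gt0.
move=> a x r a0 Ex rp rr /=.
have m0 : (0 < muB x r)%R by apply: (muB_gt0 geo) => //; exact: le2r0.
have : newtonian_norm mu p (EFin \o tent a x r) <=
    (a * (r0 `^ p + 2 `^ p) `^ p^-1 * (muB x r `^ p^-1 / r + nuB x r))%:E.
  apply: (@le_trans _ _ (((a / r) `^ p * (r0 `^ p + 2 `^ p) * muB x r)%:E `^ p^-1)).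
    apply: lee_poweR; first exact: ltW.
      apply: adde_ge0; first by apply: integral_ge0 => y _; exact: poweR_ge0.
      apply: le_ereal_inf_tmp => _ [g _ <-]; apply: integral_ge0 => y _; exact: poweR_ge0.
    rewrite mulrDr mulrDl EFinD; apply: leeD.
      apply: (@le_trans _ _ ((a `^ p)%:E * mu (ball x r))).
        exact: (tent_integral_le hmu x a0 rp p_gt0 measurableT).
      rewrite (muBE geo)//; last exact: le2r0.
      rewrite -EFinM lee_fin ler_wpM2r ?(ltW m0)//.
      rewrite -powRM ?divr_ge0 ?(ltW a0) ?(ltW rp) ?(ltW r0_gt0)//.
      apply: ler_powR2; [exact: ltW|exact: ltW|].
      by rewrite -mulrA ler_peMr ?(ltW a0)// mulrC ler_pdivlMr// mul1r.
    apply: ereal_inf_lbound; exists (tent_gradient a x r); first exact: tent_upper_gradient.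
    rewrite (tent_gradient_energy hmu)// (muBE geo)//; last exact: le2r0.
    rewrite -EFinM -powRM ?divr_ge0 ?(ltW a0) ?(ltW rp)//.
    by congr (_ `^ _ * _)%:E; ring.
  rewrite poweR_EFin lee_fin.
  have ar0 : (0 <= a / r)%R by rewrite divr_ge0// ltW.
  rewrite -mulrA powR_root_mul ?(mulr_ge0 (ltW C0) (ltW m0))//.
  rewrite powRM ?(ltW C0) ?(ltW m0)// mulrA.
  set c := ((_ + _) `^ _)%R; set m := (muB x r `^ _)%R.
  have -> : (a / r * c * m = a * c * (m / r))%R by ring.
  rewrite ler_wpM2l ?lerDl ?fine_ge0// mulr_ge0 ?powR_ge0//.
  exact: ltW.
move=> H; split => //; split; last by apply: (le_lt_trans H); rewrite ltry.
by apply/measurable_EFinP; exact: measurable_tent hmu _ _ _.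
Qed.

Lemma dirichlet_tests : tests (dirichlet_space mu nu p E).
Proof.
exists 2%R => // a x r a0 Ex rp rr.
have moo := mu_lty Ex rp rr.
have m0 : (0 < muB x r)%R by apply: (muB_gt0 geo) => //; exact: le2r0.
have ug := tent_upper_gradient x a0 rp.
have gLp := tent_gradient_Lp hmu a0 rp p_gt0 moo.
have ubE := Lpnorm_tent_le a0 Ex rp rr ltr01.
have [_ GLp Gle] := min_upper_gradient_le hmu p_ge1 (upper_gradient_weak hmu p_gt0 ug) gLp.
split.
  split; last first.
    by split; [exact: measurable_limsup_tent|apply: (le_lt_trans ubE); rewrite ltry].
  split.
    apply/(in_Lploc1P hmu) => y s s0; apply: (tent_integrable hmu) => //.
    exact: (measurable_ballX hmu).
  exists (tent_gradient a x r) => //.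
  have [bg g0 goo] := gLp.
  apply/(in_LpP mu _ p_gt0 measurableT); split; first exact: (borel_fun_measurable hmu).
  by move: goo; congr (_ < _); apply: eq_integral => y _; rewrite gee0_abs.
rewrite /=; have -> : (a * 2 * (muB x r `^ p^-1 / r + nuB x r))%:E =
    (2 * a / r * muB x r `^ p^-1)%:E + (2 * a * nuB x r)%:E.
  by rewrite -EFinD; congr EFin; field; rewrite gt_eqF.
apply: leeD; last first.
  apply: (le_trans ubE); rewrite lee_fin invr1 powRr1 ?fine_ge0//.
  by rewrite ler_wpM2r ?fine_ge0// ler_peMl ?(ltW a0)// ler1n.
have [_ G0 _] := GLp.
rewrite (LpnormE _ _ p_gt0 measurableT).
apply: (@le_trans _ _ (((2 * a / r) `^ p * muB x r)%:E `^ p^-1)).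
  apply: lee_poweR; first exact: ltW.
    by apply: integral_ge0 => y _; exact: poweR_ge0.
  rewrite EFinM -(muBE geo) ?(le2r0 rr)// -(tent_gradient_energy hmu)//.
  by apply: le_trans Gle; under eq_integral do rewrite gee0_abs//.
by rewrite poweR_EFin powR_root_mul// ?(ltW m0)// divr_ge0 ?mulr_ge0 ?(ltW a0) ?(ltW rp).
Qed.

Lemma nuB_upper_bound : exists2 M : R, (0 < M)%R & forall x, E x -> (nuB x r0 <= M)%R.
Proof.
have [F [FE Fcov]] := totally_bounded_net tbE r0_gt0.
have r20 : (0 < 2 * r0)%R by rewrite mulr_gt0.
have [|m m0 Hm] := @seq_lower_bound R _ F (fun z => (nuB z (2 * r0))^-1)%R.
  by move=> z zF; rewrite invr_gt0; apply: (nuB_gt0 geo) => //; exact: FE.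
exists m^-1%R; first by rewrite invr_gt0.
move=> x Ex; have [z zF zx] := Fcov x Ex; have Ez := FE z zF.
have nz : (0 < nuB z (2 * r0))%R by apply: (nuB_gt0 geo).
apply: (@le_trans _ _ (nuB z (2 * r0))).
  apply: (le_nuB hnu geo) => //; first exact: le2r0.
  have {}zx : (mdist z x < r0)%R by move: zx; rewrite ballEmdist.
  by apply: ball_subset; rewrite metric_sym; lra.
by rewrite -[leLHS]invrK lef_pV2 ?posrE ?invr_gt0// Hm.
Qed.

(** The decay from the fixed radius r0, where nu is bounded over E by total boundedness, is uniform
    in the centre. *)
Lemma small_nuB eta : (0 < eta)%R -> exists r1, [/\ (0 < r1)%R, (r1 <= r0)%R &
  forall x r, E x -> (0 < r)%R -> (r <= r1)%R -> (nuB x r <= eta)%R].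
Proof.
move=> eta0; have [M M0 HM] := nuB_upper_bound.
have KM0 : (0 <= K * M)%R by rewrite mulr_ge0 ?ltW.
have [a a0 Ha] := small_powR (geo_delta geo) KM0 eta0.
exists (Num.min r0 (a * r0))%R; split; first by rewrite lt_min r0_gt0 mulr_gt0.
  by rewrite ge_min lexx.
move=> x r Ex rp; rewrite le_min => /andP[rr ra].
apply: (le_trans (geo_dec geo Ex rp rr (lexx _))); apply: le_trans Ha.
rewrite mulrAC; apply: ler_pM; rewrite ?mulr_ge0 ?powR_ge0 ?fine_ge0 ?(ltW K_gt0)//.
  by rewrite ler_pM2l// HM.
apply: ler_powR2; [exact: ltW (geo_delta geo)|by rewrite divr_ge0// ltW|].
by rewrite ler_pdivrMr.
Qed.

Hypothesis dens : measure_density nu E r0.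

(** The tent equals a on the half ball, whose intersection with E carries at least c/K times the
    measure of the ball, by density and doubling. *)
Lemma Lpnorm_tent_ge : exists2 kap : R, (0 < kap)%R &
  forall a x r, (0 < a)%R -> E x -> (0 < r)%R -> (r <= r0)%R ->
  (a * kap * nuB x r `^ q^-1)%:E <= Lpnorm nu E q (limsup_average mu (EFin \o tent a x r)).
Proof.
have [c c0 Hc] := dens; have cK0 : (0 < c / K)%R by rewrite divr_gt0.
exists ((c / K) `^ q^-1)%R; first exact: powR_gt0.
move=> a x r a0 Ex rp rr; rewrite Lpnorm_tent//.
have r20 : (0 < r / 2)%R by rewrite divr_gt0.
have r2r : (r / 2 <= r0)%R by move: rr rp; lra.
apply: (@le_trans _ _ ((a `^ q * (c / K * nuB x r))%:E `^ q^-1)).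
  have kn0 : (0 <= c / K * nuB x r)%R by rewrite (mulr_ge0 (ltW cK0))// fine_ge0.
  rewrite poweR_EFin lee_fin powR_root_mul ?(ltW a0)//.
  by rewrite (powRM _ (ltW cK0)) ?fine_ge0// mulrA.
apply: lee_poweR; first exact: ltW.
  by rewrite lee_fin !mulr_ge0 ?powR_ge0 ?fine_ge0 ?(ltW c0) ?invr_ge0 ?(ltW K_gt0).
apply: le_trans (tent_integral_ge hnu x a0 rp q_gt0 mEN).
rewrite EFinM; apply: lee_wpmul2l; first by rewrite lee_fin powR_ge0.
apply: le_trans (Hc x (r / 2)%R Ex r20 r2r).
rewrite (nuBE geo) ?(le2r0 r2r)// -EFinM lee_fin -mulrA ler_pM2l// mulrC ler_pdivrMr// mulrC.
by have := geo_dbl_nu geo Ex r20 r2r; rewrite mulrCA mulfV// mulr1.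
Qed.

(** Tents of height 1 give kap nu^(1/q) <= D (mu^(1/p) / r + nu). For small radii nu = nu^(1-1/q)
    nu^(1/q) is absorbed on the left; for the others total boundedness bounds mu from below and nu
    from above. *)
Lemma necessary_bounded (Y : @function_space R X) : tests Y -> bounded_embedding mu nu Y E q ->
  ereal_sup [set sup_ratio mu nu E p q r | r in `]0%R, r0[] < +oo.
Proof.
move=> [C1 C10 HY] [Cb Cb0 HB]; have [kap k0 Hk] := Lpnorm_tent_ge.
pose D := (Cb * C1)%R; have D0 : (0 < D)%R by rewrite mulr_gt0.
have key x r : E x -> (0 < r)%R -> (r <= r0)%R ->
    (kap * nuB x r `^ q^-1 <= D * (muB x r `^ p^-1 / r + nuB x r))%R.
  move=> Ex rp rr; have [mem norm] := HY 1%R x r ltr01 Ex rp rr.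
  have := Hk 1%R x r ltr01 Ex rp rr; rewrite mul1r => /le_trans h.
  have [_ /h hb] := HB _ mem.
  rewrite -lee_fin; apply: (le_trans hb); apply: (@le_trans _ _ (Cb%:E * (1 * C1 * (muB x r `^ p^-1 / r + nuB x r))%:E)).
    by apply: lee_wpmul2l => //; rewrite lee_fin ltW.
  by rewrite -EFinM lee_fin /D mul1r mulrA.
have q1 : (0 < 1 - q^-1)%R.
  by rewrite subr_gt0 invf_lt1// (le_lt_trans p_ge1).
(* If nu(B) <= eta, then D nu(B) is at most half of kap nu(B)^(1/q). *)
pose eta := ((kap / (2 * D)) `^ (1 - q^-1)^-1)%R.
have kD0 : (0 < kap / (2 * D))%R by rewrite divr_gt0// mulr_gt0.
have eta0 : (0 < eta)%R by exact: powR_gt0.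
have [r1 [r10 r1r Hr1]] := small_nuB eta0.
have [m m0 Hm] := muB_lower_bound hmu geo tbE r10 r1r.
have [M M0 HM] := nuB_upper_bound.
pose L := Num.max (2 * D / kap)%R (r0 * M `^ q^-1 / m `^ p^-1)%R.
apply: (@le_lt_trans _ _ L%:E); last exact: ltry.
apply: ge_ereal_sup => _ [r /= + <-]; rewrite in_itv /= => /andP[rp /ltW rr].
apply: ge_ereal_sup => _ [x Ex <-]; rewrite (ratioE geo)//; last exact: le2r0.
have mx : (0 < muB x r)%R by apply: (muB_gt0 geo) => //; exact: le2r0.
have nx : (0 < nuB x r)%R by apply: (nuB_gt0 geo) => //; exact: le2r0.
have mp : (0 < muB x r `^ p^-1)%R by exact: powR_gt0.
rewrite lee_fin le_max; have [rs|rb] := leP r r1; apply/orP; [left|right].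
  have Ns : (nuB x r `^ (1 - q^-1) <= kap / (2 * D))%R.
    apply: (le_trans (ler_powR2 (ltW q1) (ltW nx) (Hr1 x r Ex rp rs))).
    by rewrite /eta -powRrM mulVf ?gt_eqF// powRr1 ?(ltW kD0).
  have NE : (nuB x r = nuB x r `^ (1 - q^-1) * nuB x r `^ q^-1)%R.
    by rewrite -powRD ?subrK ?powRr1 ?(ltW nx)// (gt_eqF nx) implybT.
  have bp : (0 < nuB x r `^ q^-1)%R by exact: powR_gt0.
  have DN : (D * nuB x r <= kap / 2 * nuB x r `^ q^-1)%R.
    rewrite {1}NE mulrA ler_pM2r// -ler_pdivlMl// mulrC; apply: (le_trans Ns).
    by apply: eq_ler; field; rewrite gt_eqF.
  have := key x r Ex rp rr; rewrite mulrDr => h.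
  have {}h : (kap / 2 * nuB x r `^ q^-1 <= D * (muB x r `^ p^-1 / r))%R by lra.
  rewrite ler_pdivrMr// -(ler_pM2l (_ : 0 < kap / 2 / r)%R) ?divr_gt0//.
  set b := (nuB x r `^ _)%R in h *; set m' := (muB x r `^ _)%R in h *.
  have -> : (kap / 2 / r * (r * b) = kap / 2 * b)%R by field; rewrite gt_eqF.
  by apply: (le_trans h); apply: eq_ler; field; rewrite !gt_eqF.
have mm : (m <= muB x r)%R.
  apply: (le_trans (Hm x Ex)); apply: (le_muB hmu geo) => //; [exact: le2r0|exact: le2r0|].
  exact/le_ball/ltW.
have NM : (nuB x r <= M)%R.
  apply: le_trans (HM x Ex); apply: (le_nuB hnu geo) => //; [exact: le2r0|exact: le2r0|].
  exact: le_ball.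
apply: ler_pM; rewrite ?mulr_ge0 ?invr_ge0 ?powR_ge0 ?(ltW rp)//.
  by apply: ler_pM; rewrite ?powR_ge0 ?(ltW rp)// ler_powR2 ?fine_ge0 ?(ltW iq0).
by rewrite lef_pV2 ?posrE ?powR_gt0// ler_powR2 ?(ltW ip0) ?(ltW m0).
Qed.

(** If (2) fails uniformly, there are balls with radii tending to 0 and ratio above e, and tents
    over them form the sequence to be tested. *)
Lemma necessary_compact_uniform (Y : @function_space R X) : tests Y ->
  compact_embedding mu nu Y E q -> forall e : R, (0 < e)%R ->
  exists2 r1 : R, (0 < r1)%R & forall x r, E x -> (0 < r)%R -> (r <= r1)%R ->
    (r * nuB x r `^ q^-1 / muB x r `^ p^-1 <= e)%R.
Proof.
move=> [C1 C10 HY] HC e e0; have [kap k0 Hk] := Lpnorm_tent_ge; apply: contrapT => no.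
have /choice[xr Hxr] (n : nat) : exists xr : X * R, [/\ E xr.1, (0 < xr.2)%R, (xr.2 <= r0 / n.+1%:R)%R &
    (e < xr.2 * nuB xr.1 xr.2 `^ q^-1 / muB xr.1 xr.2 `^ p^-1)%R].
  apply: contrapT => nxr; apply: no; exists (r0 / n.+1%:R)%R; first by rewrite divr_gt0.
  move=> x r Ex rp rn; rewrite leNgt; apply/negP => er; apply: nxr.
  by exists (x, r).
pose x n := (xr n).1; pose r n := (xr n).2.
have Ex n : E (x n) by have [] := Hxr n.
have rp n : (0 < r n)%R by have [] := Hxr n.
have rn n : (r n <= r0 / n.+1%:R)%R by have [] := Hxr n.
have er n : (e < r n * nuB (x n) (r n) `^ q^-1 / muB (x n) (r n) `^ p^-1)%R by have [] := Hxr n.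
have rr n : (r n <= r0)%R.
  by apply: (le_trans (rn n)); rewrite ler_pdivrMr// ler_peMr ?ler1n ?(ltW r0_gt0).
have mx n : (0 < muB (x n) (r n))%R by apply: (muB_gt0 geo) => //; exact: le2r0.
have nx n : (0 < nuB (x n) (r n))%R by apply: (nuB_gt0 geo) => //; exact: le2r0.
have mp n : (0 < muB (x n) (r n) `^ p^-1)%R by exact: powR_gt0.
(* The largest heights for which the tents stay bounded in Y.  Their supports
   have vanishing nu-measure, so a limit in L^q would have to be 0, whereas
   their L^q norms stay away from 0. *)
pose a n := Num.min (r n / muB (x n) (r n) `^ p^-1)%R (nuB (x n) (r n))^-1%R.
have a0 n : (0 < a n)%R by rewrite lt_min invr_gt0 nx divr_gt0.
pose u n := EFin \o tent (a n) (x n) (r n).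
have Hu n : fs_mem Y (u n) /\ fs_norm Y (u n) <= (2 * C1)%:E.
  have [mem norm] := HY (a n) (x n) (r n) (a0 n) (Ex n) (rp n) (rr n).
  split => //; apply: (le_trans norm); rewrite lee_fin -mulrA mulrCA mulrC ler_pM2r//.
  rewrite mulrDr -[leRHS]/(1 + 1)%R; apply: lerD.
    apply: (@le_trans _ _ (r n / muB (x n) (r n) `^ p^-1 * (muB (x n) (r n) `^ p^-1 / r n))%R).
      by rewrite ler_pM2r ?divr_gt0// ge_min lexx.
    by apply: eq_ler; field; rewrite !gt_eqF.
  apply: (@le_trans _ _ ((nuB (x n) (r n))^-1 * nuB (x n) (r n))%R).
    by rewrite ler_pM2r// ge_min lexx orbT.
  by rewrite mulVf// gt_eqF.
have [phi [v [phi_incr inL inv vcvg]]] := HC u _ Hu.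
have small eta : (0 < eta)%R -> \forall n \near \oo, (nuB (x n) (r n) <= eta)%R.
  move=> eta0; have [r1 [r10 r1r Hr1]] := small_nuB eta0.
  exists (Num.truncn (r0 / r1)) => // n /= nn; apply: Hr1 => //.
  apply: (le_trans (rn n)); rewrite ler_pdivrMr// mulrC -ler_pdivrMr//.
  by apply/ltW/(lt_le_trans (truncnS_gt _)); rewrite ler_nat ltnS.
have phi_oo (P : nat -> Prop) : (\forall n \near \oo, P n) -> \forall n \near \oo, P (phi n).
  move=> [N _ HN]; exists N => // n /= Nn; apply: HN => /=.
  by apply: (leq_trans Nn); elim: n {Nn} => // n IH; exact: leq_ltn_trans IH (phi_incr _ _ (ltnSn n)).
(* When nu(B) <= 1, both candidates for the height give a nu(B)^(1/q) >= min(e, 1): the first by the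
   choice of the balls, the second because 1/q - 1 < 0. *)
pose k1 := (kap * Num.min e 1)%R; have k10 : (0 < k1)%R by rewrite mulr_gt0// lt_min e0 ltr01.
have lower : \forall n \near \oo, (k1%:E <= Lpnorm nu E q (limsup_average mu (u n))).
  have := small 1%R ltr01; apply: filterS => n n1.
  apply: le_trans (Hk (a n) (x n) (r n) (a0 n) (Ex n) (rp n) (rr n)).
  rewrite lee_fin /k1 (mulrC (a n)) -mulrA ler_pM2l//.
  have np : (0 < nuB (x n) (r n) `^ q^-1)%R by exact: powR_gt0.
  rewrite -ler_pdivrMr// le_min; apply/andP; split.
    rewrite ler_pdivrMr//; apply: (@le_trans _ _ e); first by rewrite ge_min lexx.
    by apply: (le_trans (ltW (er n))); rewrite mulrAC.
  rewrite ler_pdivrMr//; apply: (@le_trans _ _ 1%R); first by rewrite ge_min lexx orbT.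
  rewrite mulrC ler_pdivlMr// mul1r.
  have q1 : (0 <= 1 - q^-1)%R.
    by rewrite subr_ge0 invf_le1// (le_trans p_ge1)// ltW.
  apply: (@le_trans _ _ (nuB (x n) (r n) `^ (1 - q^-1) * nuB (x n) (r n) `^ q^-1)%R).
    by rewrite -powRD ?subrK ?powRr1 ?(ltW (nx n))// (gt_eqF (nx n)) implybT.
  rewrite ler_piMl ?powR_ge0// -[leRHS](one_powR (1 - q^-1)).
  by apply: ler_powR2; rewrite ?(ltW (nx n)).
have [mv voo] := (in_LpP nu v q_gt0 mEN).1 inv.
have mvq : measurable_fun (E : set XN) ((fun y => `|v y| `^ q) : XN -> \bar R).
  apply: (measurableT_comp (measurable_poweR q)).
  exact: (measurableT_comp (@abse_measurable R setT) mv).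
(* Chosen so that 2^q (eta + eta) = k1^q / 2, half of the lower bound. *)
pose eta := (k1 `^ q / (2 `^ q * 4))%R.
have q20 : (0 < (2 : R) `^ q)%R by exact: powR_gt0.
have k1q : (0 < k1 `^ q)%R by exact: powR_gt0.
have eta0 : (0 < eta)%R by rewrite divr_gt0// mulr_gt0.
have [al al0 Hal] := integral_abs_cont mEN mvq (fun y _ => poweR_ge0 _ _) voo eta0.
have t0 : (0 < eta `^ q^-1)%R by exact: powR_gt0.
have close : \forall n \near \oo, Lpnorm nu E q (fun y => limsup_average mu (u (phi n)) y - v y) <
    (eta `^ q^-1)%:E.
  apply: (vcvg [set z | z < (eta `^ q^-1)%:E]); apply: open_nbhs_nbhs.
  by split; [exact: open_ereal_lt_ereal|rewrite /= lte_fin].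
have al20 : (0 < al / 2)%R by rewrite divr_gt0.
have [n [[cl lo] sm]] := filter_ex (filterI (filterI close (phi_oo _ lower)) (phi_oo _ (small _ al20))).
move: cl lo sm; set j := phi n => cl lo sm.
set L := limsup_average mu (u j) in cl lo.
have LE y : E y -> L y = (tent (a j) (x j) (r j) y)%:E.
  by move=> Ey; rewrite /L limsup_average_tent_E.
have mL : measurable_fun (E : set XN) (L : XN -> \bar R) by exact: measurable_limsup_tent.
have mB : measurable (ball (x j) (r j) : set XN) by exact: (measurable_ballX hnu).
have cl' : \int[nu]_(y in (E : set XN)) (`|L y - v y| `^ q) <= eta%:E.
  apply: ltW; have := poweR_root_lt q_gt0 t0 (_ : _ < (eta `^ q^-1)%:E).
  rewrite -powRrM mulVf ?gt_eqF// powRr1 ?(ltW eta0)//; apply.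
  by move: cl; rewrite (LpnormE _ _ q_gt0 mEN).
have sm' : \int[nu]_(y in (E : set XN)) (((fun y => `|v y| `^ q) \_ (ball (x j) (r j))) y) <= eta%:E.
  rewrite -integral_mkcondr; apply/ltW/Hal; [exact: measurableI|exact: subIsetl|].
  apply: (@le_lt_trans _ _ (nu (ball (x j) (r j)))).
    by apply: le_measure; rewrite ?inE//; exact: measurableI.
  rewrite (nuBE geo)//; last exact: le2r0.
  by rewrite lte_fin (le_lt_trans sm)// ltr_pdivrMr// ltr_pMr// ltr1n.
have : Lpnorm nu E q L <= ((k1 `^ q * 2^-1) `^ q^-1)%:E.
  rewrite (LpnormE _ _ q_gt0 mEN) -poweR_EFin; apply: lee_poweR; first exact: ltW.
    by apply: integral_ge0 => y _; exact: poweR_ge0.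
  apply: (@le_trans _ _ ((2 `^ q)%:E * (\int[nu]_(y in (E : set XN)) (`|L y - v y| `^ q) +
     \int[nu]_(y in (E : set XN)) (((fun y => `|v y| `^ q) \_ (ball (x j) (r j))) y)))).
    (* Inside the ball the tent is its difference from v plus v, and v has small norm there by
       absolute continuity; outside the ball the tent vanishes. *)
    apply: ge0_le_integralZD => //.
    - apply: (measurableT_comp (measurable_poweR q)).
      apply: (measurableT_comp (@abse_measurable R setT)).
      by apply: emeasurable_funB; [exact: mL|exact: mv].
    - apply: (@measurable_restrict _ _ XN _ (ball (x j) (r j)) E _ mB mEN).1.
      by apply: (measurable_funS mEN _ mvq); exact: subIsetl.
    - apply: (measurableT_comp (measurable_poweR q)).
      exact: (measurableT_comp (@abse_measurable R setT) mL).
    - by move=> y _; exact: poweR_ge0.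
    - by move=> y _; rewrite patchE; case: ifP => // _; exact: poweR_ge0.
    - by move=> y _; exact: poweR_ge0.
    move=> y Ey; rewrite patchE; case: ifPn => yB.
      apply: le_trans (poweRD_le q_gt0 (abse_ge0 _) (abse_ge0 _)).
      apply: lee_poweR; [exact: ltW|exact: abse_ge0|].
      rewrite LE//; case: (v y) => [w| |] //=; rewrite ?leey//.
      by rewrite -EFinD lee_fin -{1}(subrK w (tent _ _ _ _)) ler_normD.
    rewrite LE// tent_out//; last first.
      by move: yB; rewrite notin_setE ballEmdist /= => /negP; rewrite -leNgt.
    rewrite abse0 poweR0r ?gt_eqF//; apply: mule_ge0; first by rewrite lee_fin powR_ge0.
    by apply: adde_ge0; [exact: poweR_ge0|exact: lexx].
  apply: (@le_trans _ _ ((2 `^ q)%:E * (eta%:E + eta%:E))).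
    by apply: lee_wpmul2l; [rewrite lee_fin ltW|exact: leeD].
  by rewrite -EFinD -EFinM lee_fin; apply: eq_ler; rewrite /eta; field; rewrite gt_eqF.
apply/negP; rewrite -ltNge; apply: lt_le_trans lo; rewrite lte_fin.
rewrite -[ltRHS](powRr1 (ltW k10)) -[X in (_ < _ `^ X)%R](divff (lt0r_neq0 q_gt0)) powRrM.
apply: gt0_ltr_powR => //; rewrite ?nnegrE ?divr_ge0 ?powR_ge0//.
by rewrite ltr_pdivrMr// ltr_pMr// ltr1n.
Qed.

End necessity.

(** * Measure density, and the uniform form of condition (2) *)

Section measure_density.
Context {R : realType} {X : pmetricType R} {Smu Snu : set (set X)}.
Variable mu : {measure set (g_sigma_algebraType Smu) -> \bar R}.
Variable nu : {measure set (g_sigma_algebraType Snu) -> \bar R}.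
Hypotheses (hmu : complete_borel_measure mu) (hnu : complete_borel_measure nu).
Variables (E : set X) (r0 : R).
Hypothesis mE : Snu E.

Lemma measure_density_full : nu (~` E) = 0 -> measure_density nu E r0.
Proof.
move=> nuE; exists 1%R => // x r Ex rp rr; rewrite mul1e.
set XN := g_sigma_algebraType Snu.
have mEN : measurable (E : set XN) by exact: S_measurable.
have mB : measurable (ball x r : set XN) by exact: (measurable_ballX hnu).
have mBE : measurable ((ball x r : set XN) `&` E) by exact: measurableI.
have mC : measurable (~` E : set XN) by exact: measurableC.
apply: (@le_trans _ _ (nu ((ball x r `&` E) `|` ~` E))).
  apply: le_measure; rewrite ?inE//; first exact: measurableU.
  by move=> y yB; have [Ey|nEy] := pselect (E y); [left|right].
rewrite -[leRHS]adde0 -nuE; exact: measureU2.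
Qed.

Variables K delta : R.
Hypothesis geo : geometry mu nu E r0 K delta.
Hypothesis E0 : E !=set0.

Lemma vanishing_of_uniform (p q : R) :
  (forall e : R, (0 < e)%R -> exists2 r1 : R, (0 < r1)%R &
    forall x r, E x -> (0 < r)%R -> (r <= r1)%R ->
    (r * nuB nu x r `^ q^-1 / muB mu x r `^ p^-1 <= e)%R) ->
  sup_ratio mu nu E p q r @[r --> 0^'+] --> 0.
Proof.
move=> H; have r00 := geo_r0 geo; have [x0 Ex0] := E0.
have near_le (e : R) : (0 < e)%R ->
    \forall r \near (0%R : R)^'+, 0 <= sup_ratio mu nu E p q r <= e%:E.
  move=> e0; have [r1 r10 Hr1] := H e e0.
  near=> r.
  have rp : (0 < r)%R by near: r; exact: nbhs_right_gt.
  have rr1 : (r <= r1)%R by near: r; exact: nbhs_right_le.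
  have rr0 : (r <= 2 * r0)%R by near: r; apply: nbhs_right_le; rewrite mulr_gt0.
  apply/andP; split.
    (* A point of E bounds the supremum from below by a nonnegative number; over an empty set it
       would be -oo. *)
    apply: (@le_trans _ _ (r * nuB nu x0 r `^ q^-1 / muB mu x0 r `^ p^-1)%:E).
      by rewrite lee_fin divr_ge0 ?mulr_ge0 ?powR_ge0 ?(ltW rp).
    by rewrite -(ratioE geo)//; apply: ereal_sup_ubound; exists x0.
  apply: ge_ereal_sup => _ [x Ex <-].
  by rewrite (ratioE geo)// lee_fin Hr1.
apply/fine_cvgP; split.
  apply: filterS (near_le _ ltr01) => r /andP[a0 a1].
  by rewrite fin_numElt (lt_le_trans _ a0)?ltNyr// (le_lt_trans a1)// ltry.
apply/cvgrPdist_le => e e0; apply: filterS (near_le _ e0) => r /andP[] /=.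
case: (sup_ratio _ _ _ _ _ _) => [s| |] //=; rewrite !lee_fin => s0 se.
by rewrite sub0r normrN ger0_norm.
Unshelve. all: by end_near. Qed.

End measure_density.

Theorem theorem1p3 (R : realType) (X : pmetricType R) (Smu Snu : set (set X))
    (mu : {measure set (g_sigma_algebraType Smu) -> \bar R})
    (nu : {measure set (g_sigma_algebraType Snu) -> \bar R})
    (hmu : complete_borel_measure mu) (hnu : complete_borel_measure nu)
    (E : set X) (mE : Snu E) (E_gt0 : 0 < nu E)
    (p q r0 : R) (p_ge1 : (1 <= p)%R) (lt_pq : (p < q)%R) (r0_gt0 : (0 < r0)%R)
    (tbE : totally_bounded E)
    (ha : doubling_conditions mu nu E r0)
    (hb : poincare_inequality mu p E r0)
    (Y : @function_space R X)
    (hY : Y = newtonian_space mu p \/ Y = dirichlet_space mu nu p E) :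
  let cond1 : Prop := ereal_sup [set sup_ratio mu nu E p q r | r in `]0%R, r0[] < +oo in
  let cond2 : Prop := sup_ratio mu nu E p q r @[r --> 0^'+] --> 0 in
  [/\ cond1 -> bounded_embedding mu nu Y E q,
      cond2 -> compact_embedding mu nu Y E q &
      measure_density nu E r0 \/ nu (~` E) = 0 ->
      (bounded_embedding mu nu Y E q -> cond1) /\
      (compact_embedding mu nu Y E q -> cond2)].
Proof.
move=> cond1 cond2.
have E0 : E !=set0.
  by apply/set0P/negP => /eqP EE; move: E_gt0; rewrite EE measure0 ltxx.
have [K [delta geo]] := doubling_geometry hmu hnu r0_gt0 E0 ha.
have [C [lam poin]] := admissible_poincare hmu p_ge1 hb (geo_mu geo).
have [_ lam1 _] := poin; have lam0 : (0 < lam)%R := lt_le_trans ltr01 lam1.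
have [loc red] : exists loc, reduces mu nu E p loc Y.
  case: hY => ->; first by exists false; exact: newtonian_reduces.
  by exists true; exact: dirichlet_reduces.
split.
- move=> /(bounded_ratio geo)[A A0 ratio].
  (* The scale r0/(4 lam) meets the requirement 4 lam R0 <= r0 and stays below the radius r0/2 up to
     which (1) has been extracted. *)
  have lamR : (lam * (r0 / (4 * lam)) = r0 / 4)%R by field; rewrite gt_eqF.
  apply: (bounded_of_reduces hmu hnu geo tbE mE p_ge1 lt_pq poin _ _ A0 _ red (R0 := (r0 / (4 * lam))%R)).
  + by rewrite divr_gt0// mulr_gt0.
  + by rewrite lamR; lra.
  + by rewrite lamR; apply: ratio_bound_le ratio; lra.
- move=> /(vanishing_ratio geo) vanish.
  have [R0 [R0_gt0 R0_le ratio]] := exists_scale geo poin vanish ltr01.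
  apply: (compact_of_reduces hmu hnu geo tbE mE p_ge1 lt_pq poin vanish red).
  exact: (bounded_of_reduces hmu hnu geo tbE mE p_ge1 lt_pq poin R0_gt0 R0_le ltr01 ratio red).
- move=> dens0; have dens : measure_density nu E r0.
    by case: dens0 => // nuE; exact: measure_density_full nuE.
  have test : tests mu nu E r0 p Y.
    case: hY => ->; first exact: (newtonian_tests hmu geo p_ge1).
    exact: (dirichlet_tests hmu hnu geo mE p_ge1).
  split=> emb; first exact: (necessary_bounded hmu hnu geo tbE mE p_ge1 lt_pq dens test emb).
  apply: (vanishing_of_uniform geo E0) => e.
  exact: (necessary_compact_uniform hmu hnu geo tbE mE p_ge1 lt_pq dens test emb).
Qed.
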